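(* Let $V$ be the rank two fermion vertex operator superalgebra, let $\alpha,\beta\in\mathbb R$, $\kappa=\beta+\frac12$, $h=\kappa a$, $f=e^{2\pi i\alpha a(0)}$, $\theta=e^{-2\pi i\alpha}$, $\phi=e^{-2\pi i\beta}$. If $(\theta,\phi)\neq(1,1)$ then $$G_{2n,h}(f;x_1,\dots,x_n;y_1,\dots,y_n;\tau)=\det\mathbf P\cdot Z_{V,h}(f;\tau),$$ where $\mathbf P$ is the $n\times n$ matrix $$\mathbf P=\left(P_1\!\left[\begin{array}{c}\theta\\ \phi\end{array}\right](x_i-y_j,\tau)\right)_{1\le i,j\le n}.$$ Furthermore $G_{2n,h}$ is an analytic function in $x_i,y_j$ and converges absolutely and uniformly on compact subsets of the domain $|q|<|q_{x_i-y_j}|<1$ ($1\le i,j\le n$), where $q_z=e^z$.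
   Context: The rank two fermion VOSA $V$ is generated by odd vectors $\psi^\pm$ with $Y(\psi^\pm,z)=\sum_{n\in\mathbb Z}\psi^\pm(n)z^{-n-1}$, with (anti)commutators $[\psi^+(m),\psi^-(n)]=\delta_{m,-n-1}$, $[\psi^\pm(m),\psi^\pm(n)]=0$, $\psi^\pm(k)\mathbf1=0$ for $k\ge0$, and Fock basis $\psi^+(-k_1)\cdots\psi^+(-k_s)\psi^-(-l_1)\cdots\psi^-(-l_t)\mathbf 1$ with $1\le k_1<\dots<k_s$, $1\le l_1<\dots<l_t$. The conformal vector is $\omega=\frac12[\psi^+(-2)\psi^-(-1)+\psi^-(-2)\psi^+(-1)]\mathbf 1$ (central charge $1$, $\psi^\pm$ of $L(0)$-weight $\frac12$). The Heisenberg vector is $a=\psi^+(-1)\psi^-(-1)\mathbf 1$, with $[a(m),a(n)]=m\delta_{m,-n}$ and $a(0)\psi^\pm=\pm\psi^\pm$. For $h=\kappa a$ the shifted conformal vector $\omega_h=\omega+h(-2)\mathbf 1$ has central charge $c_h=1-12\kappa^2$ and $L_h(0)=L(0)-\kappa a(0)$. $\mathrm{STr}_V(X)=\mathrm{Tr}_{V_{\bar 0}}(X)-\mathrm{Tr}_{V_{\bar1}}(X)$. With $\tau$ in the upper half plane, $q=e^{2\pi i\tau}$, $q_i=e^{z_i}$, $q_i^{A}=\exp(z_iA)$, $$F_{V,h}(f;(v_1,z_1),\dots,(v_n,z_n);\tau)=\mathrm{STr}_V\!\left(f\,Y(q_1^{L_h(0)}v_1,q_1)\cdots Y(q_n^{L_h(0)}v_n,q_n)\,q^{L_h(0)-c_h/24}\right),$$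 $$Z_{V,h}(f;\tau)=\mathrm{STr}_V(f q^{L_h(0)-c_h/24})=q^{\kappa^2/2-1/24}\prod_{l\ge1}(1-\theta^{-1}q^{l-\frac12-\kappa})(1-\theta q^{l-\frac12+\kappa}),$$ $$G_{2n,h}(f;x_1,\dots,x_n;y_1,\dots,y_n;\tau)=F_{V,h}(f;(\psi^+,x_1),(\psi^-,y_1),\dots,(\psi^+,x_n),(\psi^-,y_n);\tau)$$ (alternating order). $n$-point functions are regarded as meromorphic functions of the insertion points, by continuation from the region $|q_1|>\dots>|q_n|>|q\,q_1|$ in the operator ordering; the convergence statement refers to the series defining the functions $P_1$ below. Twisted Weierstrass function: for $\phi=e^{2\pi i\lambda}$, $0\le\lambda<1$, $(\theta,\phi)\ne(1,1)$, $$P_1\!\left[\begin{array}{c}\theta\\ \phi\end{array}\right](z,\tau)=-\sum_{n\in\mathbb Z+\lambda}\frac{e^{nz}}{1-\theta^{-1}q^{n}}\quad(|q|<|e^z|<1),\quad q^n=e^{2\pi in\tau},$$ continued meromorphically to $z\in\mathbb C$. *)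

(* Defs.v *)
From HB Require Import structures.
From mathcomp Require Import all_boot all_order all_algebra finmap.
From mathcomp Require Import all_classical all_reals all_analysis.
From mathcomp Require Import complex.

Set Implicit Arguments.
Unset Strict Implicit.
Unset Printing Implicit Defensive.

Import Order.TTheory GRing.Theory Num.Theory numFieldNormedType.Exports.

Local Open Scope classical_set_scope.
Local Open Scope ring_scope.

(* The ascription gives [R[i]] its metric topology.  Norms take values in
   the field itself, and [x < y] on complex numbers holds only when [y - x]
   is a positive real. *)
Definition Cplx (R : realType) : numClosedFieldType := R[i]%C.

Definition ofR (R : realType) (x : R) : Cplx R := Complex x 0.

Definition cexp (R : realType) (z : Cplx R) : Cplx R :=
  ofR (expR (complex.Re z)) *
  Complex (cos (complex.Im z)) (sin (complex.Im z)).

Definition twopii (R : realType) : Cplx R := Complex 0 (2 * pi).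

Definition nome (R : realType) (tau : Cplx R) : Cplx R :=
  cexp (twopii R * tau).

Section Sums.
Variables (R : realType) (I : choiceType).
Local Notation C := (Cplx R).

(* Unconditional (equivalently, absolute) convergence. *)
Definition has_csum (f : I -> C) (s : C) : Prop :=
  forall e : C, 0 < e -> exists A : {fset I}, forall B : {fset I},
    fsubset A B -> `|\sum_(i <- B) f i - s| < e.

Definition csummable (f : I -> C) : Prop := exists s, has_csum f s.

Definition csum (f : I -> C) : C := xget 0 [set s | has_csum f s].

Definition restr (D : set I) (f : I -> C) : I -> C :=
  fun i => if `[< D i >] then f i else 0.

Definition abs_unif_cvg (X : Type) (K : set X) (t : I -> X -> C) : Prop :=
  forall e : C, 0 < e -> exists A : {fset I}, forall B : {fset I},
    fdisjoint A B -> forall x, K x -> \sum_(i <- B) `|t i x| < e.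

End Sums.

Section Analytic.
Variable R : realType.
Local Notation C := (Cplx R).

Definition analytic1_at (f : C -> C) (a : C) : Prop :=
  exists (c : nat -> C) (r : C), 0 < r /\
    forall h : C, `|h| < r -> has_csum (fun k => c k * h ^+ k) (f (a + h)).

(* Every point is a point of analyticity or a pole (of order [k > 0]); the
   value of [f] at a pole is unconstrained. *)
Definition meromorphic1 (f : C -> C) : Prop :=
  forall a, analytic1_at f a \/
    exists (k : nat) (g : C -> C), [/\ (0 < k)%N, analytic1_at g a, g a != 0 &
      \forall z \near a, z != a -> f z = g z / (z - a) ^+ k].

Definition analytic_at (m : nat) (f : 'rV[C]_m -> C) (a : 'rV[C]_m) : Prop :=
  exists (c : {ffun 'I_m -> nat} -> C) (r : C), 0 < r /\
    forall h : 'rV[C]_m, (forall i, `|h 0 i| < r) ->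
      has_csum (fun k => c k * \prod_(i < m) h 0 i ^+ k i) (f (a + h)).

(* Local quotients of analytic functions with denominators not identically
   zero near any point. *)
Definition meromorphic (m : nat) (f : 'rV[C]_m -> C) : Prop :=
  forall a, exists g d : 'rV[C]_m -> C,
    [/\ analytic_at g a, analytic_at d a,
        (forall U, nbhs a U -> exists2 p, U p & d p != 0) &
        \forall p \near a, d p != 0 -> f p = g p / d p].

Definition mero_continuation1 (D : set C) (f0 f : C -> C) : Prop :=
  meromorphic1 f /\ {in D, f =1 f0}.

Definition mero_continuation (m : nat) (D : set 'rV[C]_m)
    (f0 f : 'rV[C]_m -> C) : Prop :=
  meromorphic f /\ {in D, f =1 f0}.

End Analytic.

Section P1.
Variable R : realType.
Local Notation C := (Cplx R).

Definition twist (phi : C) : R :=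
  xget 0 [set l : R | 0 <= l < 1 /\ phi = cexp (twopii R * ofR l)].

Definition P1_term (theta phi tau : C) (k : int) (z : C) : C :=
  let n := ofR (k%:~R + twist phi) in
  cexp (n * z) / (1 - theta^-1 * cexp (twopii R * n * tau)).

Definition P1_series (theta phi tau z : C) : C :=
  - csum (fun k : int => P1_term theta phi tau k z).

Definition P1 (theta phi tau : C) : C -> C :=
  xget (fun=> 0)
    [set f | mero_continuation1
       [set z | `|nome tau| < `|cexp z| < 1] (P1_series theta phi tau) f].

End P1.

Section VOSA.
Variable K : numFieldType.

Definition gbinom (m : int) (j : nat) : K :=
  (\prod_(i < j) (m%:~R - i%:R)) / (j`!)%:R.

(* [mode u n] is u(n) in Y(u,z) = sum_n u(n) z^(-n-1); the even and odd parts
   of the superspace are [sector false] and [sector true].  Both sums in the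
   Jacobi (Borcherds) identity are finite by truncation, hence the
   "for J large enough". *)
Record vosa := Vosa {
  carrier :> lmodType K;
  mode : carrier -> int -> carrier -> carrier;
  vacuum : carrier;
  omega : carrier;
  charge : K;
  sector : bool -> set carrier;
  vosa_sector0 : forall p, sector p 0;
  vosa_sectorD : forall p (a : K) u v,
    sector p u -> sector p v -> sector p (a *: u + v);
  vosa_sector_span : forall v,
    exists v0 v1, [/\ sector false v0, sector true v1 & v = v0 + v1];
  vosa_sector_direct : forall v, sector false v -> sector true v -> v = 0;
  vosa_mode_linearl : forall (a : K) u v n w,
    mode (a *: u + v) n w = a *: mode u n w + mode v n w;
  vosa_mode_linearr : forall u n (a : K) v w,
    mode u n (a *: v + w) = a *: mode u n v + mode u n w;
  vosa_mode_parity : forall p p' u n v,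
    sector p u -> sector p' v -> sector (p (+) p') (mode u n v);
  vosa_truncation : forall u v,
    exists N : int, forall n, N <= n -> mode u n v = 0;
  vosa_vacuum_even : sector false vacuum;
  vosa_vacuum : forall n v, mode vacuum n v = if n == -1 then v else 0;
  vosa_creation : forall v, mode v (-1) vacuum = v;
  vosa_creation0 : forall v n, 0 <= n -> mode v n vacuum = 0;
  vosa_jacobi : forall p p' u v, sector p u -> sector p' v ->
    forall (l m n : int) w, exists N : nat, forall J : nat, (N <= J)%N ->
    \sum_(j < J) gbinom m j *: mode (mode u (l + j%:Z) v) (m + n - j%:Z) w =
    \sum_(j < J) ((-1) ^+ j * gbinom l j) *:
      (mode u (m + l - j%:Z) (mode v (n + j%:Z) w) -
       ((-1) ^ l * (-1) ^+ (p && p')) *: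
         mode v (n + l - j%:Z) (mode u (m + j%:Z) w));
  vosa_omega_even : sector false omega;
  vosa_virasoro : forall (m n : int) v,
    mode omega (m + 1) (mode omega (n + 1) v) -
    mode omega (n + 1) (mode omega (m + 1) v) =
    (m - n)%:~R *: mode omega (m + n + 1) v +
    (if m + n == 0 then (m ^+ 3 - m)%:~R / 12 * charge else 0) *: v;
  vosa_translation : forall v n w,
    mode (mode omega 0 v) n w = - n%:~R *: mode v (n - 1) w;
  vosa_grading_span : forall v, exists s : seq carrier,
    (forall u, u \in s -> exists k : int, mode omega 1 u = (k%:~R / 2) *: u) /\
    v = \sum_(u <- s) u;
  vosa_grading_finite : forall k : int, exists s : seq carrier,
    forall v, mode omega 1 v = (k%:~R / 2) *: v ->
    exists c : nat -> K, v = \sum_(i < size s) c i *: s`_i;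
  vosa_grading_bounded : exists k0 : int, forall (k : int) v,
    k < k0 -> mode omega 1 v = (k%:~R / 2) *: v -> v = 0
}.

Section Basis.
Variables (V : lmodType K) (I : choiceType) (e : I -> V).

Definition is_coord (v : V) (c : I -> K) : Prop :=
  finite_set [set i | c i != 0] /\ v = \sum_(i \in [set: I]) c i *: e i.

Definition is_basis : Prop := forall v, exists! c, is_coord v c.

Definition coord_in (v : V) : I -> K := xget (fun=> 0) (is_coord v).

End Basis.

(* Strictly increasing sequences of positive integers: [path ltn 0 s] reads
   0 < k_1 < k_2 < ... *)
Definition fock_seq := {s : seq nat | path ltn 0%N s}.
Definition fock_index := (fock_seq * fock_seq)%type.

Section Fermion.
Variables (V : vosa) (psip psim : V).

(* psip(-k_1)...psip(-k_s) psim(-l_1)...psim(-l_t) 1 *)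
Definition fock (b : fock_index) : V :=
  foldr (fun k => mode psip (- k%:Z))
    (foldr (fun l => mode psim (- l%:Z)) (vacuum V) (val b.2)) (val b.1).

Record rank_two_fermion : Prop := RankTwoFermion {
  fermion_psip_odd : sector true psip;
  fermion_psim_odd : sector true psim;
  fermion_pm : forall (m n : int) (v : V),
    mode psip m (mode psim n v) + mode psim n (mode psip m v) =
    if m == - n - 1 then v else 0;
  fermion_pp : forall (m n : int) (v : V),
    mode psip m (mode psip n v) + mode psip n (mode psip m v) = 0;
  fermion_mm : forall (m n : int) (v : V),
    mode psim m (mode psim n v) + mode psim n (mode psim m v) = 0;
  fermion_fock : is_basis fock;
  fermion_omega : omega V =
    2^-1 *: (mode psip (-2) (mode psim (-1) (vacuum V)) +
             mode psim (-2) (mode psip (-1) (vacuum V)))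
}.

Definition heis : V := mode psip (-1) (mode psim (-1) (vacuum V)).

Definition omega_shift (kappa : K) : V :=
  omega V + mode (kappa *: heis) (-2) (vacuum V).

Definition Lh0 (kappa : K) : V -> V := mode (omega_shift kappa) 1.

Definition charge_shift (kappa : K) : K := 1 - 12 * kappa ^+ 2.

End Fermion.

End VOSA.

Section Torus.
Variable R : realType.
Local Notation C := (Cplx R).

(* exp(zA) for a diagonalizable operator A: the linear operator acting on the
   mu-eigenspace of A as e^(z mu). *)
Definition expop (V : lmodType C) (z : C) (A : V -> V) : V -> V :=
  xget (fun=> 0) [set E : V -> V |
    (forall (a : C) u v, E (a *: u + v) = a *: E u + E v) /\
    (forall (mu : C) v, A v = mu *: v -> E v = cexp (z * mu) *: v)].

Variables (V : vosa C) (psip psim : V).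
Local Notation e := (fock psip psim).

(* Diagonal entries of [X] in the Fock basis, whose vectors are homogeneous
   for the parity. *)
Definition diag_entry (X : V -> V) (b : fock_index) : C :=
  coord_in e (X (e b)) b.

Definition traceable (X : V -> V) : Prop := csummable (diag_entry X).

Definition trace_on (p : bool) (X : V -> V) : C :=
  csum (restr [set b | sector p (e b)] (diag_entry X)).

Definition STr (X : V -> V) : C := trace_on false X - trace_on true X.

Variables (kappa : C) (f : V -> V).

Definition qL (tau : C) : V -> V :=
  expop (twopii R * tau)
    (fun v => Lh0 psip psim kappa v - (charge_shift kappa / 24) *: v).

Definition Z_fun (tau : C) : C := STr (f \o qL tau).

Section Npoint.
Variables (vz : seq (V * C)) (tau : C).

(* f v'_1(m_1)...v'_n(m_n) q^(L_h(0) - c_h/24), with v'_i = q_i^(L_h(0)) v_i. *)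
Definition mode_product (ms : seq int) (w : V) : V :=
  f (foldr (fun p : (V * C) * int =>
              mode (expop p.1.2 (Lh0 psip psim kappa) p.1.1) p.2)
       (qL tau w) (zip vz ms)).

Definition npoint_term (ms : seq int) : C :=
  (\prod_(p <- zip vz ms) cexp p.1.2 ^ (- p.2 - 1)) * STr (mode_product ms).

Definition mode_seqs : set (seq int) := [set ms | size ms = size vz].

Definition npoint_cvg : Prop :=
  (forall ms, mode_seqs ms -> traceable (mode_product ms)) /\
  csummable (restr mode_seqs npoint_term).

(* The series F_{V,h}(f; vz; tau), in the given operator ordering. *)
Definition npoint : C := csum (restr mode_seqs npoint_term).

End Npoint.

Definition op_ordered (zs : seq C) (tau : C) : bool :=
  sorted (fun z w => `|cexp w| < `|cexp z|) zs &&
  (`|nome tau * cexp (head 0 zs)| < `|cexp (last 0 zs)|).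

(* The 2n insertion points are packed in one row vector (x | y). *)
Section Generating.
Variables (n : nat) (tau : C).
Implicit Type p : 'rV[C]_(n + n).

Definition xpt p (i : 'I_n) : C := p 0 (lshift n i).
Definition ypt p (j : 'I_n) : C := p 0 (rshift n j).

Definition insertions p : seq (V * C) :=
  flatten [seq [:: (psip, xpt p i); (psim, ypt p i)] | i <- enum 'I_n].

Definition G_region : set 'rV[C]_(n + n) :=
  [set p | op_ordered (unzip2 (insertions p)) tau].

Definition G_series p : C := npoint (insertions p) tau.

(* [G] is the meromorphic function G_{2n,h}: its defining series converges in
   the operator-ordering region, and [G] is its continuation. *)
Definition is_G (G : 'rV[C]_(n + n) -> C) : Prop :=
  (forall p, G_region p -> npoint_cvg (insertions p) tau) /\
  mero_continuation G_region G_series G.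

Definition P_matrix (theta phi : C) p : 'M[C]_n :=
  \matrix_(i, j) P1 theta phi tau (xpt p i - ypt p j).

Definition P_domain : set 'rV[C]_(n + n) :=
  [set p | forall i j, `|nome tau| < `|cexp (xpt p i - ypt p j)| < 1].

End Generating.

End Torus.

(* Main.v *)
Require Import Defs.
From HB Require Import structures.
From mathcomp Require Import fingroup perm.
From mathcomp Require Import all_boot all_order all_algebra finmap.
From mathcomp Require Import all_classical all_reals all_analysis.
From mathcomp Require Import complex.
From mathcomp Require Import ring lra zify.

Set Implicit Arguments.
Unset Strict Implicit.
Unset Printing Implicit Defensive.

Import Order.TTheory GRing.Theory Num.Theory numFieldNormedType.Exports.

Local Open Scope classical_set_scope.
Local Open Scope ring_scope.

(** Every mode of [psi^+] or [psi^-] maps a Fock vector to a scalar multiple of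
    the vector with one level toggled, so a product of modes has matrix entries
    of modulus at most 1 and all traces are dominated by the product
    [prod_k (1 + a_k)] of the weights of the levels.  Moving the first mode of a
    word around the supertrace multiplies it by [theta^{-+1} q^{-+N}]; comparing
    with the anticommutators expresses the trace of a word through shorter words,
    and expanding a determinant along its first row or column gives the same
    recursion.  Hence the trace of an alternating word is [Z] times a determinant
    of two-point coefficients [1 / (1 - theta q^N) - [j < i]].

    Summing over the modes, the entry [(i, j)] becomes one of the two Laurent
    expansions of a single function: for [i <= j] the one in
    [1 < |e^z| < |q|^-1], for [j < i] the one in [|q| < |e^z| < 1], with
    [z = x_i - y_j].  Splitting a geometric series off the second expansion shows
    that both come from one function on [|q| < |e^z| < |q|^-1], quasi-periodic
    under [z -> z + 2 pi i tau], hence meromorphic on the plane; by the identity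
    theorem it is [P1]. *)

(** * Unconditional sums of complex families *)

(** Three obstacles shape the argument. Deleting two letters from an alternating word destroys the
    alternation, so the determinant formula is proved for every word with equally many letters of
    each sign, at the price of an overall sign and of entries that depend on the order of the two
    letters. Fock signs are never computed: bounding coefficients by 1 settles convergence, and
    cyclicity of the supertrace is a reindexing of an absolutely convergent sum by an involution of
    the basis. Finally, [P1] is only some chosen continuation, with free values at its poles;
    comparisons therefore hold on punctured neighbourhoods, and a pole has to be excluded before a
    value can be used. The shift [kappa = beta + 1/2] turns the half-integral weights of the
    fermions into exponents [n] in Z + lambda, where lambda represents [- beta] modulo 1. The
    recursion for traces can be solved when [theta^-1 q^n] is never 1, and this is exactly what the
    condition on [(theta, phi)] says. *)

Section Nrm.
Variable R : realType.
Local Notation C := (Cplx R).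
(** Norms in [Cplx R] are complex and only partially ordered; a real-valued modulus gives access to
    [lra], suprema and the real exponential. *)
Definition nrm (z : C) : R := complex.Re `|z|.

Lemma normE (z : C) : `|z| = ofR (nrm z).
Proof. by rewrite /nrm normc_def. Qed.

Lemma ofRD (x y : R) : ofR (x + y) = ofR x + ofR y.
Proof. by apply/eqP; rewrite eq_complex /= addr0 !eqxx. Qed.
Lemma ofRN (x : R) : ofR (- x) = - ofR x.
Proof. by apply/eqP; rewrite eq_complex /= oppr0 !eqxx. Qed.
Lemma ofRM (x y : R) : ofR (x * y) = ofR x * ofR y.
Proof. by apply/eqP; rewrite eq_complex /= !(mul0r,mulr0,addr0,subr0,add0r) !eqxx. Qed.
Lemma ltr_ofR (x y : R) : (ofR x < ofR y) = (x < y).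
Proof. by rewrite ltcE /= eqxx. Qed.
Lemma ler_ofR (x y : R) : (ofR x <= ofR y) = (x <= y).
Proof. by rewrite lecE /= eqxx. Qed.
Lemma pos_ofR (e : C) : 0 < e -> e = ofR (complex.Re e) /\ 0 < complex.Re e.
Proof.
rewrite ltcE /= => /andP[/eqP h0 h1]; split => //.
by apply/eqP; rewrite eq_complex /= h0 !eqxx.
Qed.
Lemma nrm_ge0 (z : C) : 0 <= nrm z.
Proof. by rewrite -ler_ofR -normE; exact: normr_ge0. Qed.
Lemma nrmM (z w : C) : nrm (z * w) = nrm z * nrm w.
Proof. by apply: (@complexI R); rewrite -[LHS]normE -[RHS]/(ofR _) ofRM -!normE normrM. Qed.
Lemma nrmD (z w : C) : nrm (z + w) <= nrm z + nrm w.
Proof. by rewrite -ler_ofR ofRD -!normE ler_normD. Qed.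
Lemma nrmN (z : C) : nrm (- z) = nrm z.
Proof. by rewrite /nrm normrN. Qed.
Lemma nrm0 : nrm 0 = 0. Proof. by rewrite /nrm normr0. Qed.
Lemma nrm1 : nrm 1 = 1. Proof. by rewrite /nrm normr1. Qed.
Lemma nrm_eq0 (z : C) : (nrm z == 0) = (z == 0).
Proof.
rewrite -[RHS]normr_eq0 normE; apply/eqP/eqP => [->//|h].
by have := congr1 (@complex.Re R) h.
Qed.
Lemma nrmV (z : C) : nrm z^-1 = (nrm z)^-1.
Proof.
have [->|z0] := eqVneq z 0; first by rewrite invr0 nrm0 invr0.
have h : nrm z != 0 by rewrite nrm_eq0.
by apply: (mulfI h); rewrite -nrmM !divff // nrm1.
Qed.
Lemma nrmX (z : C) n : nrm (z ^+ n) = nrm z ^+ n.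
Proof. by elim: n => [|n IH]; rewrite ?expr0 ?nrm1 // !exprS nrmM IH. Qed.
Lemma nrm_sum I (r : seq I) (P : pred I) (F : I -> C) :
  nrm (\sum_(i <- r | P i) F i) <= \sum_(i <- r | P i) nrm (F i).
Proof.
elim/big_ind2: _ => [|x a y b h1 h2|//]; first by rewrite nrm0.
by apply: le_trans (nrmD _ _) _; apply: lerD.
Qed.
Lemma nrm_prod I (r : seq I) (P : pred I) (F : I -> C) :
  nrm (\prod_(i <- r | P i) F i) = \prod_(i <- r | P i) nrm (F i).
Proof. by elim/big_ind2: _ => [|x a y b <- <-|//]; rewrite ?nrm1 ?nrmM. Qed.
Lemma nrm_ofR (x : R) : nrm (ofR x) = `|x|.
Proof. by rewrite /nrm normc_def /= expr0n addr0 sqrtr_sqr. Qed.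
Lemma nrm_Re (z : C) : `|complex.Re z| <= nrm z.
Proof.
by rewrite /nrm normc_def /= -[X in X <= _]sqrtr_sqr ler_wsqrtr // lerDl sqr_ge0.
Qed.
Lemma nrm_Im (z : C) : `|complex.Im z| <= nrm z.
Proof.
by rewrite /nrm normc_def /= -[X in X <= _]sqrtr_sqr ler_wsqrtr // lerDr sqr_ge0.
Qed.
Lemma nrmB (z w : C) : nrm (z - w) = nrm (w - z).
Proof. by rewrite -nrmN opprB. Qed.
Lemma nrm_tri (z w : C) : nrm z - nrm w <= nrm (z - w).
Proof. by rewrite lerBlDr; apply: le_trans (nrmD _ _); rewrite subrK. Qed.
Lemma nrmReIm (z : C) : nrm z <= `|complex.Re z| + `|complex.Im z|.
Proof.
have -> : z = ofR (complex.Re z) + ofR (complex.Im z) * Complex 0 1.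
  by case: z => a b; apply/eqP; rewrite eq_complex /= !(mul0r,mulr0,addr0,subr0,add0r,mulr1) !eqxx.
apply: le_trans (nrmD _ _) _.
have i1 : nrm (Complex 0 1 : C) = 1 by rewrite /nrm normc_def /= expr0n expr1n add0r sqrtr1.
by rewrite nrmM !nrm_ofR i1 mulr1 /= !(mul0r,mulr0,addr0,subr0,add0r,mulr1).
Qed.
Lemma nrm_lt (z : C) (e : R) : (`|z| < ofR e) = (nrm z < e).
Proof. by rewrite normE ltr_ofR. Qed.
Lemma nrm_small (z : C) : (forall e : R, 0 < e -> nrm z < e) -> z = 0.
Proof.
move=> h; apply/eqP; rewrite -nrm_eq0; apply/negP => /negP h0.
by have := h (nrm z); rewrite lt_def h0 nrm_ge0 ltxx => /(_ isT).
Qed.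
End Nrm.

Section Sums.
Variable R : realType.
Local Notation C := (Cplx R).
Implicit Type I : choiceType.

Definition abs_bounded I (f : I -> C) (M : R) : Prop :=
  forall A : {fset I}, \sum_(i <- A) nrm (f i) <= M.
Definition abs_summable I (f : I -> C) : Prop := exists M, abs_bounded f M.

Lemma has_csumP I (f : I -> C) (s : C) :
  has_csum f s <-> forall e : R, 0 < e -> exists A : {fset I}, forall B : {fset I},
    fsubset A B -> nrm (\sum_(i <- B) f i - s) < e.
Proof.
split=> h e e0.
  have [|A hA] := h (ofR e); first by rewrite ltr_ofR.
  by exists A => B /hA; rewrite nrm_lt.
have [ee e1] := pos_ofR e0.
by have [A hA] := h _ e1; exists A => B /hA; rewrite ee nrm_lt.
Qed.

Lemma has_csum_uniq I (f : I -> C) s t : has_csum f s -> has_csum f t -> s = t.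
Proof.
move=> /has_csumP hs /has_csumP ht; apply/eqP; rewrite -subr_eq0; apply/eqP.
apply: nrm_small => e e0.
have e2 : 0 < e / 2 by rewrite divr_gt0.
have [A hA] := hs _ e2; have [B hB] := ht _ e2.
have h1 := hA _ (fsubsetUl A B); have h2 := hB _ (fsubsetUr A B).
set S := \sum_(i <- _) f i in h1 h2.
have -> : s - t = (S - t) - (S - s) by ring.
by rewrite (splitr e); apply: le_lt_trans (nrmD _ _) _; rewrite nrmN ltrD.
Qed.

Lemma csumE I (f : I -> C) s : has_csum f s -> csum f = s.
Proof.
by move=> h; rewrite /csum; apply: xget_unique => // t /= /has_csum_uniq; apply.
Qed.

Lemma csumP I (f : I -> C) : csummable f -> has_csum f (csum f).
Proof. by case=> s h; rewrite (csumE h). Qed.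

Lemma has_csumD I (f g : I -> C) s t : has_csum f s -> has_csum g t ->
  has_csum (fun i => f i + g i) (s + t).
Proof.
move=> /has_csumP hs /has_csumP ht; apply/has_csumP => e e0.
have e2 : 0 < e / 2 by rewrite divr_gt0.
have [A hA] := hs _ e2; have [B hB] := ht _ e2.
exists (A `|` B)%fset => D; rewrite fsubUset => /andP[/hA h1 /hB h2].
rewrite big_split /= opprD addrACA (splitr e).
by apply: le_lt_trans (nrmD _ _) _; rewrite ltrD.
Qed.

Lemma has_csumZ I (f : I -> C) s a : has_csum f s ->
  has_csum (fun i => a * f i) (a * s).
Proof.
move=> /has_csumP hs; apply/has_csumP => e e0.
have h0 : 0 < e / (nrm a + 1) by rewrite divr_gt0 // ltr_wpDl // nrm_ge0.
have [A hA] := hs _ h0; exists A => B /hA.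
rewrite -mulr_sumr -mulrBr nrmM ltr_pdivlMr ?ltr_wpDl ?nrm_ge0 // mulrC.
by apply: le_lt_trans; rewrite ler_wpM2r ?nrm_ge0 // lerDl.
Qed.

Lemma has_csum0 I (f : I -> C) : (forall i, f i = 0) -> has_csum f 0.
Proof.
move=> h; apply/has_csumP => e e0; exists fset0 => B _.
by rewrite big1 ?subr0 ?nrm0.
Qed.

Lemma has_csum_ext I (f g : I -> C) s : f =1 g -> has_csum f s -> has_csum g s.
Proof. by move=> /funext ->. Qed.

Lemma has_csumN I (f : I -> C) s : has_csum f s -> has_csum (fun i => - f i) (- s).
Proof.
move=> /(has_csumZ (-1)); rewrite mulN1r; apply: has_csum_ext => i.
by rewrite mulN1r.
Qed.

Lemma has_csumB I (f g : I -> C) s t : has_csum f s -> has_csum g t ->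
  has_csum (fun i => f i - g i) (s - t).
Proof. by move=> hf /has_csumN; exact: has_csumD. Qed.

Lemma has_csum_sum I (J : Type) (r : seq J) (P : pred J) (f : J -> I -> C) (s : J -> C) :
  (forall j, has_csum (f j) (s j)) ->
  has_csum (fun i => \sum_(j <- r | P j) f j i) (\sum_(j <- r | P j) s j).
Proof.
move=> h; elim: r => [|j r IH].
  by rewrite big_nil; apply: has_csum0 => i; rewrite big_nil.
rewrite big_cons; case: ifPn => hj.
  by apply: has_csum_ext (has_csumD (h j) IH) => i; rewrite big_cons hj.
by apply: has_csum_ext IH => i; rewrite big_cons (negbTE hj).
Qed.

Lemma has_csum_le I (f : I -> C) s (M : R) : has_csum f s ->
  (forall A : {fset I}, nrm (\sum_(i <- A) f i) <= M) -> nrm s <= M.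
Proof.
move=> /has_csumP hs hM; rewrite leNgt; apply/negP => hlt.
have [|A hA] := hs (nrm s - M); first by rewrite subr_gt0.
have := hA A (fsubset_refl _); rewrite nrmB => h1.
have := nrm_tri s (\sum_(i <- A) f i); have := hM A; lra.
Qed.

Lemma le_sum_fset I (f : I -> R) (A B : {fset I}) : (forall i, 0 <= f i) ->
  fsubset A B -> \sum_(i <- A) f i <= \sum_(i <- B) f i.
Proof.
move=> f0 hAB; rewrite [X in _ <= X](big_fsetID _ (mem A)) /=.
have -> : [fset x in B | x \in A]%fset = A.
  apply/fsetP => x; rewrite !inE /=; case: (boolP (x \in A)) => xA; rewrite ?andbF ?andbT //.
  exact: (fsubsetP hAB).
by rewrite lerDl sumr_ge0.
Qed.

(** The finite partial sums are directed and bounded, so their supremum is the sum. *)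
Lemma nonneg_has_csum I (f : I -> R) M : (forall i, 0 <= f i) ->
  (forall A : {fset I}, \sum_(i <- A) f i <= M) ->
  csummable (fun i => ofR (f i)).
Proof.
move=> f0 hM; pose S : set R := [set x | exists A : {fset I}, x = \sum_(i <- A) f i].
have hS : has_sup S.
  split; first by exists (\sum_(i <- fset0) f i), fset0.
  by exists M => x [A ->].
exists (ofR (sup S)); apply/has_csumP => e e0.
have [_ [A ->] hA] := sup_adherent e0 hS.
exists A => B hAB.
have h1 : \sum_(i <- A) f i <= \sum_(i <- B) f i by exact: le_sum_fset.
have h2 : \sum_(i <- B) f i <= sup S by apply: sup_upper_bound => //; exists B.
have -> : \sum_(i <- B) ofR (f i) = ofR (\sum_(i <- B) f i).
  by elim/big_rec2: _ => [|i x y _ ->]; rewrite ?ofRD.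
rewrite -ofRN -ofRD nrm_ofR distrC ger0_norm ?subr_ge0 //; lra.
Qed.

(** A real family [g] with [|g| <= nrm f] is the difference of the nonnegative families [nrm f + g]
    and [nrm f]; this is applied to the real and the imaginary part. *)
Lemma abs_summable_csummable I (f : I -> C) : abs_summable f -> csummable f.
Proof.
move=> [M hM].
have key (g : I -> R) : (forall i, `|g i| <= nrm (f i)) ->
    csummable (fun i => ofR (g i)).
  move=> hg.
  have [s hs] : csummable (fun i => ofR (nrm (f i))).
    by apply: nonneg_has_csum hM => i; exact: nrm_ge0.
  have [t ht] : csummable (fun i => ofR (nrm (f i) + g i)).
    apply: (@nonneg_has_csum _ _ (M + M)) => [i|A].
      by have := hg i; rewrite ler_norml => /andP[]; lra.
    apply: le_trans (lerD (hM A) (hM A)); rewrite -big_split; apply: ler_sum => i _.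
    by rewrite lerD2l; apply: le_trans (ler_norm _) (hg i).
  exists (t - s); apply: has_csum_ext (has_csumB ht hs) => i.
  by rewrite ofRD addrAC subrr add0r.
have [s hs] := key (fun i => complex.Re (f i)) (fun i => nrm_Re (f i)).
have [t ht] := key (fun i => complex.Im (f i)) (fun i => nrm_Im (f i)).
exists (s + Complex 0 1 * t); apply: has_csum_ext (has_csumD hs (has_csumZ (Complex 0 1) ht)) => i.
case: (f i) => a b; apply/eqP.
by rewrite eq_complex /= !(mul0r,mulr0,addr0,subr0,add0r,mul1r) !eqxx.
Qed.

Lemma abs_summable_le I (f : I -> C) (g : I -> C) : (forall i, nrm (f i) <= nrm (g i)) -> abs_summable g -> abs_summable f.
Proof.
move=> h [M hM]; exists M => A; apply: le_trans (hM A); exact: ler_sum.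
Qed.

Lemma fset_sum_filter I (V : nmodType) (A : {fset I}) (P : pred I) (F : I -> V) :
  \sum_(i <- A | P i) F i = \sum_(i <- [fset i in A | P i]%fset) F i.
Proof. by rewrite -big_fset_condE. Qed.

(** Off a finite set every finite subsum has modulus at most 2. Applied to the indices where the
    real or the imaginary part has a fixed sign, this bounds the sum of absolute values. *)
Lemma csummable_abs_summable I (f : I -> C) : csummable f -> abs_summable f.
Proof.
move=> [s /has_csumP hs]; have [A hA] := hs 1 ltr01.
have hB (B : {fset I}) : fdisjoint A B -> nrm (\sum_(i <- B) f i) <= 2.
  move=> dAB; have h1 := hA _ (fsubset_refl A); have h2 := hA _ (fsubsetUl A B).
  rewrite (big_fsetID _ (mem A)) /= in h2.
  have e1 : [fset x in (A `|` B)%fset | x \in A]%fset = A.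
    by apply/fsetP => x; rewrite !inE /= andbC; case: (x \in A); rewrite ?andbF.
  have e2 : [fset x in (A `|` B)%fset | x \notin A]%fset = B.
    apply/fsetP => x; rewrite !inE /=; case: (boolP (x \in A)) => xA /=; rewrite ?andbT ?andbF //.
    by apply/esym/negbTE; apply: (fdisjointP dAB).
  rewrite e1 e2 in h2; set S := \sum_(i <- A) f i in h1 h2.
  set U := \sum_(i <- B) f i in h2 *.
  have -> : U = (S + U - s) - (S - s) by ring.
  by apply: le_trans (nrmD _ _) _; rewrite nrmN; lra.
have key (g : C -> R) : (forall z, `|g z| <= nrm z) -> (forall z w, g (z + w) = g z + g w) ->
    forall B : {fset I}, fdisjoint A B -> \sum_(i <- B) `|g (f i)| <= 4.
  move=> g1 gD B dAB.
  have g0 : g 0 = 0 by apply: (@addrI _ (g 0)); rewrite -gD !addr0.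
  have gsum (D : {fset I}) : \sum_(i <- D) g (f i) = g (\sum_(i <- D) f i).
    by elim/big_rec2: _ => [|i x y _ ->]; rewrite ?gD.
  have sub (P : pred I) : fdisjoint A [fset i in B | P i]%fset.
    apply/fdisjointP => x /(fdisjointP dAB); rewrite !inE /= => /negbTE ->//.
  rewrite (bigID (fun i => 0 <= g (f i))) /=.
  have -> : (4 : R) = 2 + 2 by rewrite -natrD.
  apply: lerD.
    rewrite (eq_bigr (fun i => g (f i))) => [|i hi]; last by rewrite ger0_norm.
    rewrite fset_sum_filter gsum; apply: le_trans (ler_norm _) _.
    by apply: le_trans (g1 _) _; apply: hB.
  rewrite (eq_bigr (fun i => - g (f i))) => [|i hi]; last first.
    by rewrite ltr0_norm // ltNge.
  rewrite sumrN fset_sum_filter gsum; apply: le_trans (ler_norm _) _.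
  by rewrite normrN; apply: le_trans (g1 _) _; apply: hB.
(* Real and imaginary parts contribute 4 each, namely 2 for each sign. *)
exists (\sum_(i <- A) nrm (f i) + 8) => B.
rewrite (big_fsetID _ (mem A)) /=; apply: lerD.
  apply: le_sum_fset => [i|]; first exact: nrm_ge0.
  by apply/fsubsetP => x; rewrite !inE /= => /andP[].
set D := [fset x in B | _]%fset.
have dAD : fdisjoint A D by apply/fdisjointP => x; rewrite !inE /= => ->; rewrite andbF.
have -> : (8 : R) = 4 + 4 by rewrite -natrD.
apply: le_trans (lerD (key (@complex.Re R) (@nrm_Re R) _ D dAD) (key (@complex.Im R) (@nrm_Im R) _ D dAD)).
- by rewrite -big_split; apply: ler_sum => i _; exact: nrmReIm.
- by case=> a b [c d].
- by case=> a b [c d].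
Qed.

Lemma abs_summable_tail I (f : I -> C) : abs_summable f -> forall e : R, 0 < e ->
  exists A : {fset I}, forall B : {fset I}, fdisjoint A B -> \sum_(i <- B) nrm (f i) < e.
Proof.
move=> [M hM] e e0; pose S : set R := [set x | exists A : {fset I}, x = \sum_(i <- A) nrm (f i)].
have hS : has_sup S.
  split; first by exists (\sum_(i <- fset0) nrm (f i)), fset0.
  by exists M => x [A ->].
have [_ [A ->] hA] := sup_adherent e0 hS.
exists A => B dAB.
have h2 : \sum_(i <- (A `|` B)%fset) nrm (f i) <= sup S by apply: sup_upper_bound => //; exists (A `|` B)%fset.
have h3 : \sum_(i <- (A `|` B)%fset) nrm (f i) = \sum_(i <- A) nrm (f i) + \sum_(i <- B) nrm (f i).
  rewrite (big_fsetID _ (mem A)) /=; congr (_ + _); apply: eq_fbigl => x; rewrite !inE /=.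
    by case: (x \in A); rewrite ?andbF.
  case: (boolP (x \in A)) => xA /=; rewrite ?andbT ?andbF //.
  by apply/esym/negbTE; apply: (fdisjointP dAB).
by move: h2; rewrite h3; lra.
Qed.

Lemma nrm_csum_le I (f : I -> C) s (M : R) : has_csum f s -> abs_bounded f M -> nrm s <= M.
Proof.
move=> h hM; apply: has_csum_le h _ => A; exact: le_trans (nrm_sum _ _ _) (hM A).
Qed.

Lemma abs_summable_restr I (f : I -> C) (D : set I) : abs_summable f -> abs_summable (restr D f).
Proof.
by apply: abs_summable_le => i; rewrite /restr; case: ifP => // _; rewrite nrm0 nrm_ge0.
Qed.

(** Once finitely many fibres cover a set [A] that carries the sum up to [e / 2], what is missing is
    a subfamily off [A]. Reindexing, Fubini and Cauchy products are all derived from this. *)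
Lemma csum_fibers I (J : choiceType) (p : I -> J) (f : I -> C) s :
  has_csum f s -> has_csum (fun j => csum (restr [set i | p i = j] f)) s.
Proof.
move=> hs; have af : abs_summable f by apply: csummable_abs_summable; exists s.
pose g j := csum (restr [set i | p i = j] f).
have hg j : has_csum (restr [set i | p i = j] f) (g j).
  by apply: csumP; apply: abs_summable_csummable; apply: abs_summable_restr.
apply/has_csumP => e e0.
have e2 : 0 < e / 2 by rewrite divr_gt0.
have [A hA] := abs_summable_tail af e2.
exists [fset p i | i in A]%fset => J' hJ'.
have h1 := has_csum_sum J' xpredT hg.
have h2 := has_csumB h1 hs.
apply: (@le_lt_trans _ _ (e / 2)); last by lra.
apply: nrm_csum_le h2 _ => B.
have e1 i : \sum_(j <- J') restr [set i0 | p i0 = j] f i - f i =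
    if p i \in J' then 0 else - f i.
  case: ifPn => pJ.
    rewrite (big_fsetD1 (p i)) //= /restr asboolT // big1_fset ?addr0 ?subrr // => j.
    by rewrite !inE => /andP[/eqP jp _] _; rewrite asboolF // => /esym.
  rewrite big1_fset ?sub0r // => j hj _.
  by rewrite /restr asboolF // => hpj; move: pJ; rewrite hpj hj.
rewrite (eq_bigr _ (fun i _ => congr1 (@nrm R) (e1 i))).
rewrite (bigID (fun i => p i \in J')) /= big1 ?add0r; last by move=> i ->; rewrite nrm0.
rewrite (eq_bigr (fun i => nrm (f i))) => [|i /negbTE ->]; last by rewrite nrmN.
rewrite fset_sum_filter; apply/ltW/hA/fdisjointP => x xA; rewrite !inE /= negb_and negbK.
by apply/orP; right; apply: (fsubsetP hJ'); apply: in_imfset.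
Qed.

Lemma has_csum_support1 I (f : I -> C) i : (forall j, j != i -> f j = 0) -> has_csum f (f i).
Proof.
move=> h; apply/has_csumP => e e0; exists [fset i]%fset => B iB.
rewrite (big_fsetD1 i) /=; last by rewrite (fsubsetP iB) ?inE.
by rewrite big1_fset ?addr0 ?subrr ?nrm0 // => j; rewrite !inE => /andP[/h].
Qed.

Lemma has_csum_inj I (J : choiceType) (h : I -> J) (f : I -> C) (g : J -> C) s :
  injective h -> (forall i, g (h i) = f i) -> (forall j, (forall i, h i <> j) -> g j = 0) ->
  has_csum f s -> has_csum g s.
Proof.
move=> hinj gh g0 /(csum_fibers h); apply: has_csum_ext => j.
have [[i <-]|nj] := pselect (exists i, h i = j).
  rewrite gh (csumE (has_csum_support1 (i := i) _)) => [|k ki].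
    by rewrite /restr asboolT.
  by rewrite /restr asboolF // => /hinj /eqP; rewrite (negbTE ki).
rewrite g0; last by move=> i hi; apply: nj; exists i.
apply: csumE; apply: has_csum0 => i; rewrite /restr asboolF // => hi.
by apply: nj; exists i.
Qed.

Lemma has_csum_bij I (J : choiceType) (h : I -> J) (h' : J -> I) (f : J -> C) s :
  cancel h h' -> cancel h' h -> has_csum f s -> has_csum (fun i => f (h i)) s.
Proof.
move=> hK h'K; apply: (has_csum_inj (h := h')).
- exact: can_inj h'K.
- by move=> j; rewrite h'K.
- by move=> i /(_ (h i)); rewrite hK.
Qed.

Lemma abs_summable_inj I (J : choiceType) (h : J -> I) (f : I -> C) : injective h ->
  abs_summable f -> abs_summable (fun j => f (h j)).
Proof.
move=> hinj [M hM]; exists M => A; apply: le_trans (hM (h @` A)%fset).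
by rewrite big_imfset //= => x y _ _; exact: hinj.
Qed.

Lemma abs_summable_inj_inv I (J : choiceType) (h : I -> J) (f : I -> C) (g : J -> C) :
  injective h -> (forall i, g (h i) = f i) -> (forall j, (forall i, h i <> j) -> g j = 0) ->
  abs_summable f -> abs_summable g.
Proof.
move=> hinj gh g0 /abs_summable_csummable[s hs]; apply: csummable_abs_summable; exists s.
exact: has_csum_inj hinj gh g0 hs.
Qed.

Lemma asmZ I (f : I -> C) a : abs_summable f -> abs_summable (fun i => a * f i).
Proof.
move=> /abs_summable_csummable[s hs]; apply: csummable_abs_summable; exists (a * s); exact: has_csumZ.
Qed.
Lemma asmD I (f g : I -> C) : abs_summable f -> abs_summable g -> abs_summable (fun i => f i + g i).
Proof.
move=> /abs_summable_csummable[s hs] /abs_summable_csummable[t ht]; apply: csummable_abs_summable; exists (s + t).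
exact: has_csumD.
Qed.

Lemma abs_summable_prod I (J : choiceType) (f : I -> C) (g : J -> C) :
  abs_summable f -> abs_summable g -> abs_summable (fun x : I * J => f x.1 * g x.2).
Proof.
move=> [M hM] [N hN].
have N0 : 0 <= N by apply: le_trans (hN fset0); rewrite big_seq_fset0.
exists (M * N) => A.
rewrite (partition_big_imfset _ (fun x => x.1)) /=.
apply: le_trans (_ : \sum_(i <- [fset x.1 | x in A]%fset) nrm (f i) * N <= _); last first.
  by rewrite -mulr_suml ler_wpM2r.
apply: ler_sum => i _.
rewrite (eq_bigr (fun x => nrm (f i) * nrm (g x.2))) => [|x /eqP <-]; last exact: nrmM.
rewrite -mulr_sumr ler_wpM2l ?nrm_ge0 // fset_sum_filter.
set D := [fset x in A | _]%fset.
have inj : {in D &, injective snd}.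
  by move=> [x1 x2] [y1 y2]; rewrite !inE /= => /andP[_ /eqP ->] /andP[_ /eqP ->] ->.
by have := hN [fset x.2 | x in D]%fset; rewrite big_imfset.
Qed.

Lemma has_csum_prod I (J : choiceType) (f : I -> C) (g : J -> C) s t :
  has_csum f s -> has_csum g t -> has_csum (fun x : I * J => f x.1 * g x.2) (s * t).
Proof.
move=> hs ht; have [u hu] : csummable (fun x : I * J => f x.1 * g x.2).
  by apply/abs_summable_csummable/abs_summable_prod; apply: csummable_abs_summable; [exists s|exists t].
suff -> : s * t = u by [].
apply: has_csum_uniq (csum_fibers fst hu).
rewrite mulrC; apply: has_csum_ext (has_csumZ t hs) => i; apply/esym/csumE.
rewrite mulrC.
apply: (has_csum_inj (h := fun j => (i, j))) (has_csumZ (f i) ht).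
- by move=> x y [].
- by move=> j; rewrite /restr asboolT.
- move=> [a b] h; rewrite /restr asboolF //= => ai; by apply: (h b); rewrite ai.
Qed.

(** Distributes a finite product of series; each term of the Leibniz formula contains one mode sum
    per row. *)
Lemma has_csum_ffun n I (f : 'I_n -> I -> C) (s : 'I_n -> C) :
  (forall i, has_csum (f i) (s i)) ->
  has_csum (fun k : {ffun 'I_n -> I} => \prod_i f i (k i)) (\prod_i s i).
Proof.
elim: n f s => [|n IH] f s hs.
  rewrite big_ord0.
  pose k0 : {ffun 'I_0 -> I} := ffun0 (card_ord 0).
  have h (g : {ffun 'I_0 -> I} -> C) : has_csum g (g k0).
    by apply: has_csum_support1 => j /eqP[]; apply/ffunP => -[].
  by move: (h (fun k => \prod_i f i (k i))); rewrite big_ord0.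
have h := has_csum_prod (hs ord0) (IH (fun i => f (lift ord0 i)) (fun i => s (lift ord0 i)) (fun i => hs _)).
rewrite big_ord_recl.
pose a (x : I * {ffun 'I_n -> I}) : {ffun 'I_n.+1 -> I} :=
  [ffun i => if unlift ord0 i is Some j then x.2 j else x.1].
pose b (k : {ffun 'I_n.+1 -> I}) : I * {ffun 'I_n -> I} := (k ord0, [ffun j => k (lift ord0 j)]).
have aK : cancel b a.
  move=> k; apply/ffunP => i; rewrite ffunE; case: unliftP => [j|] -> //=; by rewrite ffunE.
have bK : cancel a b.
  move=> [x k]; rewrite /b ffunE unlift_none /=; congr (_, _); apply/ffunP => j.
  by rewrite !ffunE liftK.
apply: has_csum_ext (has_csum_bij aK bK h) => k /=.
by rewrite big_ord_recl; congr (_ * _); apply: eq_bigr => i _; rewrite ffunE.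
Qed.

End Sums.

(** * Geometric, double and grouped series *)

Section MoreSums.
Variable R : realType.
Local Notation C := (Cplx R).
Implicit Type I : choiceType.

Lemma has_csum1 I (f : I -> C) i s : (forall j, j != i -> f j = 0) -> f i = s -> has_csum f s.
Proof. by move=> h <-; exact: has_csum_support1. Qed.

Lemma has_csum_fin (I : finType) (f : I -> C) : has_csum f (\sum_i f i).
Proof.
apply/has_csumP => e e0; exists [fset i in I]%fset => B hB.
rewrite (_ : \sum_(i <- B) f i = \sum_i f i) ?subrr ?nrm0 //.
rewrite -[RHS]big_enum /=; apply: perm_big; apply: uniq_perm; rewrite ?fset_uniq ?enum_uniq // => i.
by rewrite mem_enum (fsubsetP hB) // !inE.
Qed.

Lemma abs_bounded_nat (f : nat -> C) M : (forall N, \sum_(k < N) nrm (f k) <= M) -> abs_bounded f M.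
Proof.
move=> h A; have [N hN] : exists N, forall k, k \in A -> (k < N)%N.
  exists (\max_(k <- A) k).+1 => k kA; rewrite ltnS.
  by rewrite (big_fsetD1 k) //= leq_maxl.
apply: le_trans (h N).
rewrite -(big_mkord xpredT (fun k => nrm (f k))) /index_iota subn0.
pose B := [fset k in iota 0 N]%fset.
rewrite (_ : \sum_(i <- iota 0 N) _ = \sum_(i <- B) nrm (f i)).
  apply: le_sum_fset => [k|]; first exact: nrm_ge0.
  by apply/fsubsetP => k /hN; rewrite !inE /= mem_iota.
by apply: perm_big; apply: uniq_perm; rewrite ?fset_uniq ?iota_uniq // => i; rewrite !inE.
Qed.

Lemma has_csum_nat0 (f : nat -> C) s : has_csum (fun k => f k.+1) s -> has_csum f (f 0%N + s).
Proof.
move=> hs.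
have h1 : has_csum (fun k : nat => if k == 0%N then f 0%N else 0) (f 0%N).
  by apply: (has_csum1 (i := 0%N)) => [[]|].
have h2 : has_csum (fun k : nat => if k == 0%N then 0 else f k) s.
  apply: (has_csum_inj (h := S)) hs => //; first by move=> x y [].
  by case=> [//|k] /(_ k).
apply: has_csum_ext (has_csumD h1 h2) => -[|k] /=; by rewrite ?addr0 ?add0r.
Qed.

Lemma abs_summable_geom (z : C) : nrm z < 1 -> abs_summable (fun k => z ^+ k).
Proof.
move=> z1; exists (1 - nrm z)^-1; apply: abs_bounded_nat => N.
rewrite (eq_bigr (fun k : 'I_N => nrm z ^+ k)) => [|k _]; last exact: nrmX.
have h0 : 0 < 1 - nrm z by lra.
rewrite -(ler_pM2l h0) mulfV ?gt_eqF // -opprB mulNr -subrX1 opprB.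
by rewrite gerBl exprn_ge0 // nrm_ge0.
Qed.

Lemma has_csum_geom (z : C) : nrm z < 1 -> has_csum (fun k => z ^+ k) (1 - z)^-1.
Proof.
move=> z1; have [s hs] := abs_summable_csummable (abs_summable_geom z1).
have h1 : has_csum (fun k => z ^+ k) (1 + z * s).
  rewrite -[1](expr0 z); apply: (has_csum_nat0 (f := fun k => z ^+ k)).
  by apply: has_csum_ext (has_csumZ z hs) => k; rewrite exprS.
have e : (1 - z) * s = 1.
  by rewrite mulrBl mul1r {1}(has_csum_uniq hs h1) addrK.
have h0 : 1 - z != 0 by apply: contra_eq_neq e => ->; rewrite mul0r eq_sym oner_eq0.
by rewrite (_ : (1 - z)^-1 = s) //; apply: (mulfI h0); rewrite mulfV.
Qed.

Lemma abs_summable_tonelli I (J : choiceType) (f : I * J -> C) (b : I -> R) M :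
  (forall i, abs_bounded (fun j => f (i, j)) (b i)) ->
  (forall A : {fset I}, \sum_(i <- A) b i <= M) -> abs_summable f.
Proof.
move=> hb hM; exists M => A; rewrite (partition_big_imfset _ (fun x => x.1)) /=.
apply: le_trans (hM [fset x.1 | x in A]%fset); apply: ler_sum => i _.
rewrite fset_sum_filter; set D := [fset x in A | _]%fset.
have inj : {in D &, injective snd}.
  by move=> [x1 x2] [y1 y2]; rewrite !inE /= => /andP[_ /eqP ->] /andP[_ /eqP ->] ->.
have := hb i [fset x.2 | x in D]%fset; rewrite big_imfset //=; apply: le_trans.
rewrite big_seq [leRHS]big_seq; apply: ler_sum => -[x1 x2].
by rewrite !inE /= => /andP[_ /eqP ->].
Qed.

Lemma csum_fst I (J : choiceType) (f : I * J -> C) (g : I -> C) s : has_csum f s ->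
  (forall i, has_csum (fun j => f (i, j)) (g i)) -> has_csum g s.
Proof.
move=> hs hg; apply: has_csum_ext (csum_fibers fst hs) => i; apply: csumE.
apply: (has_csum_inj (h := fun j => (i, j))) (hg i).
- by move=> x y [].
- by move=> j; rewrite /restr asboolT.
- move=> [a b] h; rewrite /restr asboolF //= => ai; by apply: (h b); rewrite ai.
Qed.

Lemma has_csum_fubini I (J : choiceType) (f : I * J -> C) (g : I -> C) s : abs_summable f ->
  (forall i, has_csum (fun j => f (i, j)) (g i)) -> has_csum g s -> has_csum f s.
Proof.
move=> /abs_summable_csummable[t ht] hg hs.
by rewrite (has_csum_uniq hs (csum_fst ht hg)).
Qed.

(* Cauchy products are the case [f (i, j) = a i * b j]. *)
Lemma has_csum_antidiag (f : nat * nat -> C) s (g : nat -> C) : has_csum f s ->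
  (forall n, g n = \sum_(i < n.+1) f (i : nat, (n - i)%N)) -> has_csum g s.
Proof.
move=> hs hg; apply: has_csum_ext (csum_fibers (fun x => (x.1 + x.2)%N) hs) => n; apply: csumE.
rewrite hg; apply: (has_csum_inj (h := fun i : 'I_n.+1 => (i : nat, (n - i)%N))) (has_csum_fin _).
- by move=> x y [] /val_inj.
- by move=> i; rewrite /restr asboolT //= subnKC // -ltnS.
- move=> [a b] h; rewrite /restr asboolF //= => abn.
  have an : (a < n.+1)%N by lia.
  by apply: (h (Ordinal an)) => /=; congr (_, _); lia.
Qed.

(** Terms with the same exponent [e i] are collected. The nonvanishing reference values [x0] show
    that each fibre of [c] alone is summable. *)
Lemma csum_group I (K : choiceType) (c : I -> C) (e : I -> K) (x0 x : K -> C) s :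
  (forall k, x0 k != 0) -> abs_summable (fun i => c i * x0 (e i)) ->
  has_csum (fun i => c i * x (e i)) s ->
  has_csum (fun k => csum (restr [set i | e i = k] c) * x k) s.
Proof.
move=> x00 ac hs; apply: has_csum_ext (csum_fibers e hs) => k; apply: csumE.
have h : csummable (restr [set i | e i = k] c).
  apply: abs_summable_csummable; apply: abs_summable_le (asmZ (x0 k)^-1 (abs_summable_restr [set i | e i = k] ac)) => i.
  rewrite /restr; case: asboolP => [/= ->|_]; last by rewrite nrm0 nrm_ge0.
  by rewrite mulrC mulfK.
rewrite mulrC; apply: has_csum_ext (has_csumZ (x k) (csumP h)) => i.
by rewrite /restr; case: asboolP => [/= ->|_]; rewrite ?mulr0 // mulrC.
Qed.

Lemma abs_summable_int (f : int -> C) : abs_summable (fun n : nat => f n%:Z) -> abs_summable (fun n : nat => f (- n%:Z)) -> abs_summable f.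
Proof.
move=> h1 h2.
pose f1 (k : int) := if 0 <= k then f k else 0.
pose f2 (k : int) := if k <= 0 then f k else 0.
have a1 : abs_summable f1.
  apply: (abs_summable_inj_inv (h := Posz)) h1 => //; first by move=> x y [].
  by rewrite /f1 => -[n|n] h //; case: (h n).
have a2 : abs_summable f2.
  apply: (abs_summable_inj_inv (h := fun n : nat => - n%:Z)) h2 => [x y /oppr_inj [] //|n|k h]; rewrite /f2.
    by rewrite oppr_le0.
  case: ifP => // k0; case: (h `|k|%N); rewrite abszE ler0_norm ?opprK //.
have [M hM] := a1; have [N hN] := a2.
exists (M + N) => A; apply: le_trans (lerD (hM A) (hN A)); rewrite -big_split.
apply: ler_sum => k _; rewrite /f1 /f2.
have [k0|k0] := leP 0 k; first by rewrite lerDl nrm_ge0.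
by rewrite (ltW k0) nrm0 /= add0r.
Qed.

End MoreSums.

(** * The complex exponential and its power series *)

Section Cexp.
Variable R : realType.
Local Notation C := (Cplx R).

Lemma nrm_cexp (z : C) : nrm (cexp z) = expR (complex.Re z).
Proof.
rewrite /cexp nrmM nrm_ofR ger0_norm ?expR_ge0 // {1}/nrm normc_def /= cos2Dsin2 sqrtr1.
by rewrite mulr1.
Qed.

Lemma cexp_neq0 (z : C) : cexp z != 0.
Proof. by rewrite -nrm_eq0 nrm_cexp gt_eqF // expR_gt0. Qed.

Lemma cexpD (z w : C) : cexp (z + w) = cexp z * cexp w.
Proof.
case: z w => a b [c d]; rewrite /cexp /= expRD ofRM.
have -> : (Complex (cos (b + d)) (sin (b + d)) : C) = Complex (cos b) (sin b) * Complex (cos d) (sin d).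
  by apply/eqP; rewrite eq_complex /= cosD sinD eqxx /= addrC mulrC [sin b * _]mulrC [cos d * _]mulrC eqxx.
by ring.
Qed.

Lemma cexp0 : cexp (0 : C) = 1.
Proof.
rewrite /cexp /= expR0 cos0 sin0; apply/eqP.
by rewrite eq_complex /= !(mulr0, mul0r, mulr1, subr0, addr0) !eqxx.
Qed.

Lemma cexpN (z : C) : cexp (- z) = (cexp z)^-1.
Proof. by apply: (mulfI (cexp_neq0 z)); rewrite -cexpD subrr cexp0 mulfV // cexp_neq0. Qed.

Lemma cexpMn (z : C) n : cexp (z * n%:R) = cexp z ^+ n.
Proof.
elim: n => [|n IH]; first by rewrite mulr0 cexp0.
by rewrite -natr1 mulrDr mulr1 cexpD IH exprSr.
Qed.

Lemma cexpMz (z : C) (k : int) : cexp (z * k%:~R) = cexp z ^ k.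
Proof.
case: k => n; first exact: cexpMn.
by rewrite NegzE mulrNz mulrN cexpN -exprnN cexpMn.
Qed.

Lemma cexp_sum J (r : seq J) (P : pred J) (F : J -> C) :
  cexp (\sum_(j <- r | P j) F j) = \prod_(j <- r | P j) cexp (F j).
Proof. by elim/big_rec2: _ => [|j x y _ <-]; rewrite ?cexp0 ?cexpD. Qed.

End Cexp.

Ltac cplx_ring := apply/eqP; rewrite eq_complex /=; apply/andP; split; apply/eqP; ring.

Section CexpSeries.
Variable R : realType.
Local Notation C := (Cplx R).

Lemma ofR_sum I (r : seq I) (P : pred I) (F : I -> R) :
  ofR (\sum_(i <- r | P i) F i) = \sum_(i <- r | P i) ofR (F i).
Proof. by elim/big_rec2: _ => [//|i x y _ <-]; rewrite ofRD. Qed.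
Lemma ofRX (x : R) n : ofR (x ^+ n) = ofR x ^+ n.
Proof. by elim: n => [|n IH]; rewrite ?expr0 // !exprS ofRM IH. Qed.
Lemma ofR_nat n : ofR (n%:R : R) = n%:R.
Proof. by elim: n => [|n IH]; rewrite ?mulr0n // -!natr1 ofRD IH. Qed.
Lemma ofRV (x : R) : ofR x^-1 = (ofR x)^-1.
Proof.
have [->|x0] := eqVneq x 0; first by rewrite invr0 /= (invr0 C).
have h : ofR x != 0 by rewrite -nrm_eq0 nrm_ofR normr_eq0.
by apply: (mulfI h); rewrite -ofRM !mulfV.
Qed.
Lemma ofR_int (k : int) : ofR (k%:~R : R) = k%:~R.
Proof. by case: k => n; rewrite ?NegzE ?mulrNz ?ofRN -?pmulrn ofR_nat. Qed.

Lemma nrm_nat n : nrm (n%:R : C) = n%:R.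
Proof. by rewrite -ofR_nat nrm_ofR ger0_norm. Qed.

Lemma has_csum_nat_lim (f : nat -> C) s : has_csum f s -> forall e : R, 0 < e ->
  exists N, forall n, (N <= n)%N -> nrm (\sum_(0 <= k < n) f k - s) < e.
Proof.
move=> /has_csumP hs e /hs[A hA]; exists (\max_(k <- A) k).+1 => n hn.
have -> : \sum_(0 <= k < n) f k = \sum_(k <- [fset k in iota 0 n]%fset) f k.
  rewrite /index_iota subn0; apply: perm_big; apply: uniq_perm; rewrite ?fset_uniq ?iota_uniq // => i.
  by rewrite !inE.
apply: hA; apply/fsubsetP => k kA; rewrite !inE /= mem_iota /= add0n.
by apply: leq_trans hn; rewrite ltnS (big_fsetD1 k) //= leq_maxl.
Qed.

(** Carries ordered convergence of real series over to unconditional sums: the two limits are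
    compared along initial segments. *)
Lemma has_csum_series (g : nat -> R) l : abs_summable (fun k => ofR (g k)) ->
  series g @ \oo --> l -> has_csum (fun k => ofR (g k)) (ofR l).
Proof.
move=> /abs_summable_csummable[s hs] hl; suff <- : s = ofR l by [].
apply/eqP; rewrite -subr_eq0; apply/eqP; apply: nrm_small => e e0.
have e2 : 0 < e / 2 by rewrite divr_gt0.
have [N hN] := has_csum_nat_lim hs e2.
have /cvgrPdist_lt/(_ _ e2) [M _ hM] := hl.
have h1 := hN _ (leq_maxl N M); have := hM _ (leq_maxr N M) => /=.
rewrite /series /= => h2; rewrite -ofR_sum in h1.
set S := \sum_(0 <= k < _) g k in h1 h2.
have -> : s - ofR l = - (ofR S - s) - (ofR (l - S)) by rewrite ofRD ofRN; ring.
by apply: le_lt_trans (nrmD _ _) _; rewrite !nrmN nrm_ofR (splitr e) ltrD.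
Qed.

Definition expterm (z : C) (k : nat) : C := z ^+ k / (k`!)%:R.

Lemma nrm_expterm z k : nrm (expterm z k) = exp_coeff (nrm z) k.
Proof. by rewrite /expterm nrmM nrmX nrmV nrm_nat. Qed.

Lemma expterm_bound (x : R) N : 0 <= x -> \sum_(k < N) exp_coeff x k <= expR x.
Proof.
move=> x0; rewrite -(big_mkord xpredT (exp_coeff x)).
have := nondecreasing_cvgn_le (u_ := series (exp_coeff x)) _ (is_cvg_series_exp_coeff x) N.
apply; apply/nondecreasing_seqP => n; rewrite /series /= big_nat_recr //= lerDl.
exact: exp_coeff_ge0.
Qed.

Lemma expterm_abs_bounded z : abs_bounded (expterm z) (expR (nrm z)).
Proof.
apply: abs_bounded_nat => N.
rewrite (eq_bigr _ (fun (k : 'I_N) _ => nrm_expterm z k)); exact: expterm_bound (nrm_ge0 z).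
Qed.

Lemma expterm_abs_summable z : abs_summable (expterm z).
Proof. by exists (expR (nrm z)); exact: expterm_abs_bounded. Qed.

Lemma expterm_ofR (x : R) : has_csum (expterm (ofR x)) (ofR (expR x)).
Proof.
have e k : expterm (ofR x) k = ofR (exp_coeff x k).
  by rewrite /expterm /exp_coeff /= ofRM ofRV ofR_nat ofRX.
rewrite (funext e); apply: has_csum_series; last exact: is_cvg_series_exp_coeff.
by rewrite -(funext e); exact: expterm_abs_summable.
Qed.

Lemma imX k : (Complex 0 1 : C) ^+ k =
  ofR ((~~ odd k)%:R * (-1) ^+ k./2) + Complex 0 1 * ofR ((odd k)%:R * (-1) ^+ k./2).
Proof.
elim: k => [|k IH].
  by apply/eqP; rewrite eq_complex /= !(mulr0, mul0r, mulr1, mul1r, subr0, addr0, oppr0) !eqxx.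
rewrite exprS IH /= uphalf_half; case: (odd k) => /=; apply/eqP;
rewrite eq_complex /= ?add0n ?add1n ?exprS !(mulr0, mul0r, mulr1, mul1r, subr0, addr0, oppr0, sub0r, add0r, mulN1r) !eqxx //.
Qed.

Lemma expterm_im (y : R) : has_csum (expterm (Complex 0 y)) (Complex (cos y) (sin y)).
Proof.
have -> : (Complex 0 y : C) = Complex 0 1 * ofR y.
  by cplx_ring.
have e k : expterm (Complex 0 1 * ofR y) k = ofR (cos_coeff y k) + Complex 0 1 * ofR (sin_coeff y k).
  rewrite /expterm exprMn imX /cos_coeff /sin_coeff /= !ofRM ofRV ofR_nat ofRX.
  have -> : ofR (R:=R) (odd k)%:R * ofR ((-1) ^+ k.-1./2) = ofR (odd k)%:R * ofR ((-1) ^+ k./2).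
    by case: k => [|k] /=; rewrite ?mul0r // uphalf_half; case: (odd k); rewrite ?mul0r.
  by rewrite -exprnP !ofR_nat; ring.
have bnd (g : nat -> R) : (forall k, `|g k| <= exp_coeff `|y| k) -> abs_summable (fun k => ofR (g k)).
  move=> hg; apply: abs_summable_le (expterm_abs_summable (ofR y)) => k.
  by rewrite nrm_ofR nrm_expterm nrm_ofR.
have n1 k (b : bool) (m : nat) : `|b%:R * (-1) ^+ m * y ^+ k / (k`!)%:R| <= exp_coeff `|y| k.
  rewrite /exp_coeff /= !normrM normrV ?unitfE ?pnatr_eq0 -?lt0n ?fact_gt0 // normrX.
  rewrite normrX normrN1 expr1n mulr1 [X in _ / X <= _]ger0_norm //.
  rewrite ler_wpM2r ?invr_ge0 //; case: b; rewrite ?normr1 ?mul1r // normr0 mul0r.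
  by rewrite exprn_ge0.
have hc := has_csum_series (bnd (cos_coeff y) (fun k => n1 k _ _)) (@is_cvg_series_cos_coeff _ y).
have hs := has_csum_series (bnd (sin_coeff y) (fun k => n1 k _ _)) (@is_cvg_series_sin_coeff _ y).
have := has_csumD hc (has_csumZ (Complex 0 1) hs).
rewrite -(funext e); congr has_csum.
by rewrite [in RHS]cos.unlock [in RHS]sin.unlock; apply/eqP; rewrite eq_complex /= !(mulr0, mul0r, mulr1, mul1r, subr0, addr0, add0r) !eqxx.
Qed.

(** The Cauchy product of the series of e^x and e^(iy), regrouped by the binomial theorem. *)
Lemma cexp_series z : has_csum (expterm z) (cexp z).
Proof.
case: z => x y; rewrite /cexp /=.
have := has_csum_prod (expterm_ofR x) (expterm_im y).
move=> /has_csum_antidiag; apply => n.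
have -> : Complex x y = ofR x + (Complex 0 y : C).
  by apply/eqP; rewrite eq_complex /= addr0 add0r !eqxx.
rewrite /expterm addrC exprDn mulr_suml; apply: eq_bigr => i _ /=.
have h : ('C(n, i))%:R / n`!%:R = (i`!%:R)^-1 * ((n - i)`!%:R)^-1 :> C.
  have hin : (i <= n)%N by rewrite -ltnS.
  have f0 m : (m`!)%:R != 0 :> C by rewrite pnatr_eq0 -lt0n fact_gt0.
  rewrite -(bin_fact hin) !natrM; field; rewrite ?f0 //= pnatr_eq0 -lt0n bin_gt0 //.
rewrite -mulr_natr -[LHS]mulrA h; ring.
Qed.

End CexpSeries.

(** * Analytic and meromorphic functions *)

Section Analytic1.
Variable R : realType.
Local Notation C := (Cplx R).
Implicit Types (f g : C -> C) (a : C) (c : nat -> C).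

Lemma nrm_mono (x h : C) k : nrm (x * h ^+ k) = nrm x * nrm h ^+ k.
Proof. by rewrite nrmM nrmX. Qed.

Lemma nrm_mono_real (x : C) (r : R) k : 0 <= r -> nrm (x * ofR r ^+ k) = nrm x * r ^+ k.
Proof. by move=> r0; rewrite nrm_mono nrm_ofR ger0_norm. Qed.

Lemma abs_summable_le_eq (I : choiceType) (f g : I -> C) (u v : I -> R) :
  (forall i, nrm (f i) = u i) -> (forall i, nrm (g i) = v i) -> (forall i, u i <= v i) ->
  abs_summable g -> abs_summable f.
Proof. by move=> hu hv huv; apply: abs_summable_le => i; rewrite hu hv. Qed.

Lemma abs_summable_powh c (r : R) (h : C) : nrm h <= r ->
  abs_summable (fun k => c k * ofR r ^+ k) -> abs_summable (fun k => c k * h ^+ k).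
Proof.
move=> hr; have r0 := le_trans (nrm_ge0 h) hr.
apply: (abs_summable_le_eq (fun k => nrm_mono (c k) h k) (fun k => nrm_mono_real (c k) k r0)) => k.
by rewrite ler_wpM2l ?nrm_ge0 // lerXn2r // nnegrE nrm_ge0.
Qed.

Lemma abs_summable_pow c (r r' : R) : 0 <= r' -> r' <= r ->
  abs_summable (fun k => c k * ofR r ^+ k) -> abs_summable (fun k => c k * ofR r' ^+ k).
Proof. by move=> r0 rr; apply: abs_summable_powh; rewrite nrm_ofR ger0_norm. Qed.

(** Halving the radius gives absolute summability at the radius itself, which sums and products of
    expansions rely on. *)
Lemma analytic1P f a : analytic1_at f a <-> exists c (r : R), [/\ 0 < r,
  abs_summable (fun k => c k * ofR r ^+ k) &
  forall h, nrm h < r -> has_csum (fun k => c k * h ^+ k) (f (a + h))].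
Proof.
split=> [[c [r [/pos_ofR[er r0] H]]]|[c [r [r0 _ H]]]].
  move: (complex.Re r) er r0 => {r} s -> s0 in H *.
  have H' h : nrm h < s -> has_csum (fun k => c k * h ^+ k) (f (a + h)).
    by move=> hs; apply: H; rewrite nrm_lt.
  exists c, (s / 2); split; first by rewrite divr_gt0.
  - apply: csummable_abs_summable; eexists; apply: H'; rewrite nrm_ofR ger0_norm; lra.
  - by move=> h hs; apply: H'; lra.
exists c, (ofR r); split; first by rewrite ltr_ofR.
by move=> h; rewrite nrm_lt; exact: H.
Qed.

(** Expansions arise as families of monomials over other index sets, such as pairs, in which an
    exponent may be repeated. *)
Lemma analytic1_family (I : choiceType) (c : I -> C) (e : I -> nat) (r : R) f a : 0 < r ->
  abs_summable (fun i => c i * ofR r ^+ e i) ->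
  (forall h, nrm h < r -> has_csum (fun i => c i * h ^+ e i) (f (a + h))) ->
  analytic1_at f a.
Proof.
move=> r0 ac H; exists (fun k => csum (restr [set i | e i = k] c)), (ofR r).
split; first by rewrite ltr_ofR.
move=> h; rewrite nrm_lt => /H.
apply: (csum_group (x0 := fun k => ofR r ^+ k) (x := fun k => h ^+ k)) ac => k.
by rewrite -nrm_eq0 nrmX nrm_ofR ger0_norm ?expf_neq0 ?gt_eqF // ltW.
Qed.

Lemma analytic1_near f g a (r : R) : 0 < r -> (forall h, nrm h < r -> f (a + h) = g (a + h)) ->
  analytic1_at f a -> analytic1_at g a.
Proof.
move=> r0 fg /analytic1P[c [s [s0 ac H]]]; apply/analytic1P.
exists c, (Num.min s r); split; first by rewrite lt_min s0.
  by apply: abs_summable_pow ac; rewrite ?le_min ?ge_min ?lexx // (ltW s0) (ltW r0).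
by move=> h; rewrite lt_min => /andP[hs hr]; rewrite -fg //; exact: H.
Qed.

Lemma analytic1_ext f g a : f =1 g -> analytic1_at f a -> analytic1_at g a.
Proof. by move=> /funext ->. Qed.

Lemma analytic1_const b a : analytic1_at (fun=> b) a.
Proof.
apply: (@analytic1_family nat (fun k => if k == 0%N then b else 0) id 1) => // [|h _].
  apply: csummable_abs_summable; exists b; apply: (has_csum1 (i := 0%N)) => [[|k] //|]; by rewrite ?mul0r ?mulr1.
by apply: (has_csum1 (i := 0%N)) => [[|k] //|]; rewrite ?mul0r ?mulr1.
Qed.

Lemma analytic1_id a : analytic1_at id a.
Proof.
apply: (@analytic1_family bool (fun b => if b then 1 else a) nat_of_bool 1) => // [|h _].
  by apply: csummable_abs_summable; eexists; exact: has_csum_fin.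
rewrite (_ : id (a + h) = \sum_b (if b then 1 else a) * h ^+ nat_of_bool b); first exact: has_csum_fin.
by rewrite (bigD1 true) //= (bigD1 false) //= big1 ?addr0 ?mul1r ?mulr1 1?addrC // => -[].
Qed.

Lemma min_radius (r s : R) : 0 < r -> 0 < s -> exists m, [/\ 0 < m, m <= r & m <= s].
Proof.
move=> r0 s0; exists (Num.min r s); rewrite lt_min r0 s0 !ge_min !lexx orbT; split=> //.
Qed.

Lemma analytic1_add f g a : analytic1_at f a -> analytic1_at g a -> analytic1_at (fun z => f z + g z) a.
Proof.
move=> /analytic1P[c [r [r0 ac Hf]]] /analytic1P[d [s [s0 ad Hg]]].
have [m [m0 mr ms]] := min_radius r0 s0.
apply: (@analytic1_family nat (fun k => c k + d k) id m _ _ m0) => [|h hm].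
  have := asmD (abs_summable_pow (ltW m0) mr ac) (abs_summable_pow (ltW m0) ms ad).
  by congr abs_summable; apply/funext => k; rewrite mulrDl.
have := has_csumD (Hf _ (lt_le_trans hm mr)) (Hg _ (lt_le_trans hm ms)).
by apply: has_csum_ext => k; rewrite mulrDl.
Qed.

Lemma analytic1_mul f g a : analytic1_at f a -> analytic1_at g a -> analytic1_at (fun z => f z * g z) a.
Proof.
move=> /analytic1P[c [r [r0 ac Hf]]] /analytic1P[d [s [s0 ad Hg]]].
have [m [m0 mr ms]] := min_radius r0 s0.
apply: (@analytic1_family _ (fun x : nat * nat => c x.1 * d x.2) (fun x => x.1 + x.2)%N m _ _ m0) => [|h hm].
  have := abs_summable_prod (abs_summable_pow (ltW m0) mr ac) (abs_summable_pow (ltW m0) ms ad).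
  by congr abs_summable; apply/funext => k; rewrite exprD; ring.
have := has_csum_prod (Hf _ (lt_le_trans hm mr)) (Hg _ (lt_le_trans hm ms)).
by apply: has_csum_ext => k; rewrite exprD; ring.
Qed.

Lemma analytic1_opp f a : analytic1_at f a -> analytic1_at (fun z => - f z) a.
Proof.
move=> /(analytic1_mul (analytic1_const (-1) a)); congr (analytic1_at _ _).
by apply/funext => z; rewrite mulN1r.
Qed.

Lemma analytic1_exp f a n : analytic1_at f a -> analytic1_at (fun z => f z ^+ n) a.
Proof.
move=> hf; elim: n => [|n IH]; first exact: analytic1_const.
rewrite (_ : (fun _ => _) = fun z => f z * f z ^+ n); first exact: analytic1_mul.
by apply/funext => z; rewrite exprS.
Qed.

Lemma analytic1_cexp b a : analytic1_at (fun z => cexp (b * z)) a.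
Proof.
apply: (@analytic1_family nat (fun k => cexp (b * a) * (b ^+ k / k`!%:R)) id 1) => // [|h _].
  apply: abs_summable_le (asmZ (cexp (b * a)) (expterm_abs_summable b)) => k.
  by rewrite expr1n mulr1.
rewrite mulrDr cexpD; apply: has_csum_ext (has_csumZ (cexp (b * a)) (cexp_series (b * h))) => k.
by rewrite /expterm exprMn; ring.
Qed.

Lemma analytic1_shift f a b : analytic1_at f (a + b) -> analytic1_at (fun z => f (z + b)) a.
Proof.
move=> [c [r [r0 H]]]; exists c, r; split=> // h /H; congr has_csum; congr f; ring.
Qed.

(* Course-of-values recursion: [invs c n] gives the first [n.+1] coefficients of
   the inverse of the power series [c]. *)
Fixpoint invs c n : nat -> C := if n is m.+1 then
  fun i => if (i <= m)%N then invs c m i else - (c 0%N)^-1 * \sum_(j < m.+1) c (n - j)%N * invs c m j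
  else fun _ => (c 0%N)^-1.
Definition invc c n := invs c n n.

Lemma invsE c n i : (i <= n)%N -> invs c n i = invc c i.
Proof.
elim: n => [|n IH]; first by rewrite leqn0 => /eqP ->.
rewrite leq_eqVlt ltnS => /orP[/eqP -> //|hi]; by rewrite /= hi IH.
Qed.

Lemma invcS c n : invc c n.+1 = - (c 0%N)^-1 * \sum_(j < n.+1) c (n.+1 - j)%N * invc c j.
Proof.
rewrite /invc /= ltnn; congr (_ * _); apply: eq_bigr => j _; congr (_ * _).
by apply: invsE; rewrite -ltnS.
Qed.

(** The ratio [1 + M] closes the induction because [M * \sum_(j < n.+1) (1 + M) ^+ j] telescopes to
    [(1 + M) ^+ n.+1 - 1]. *)
Lemma invc_bound c (r M : R) : c 0%N != 0 -> 0 < r -> 0 < M ->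
  (forall k, nrm (c k) * r ^+ k <= M * nrm (c 0%N)) ->
  forall n, nrm (invc c n) * r ^+ n <= (1 + M) ^+ n / nrm (c 0%N).
Proof.
move=> c0 r0 M0 hc n; elim/ltn_ind: n => -[|n] IH.
  by rewrite /invc /= nrmV !expr0 mulr1 mul1r.
rewrite invcS nrmM nrmN nrmV.
have n0 : 0 < nrm (c 0%N) by rewrite lt_def nrm_eq0 c0 nrm_ge0.
rewrite -mulrA mulrC ler_wpM2r ?invr_ge0 ?nrm_ge0 //.
have h1 : nrm (\sum_(j < n.+1) c (n.+1 - j)%N * invc c j) * r ^+ n.+1 <=
   \sum_(j < n.+1) M * (1 + M) ^+ j.
  apply: le_trans (_ : (\sum_(j < n.+1) nrm (c (n.+1 - j)%N * invc c j)) * r ^+ n.+1 <= _).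
    by rewrite ler_wpM2r ?exprn_ge0 ?(ltW r0) //; exact: nrm_sum.
  rewrite mulr_suml; apply: ler_sum => j _.
  rewrite nrmM -[in r ^+ _](subnK (ltnW (ltn_ord j) : (j <= n.+1)%N)) exprD.
  rewrite mulrACA.
  have -> : M * (1 + M) ^+ j = (M * nrm (c 0%N)) * ((1 + M) ^+ j / nrm (c 0%N)).
    by rewrite mulrACA mulfV ?gt_eqF // mulr1.
  apply: ler_pM; rewrite ?mulr_ge0 ?nrm_ge0 ?exprn_ge0 ?(ltW r0) //.
  exact: IH.
apply: le_trans h1 _; rewrite -mulr_sumr -{1}[M](addrK 1) [M + 1]addrC -subrX1 gerDl; lra.
Qed.

Lemma analytic1_inv f a : analytic1_at f a -> f a != 0 -> analytic1_at (fun z => (f z)^-1) a.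
Proof.
move=> /analytic1P[c [r [r0 ac H]]] fa0.
have e0 : c 0%N = f a.
  have := H 0; rewrite nrm0 addr0 => /(_ r0) h.
  apply: has_csum_uniq h; apply: (has_csum1 (i := 0%N)) => [[//|k]|]; by rewrite ?expr0 ?mulr1 // expr0n mulr0.
have c0 : c 0%N != 0 by rewrite e0.
have n0 : 0 < nrm (c 0%N) by rewrite lt_def nrm_eq0 c0 nrm_ge0.
have [M [M0 hM]] : exists M, 0 < M /\ forall k, nrm (c k) * r ^+ k <= M * nrm (c 0%N).
  have [M hM] := ac; exists ((`|M| + 1) / nrm (c 0%N)); split.
    by rewrite divr_gt0 // ltr_wpDl.
  move=> k; rewrite divfK ?gt_eqF //.
  have := hM [fset k]%fset; rewrite big_seq_fset1 nrmM nrmX nrm_ofR (ger0_norm (ltW r0)).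
  move=> /le_trans; apply; apply: le_trans (ler_norm M) _; by rewrite lerDl.
have hd := invc_bound c0 r0 M0 hM.
have M1 : 0 < 1 + M by lra.
(* At this radius the growth [(1 + M) ^+ k] is absorbed and terms of size [2^-1 ^+ k / nrm (c 0%N)]
   remain. *)
pose rho := r / (2 * (1 + M)).
have rho0 : 0 < rho by rewrite divr_gt0 // mulr_gt0.
have rhor : rho <= r.
  by rewrite ler_pdivrMr ?mulr_gt0 // ler_peMr ?(ltW r0) //; lra.
have ad : abs_summable (fun k => invc c k * ofR rho ^+ k).
  have h2 : nrm (ofR 2^-1 : C) < 1.
    rewrite nrm_ofR ger0_norm ?invr_ge0 //; lra.
  apply: (abs_summable_le_eq (fun k => nrm_mono_real (invc c k) k (ltW rho0))
    (fun k => nrmM (c 0%N)^-1 (ofR 2^-1 ^+ k)) _ (asmZ (c 0%N)^-1 (abs_summable_geom h2))) => k.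
  rewrite nrmV nrmX nrm_ofR ger0_norm ?invr_ge0 //.
  rewrite /rho invfM mulrCA exprMn mulrCA [leRHS]mulrC ler_wpM2l ?exprn_ge0 ?invr_ge0 //.
  rewrite exprMn mulrA -ler_pdivlMr ?exprn_gt0 ?invr_gt0 // exprVn invrK [leRHS]mulrC.
  exact: hd.
apply: (@analytic1_family nat (invc c) id rho) => // h hh.
have hr : nrm h < r by exact: lt_le_trans hh rhor.
have [s hs] := abs_summable_csummable (abs_summable_powh (ltW hh) ad).
suff e : f (a + h) * s = 1.
  have f0 : f (a + h) != 0 by apply: contra_eq_neq e => ->; rewrite mul0r eq_sym oner_eq0.
  by rewrite (_ : (f (a + h))^-1 = s) //; apply: (mulfI f0); rewrite mulfV.
have hp := has_csum_prod hs (H h hr).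
rewrite mulrC.
apply: has_csum_uniq (has_csum_antidiag hp (g := fun n => if n == 0%N then 1 else 0) _) _.
  case=> [|n]; first by rewrite big_ord_recl big_ord0 addr0 /= !expr0 !mulr1 /invc /= mulVf.
  rewrite (eq_bigr (fun i : 'I_n.+2 => (c (n.+1 - i)%N * invc c i) * h ^+ n.+1)) => [|i _].
    rewrite -mulr_suml big_ord_recr /= subnn invcS mulNr mulrN mulVKf // subrr mul0r //.
  rewrite /= mulrACA -exprD subnKC; first by rewrite [invc c i * _]mulrC.
  by rewrite -ltnS.
by apply: (has_csum1 (i := 0%N)) => [[]|].
Qed.

(** Near [a] the lowest nonzero term [c k * h ^+ k] dominates the remainder, which is at most
    [nrm h ^+ k.+1 * (M / r ^+ k.+1)]. *)
Lemma analytic1_zero f a : analytic1_at f a ->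
  (exists r : R, 0 < r /\ forall h, nrm h < r -> f (a + h) = 0) \/
  (exists r : R, 0 < r /\ forall h, h != 0 -> nrm h < r -> f (a + h) != 0).
Proof.
move=> /analytic1P[c [r [r0 ac H]]].
have [hc|/existsNP[k0 hk0]] := pselect (forall k, c k = 0).
  left; exists r; split=> // h /H hs; apply: has_csum_uniq hs _.
  by apply: has_csum0 => k; rewrite hc mul0r.
right; have exk : exists k, c k != 0 by exists k0; exact/eqP.
case: (ex_minnP exk) => k ck kmin.
have [M hM] := ac.
have M0 : 0 <= M by apply: le_trans (hM fset0); rewrite big_seq_fset0.
(* [M + 1] instead of [M] keeps the divisor in the radius below positive when [M = 0]. *)
have B0 : 0 < (M + 1) / r ^+ k.+1 by rewrite divr_gt0 ?exprn_gt0 // ltr_wpDl.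
have nk : 0 < nrm (c k) by rewrite lt_def nrm_eq0 ck nrm_ge0.
exists (Num.min r (nrm (c k) / ((M + 1) / r ^+ k.+1))); split.
  by rewrite lt_min r0 divr_gt0.
move=> h h0; rewrite lt_min => /andP[hr]; rewrite ltr_pdivlMr // => hB.
pose g j := if (j <= k)%N then 0 else c j * h ^+ j.
have hg : has_csum g (f (a + h) - c k * h ^+ k).
  have h1 : has_csum (fun j => if j == k then c k * h ^+ k else 0) (c k * h ^+ k).
    by apply: (has_csum1 (i := k)) => [j /negbTE -> //|]; rewrite eqxx.
  apply: has_csum_ext (has_csumB (H h hr) h1) => j; rewrite /g.
  have [jk|jk|->] := ltngtP j k; rewrite ?subr0 ?subrr //.
  by rewrite (_ : c j = 0) ?mul0r //; apply/eqP; apply: contraTT jk => /kmin; rewrite -leqNgt.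
have nh : 0 < nrm h by rewrite lt_def nrm_eq0 h0 nrm_ge0.
have hle : nrm (f (a + h) - c k * h ^+ k) <= nrm h ^+ k.+1 * (M / r ^+ k.+1).
  apply: nrm_csum_le hg _ => A; rewrite mulrA mulrAC.
  apply: le_trans (_ : nrm h ^+ k.+1 / r ^+ k.+1 * \sum_(i <- A) nrm (c i * ofR r ^+ i) <= _); last first.
    by rewrite ler_wpM2l // divr_ge0 // exprn_ge0 // ltW.
  rewrite mulr_sumr; apply: ler_sum => j _; rewrite /g; case: ifPn => jk.
    by rewrite nrm0 mulr_ge0 ?nrm_ge0 // divr_ge0 // exprn_ge0 // ltW.
  rewrite -ltnNge in jk; rewrite !nrmM !nrmX nrm_ofR (ger0_norm (ltW r0)) mulrCA ler_wpM2l ?nrm_ge0 //.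
  rewrite -[j](subnKC jk) !exprD mulrA divfK ?expf_neq0 ?gt_eqF //.
  by rewrite ler_wpM2l ?exprn_ge0 ?(ltW nh) // lerXn2r // ?nnegrE ltW.
apply/negP => /eqP fz; move: hle; rewrite fz sub0r nrmN nrmM nrmX exprSr -mulrA mulrC.
rewrite ler_pM2l ?exprn_gt0 //; apply/negP; rewrite -ltNge; apply: le_lt_trans hB.
rewrite ler_pM2l // ler_pM2r ?invr_gt0 ?exprn_gt0 //; lra.
Qed.

End Analytic1.

Section Nbhs.
Variable R : realType.
Local Notation C := (Cplx R).

Lemma nbhsCP (a : C) (U : set C) :
  nbhs a U <-> exists r : R, 0 < r /\ forall h, nrm h < r -> U (a + h).
Proof.
split=> [/nbhs_ballP[e /= /pos_ofR[ee e0] H]|[r [r0 H]]].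
  exists (complex.Re e); split => // h hr; apply: H; rewrite -ball_normE /ball_ /= ee.
  by rewrite opprD addNKr normrN nrm_lt.
apply/nbhs_ballP; exists (ofR r); first by rewrite /= ltr_ofR.
move=> z; rewrite -ball_normE /ball_ /= nrm_lt nrmB => /H.
by rewrite addrC subrK.
Qed.

Lemma nbhs_rowP (m : nat) (a : 'rV[C]_m) (U : set 'rV[C]_m) :
  nbhs a U <-> exists r : R, 0 < r /\ forall h : 'rV[C]_m, (forall i, nrm (h 0 i) < r) -> U (a + h).
Proof.
split=> [/nbhs_ballP[e /= /pos_ofR[ee e0] H]|[r [r0 H]]].
  exists (complex.Re e); split => // h hr; apply: H; split=> [|i j]; first by rewrite ee ltr_ofR.
  rewrite -ball_normE /ball_ /= ee ord1 mxE.
  by rewrite opprD addNKr normrN nrm_lt.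
apply/nbhs_ballP; exists (ofR r); first by rewrite /= ltr_ofR.
move=> z hz; rewrite -(subrK a z) addrC; apply: H => i.
have [_ /(_ 0 i)] := hz; rewrite -ball_normE /ball_ /= nrm_lt nrmB.
by rewrite !mxE.
Qed.

End Nbhs.

(** * Analytic functions of several variables *)

Section AnalyticRow.
Variables (R : realType) (m : nat).
Local Notation C := (Cplx R).
Implicit Types (f g : 'rV[C]_m -> C) (a h : 'rV[C]_m) (k : {ffun 'I_m -> nat}).

Definition mono h k : C := \prod_(i < m) h 0 i ^+ k i.
Definition mono1 (r : R) k : R := \prod_(i < m) r ^+ k i.

Lemma nrm_mono_row h k : nrm (mono h k) = \prod_(i < m) nrm (h 0 i) ^+ k i.
Proof. by rewrite /mono nrm_prod; apply: eq_bigr => i _; rewrite nrmX. Qed.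

Lemma mono1_ge0 (r : R) k : 0 <= r -> 0 <= mono1 r k.
Proof. by move=> r0; apply: prodr_ge0 => i _; apply: exprn_ge0. Qed.

Lemma nrm_mono_le (r : R) h k : (forall i, nrm (h 0 i) <= r) -> nrm (mono h k) <= mono1 r k.
Proof.
move=> H; rewrite nrm_mono_row; apply: ler_prod => i _; rewrite exprn_ge0 ?nrm_ge0 //=.
by rewrite lerXn2r // ?nnegrE ?nrm_ge0 // (le_trans (nrm_ge0 _) (H i)).
Qed.

Lemma mono_const (r : R) k : mono (const_mx (ofR r)) k = ofR (mono1 r k).
Proof.
rewrite /mono /mono1; elim/big_rec2: _ => [//|i x y _ ->]; by rewrite mxE ofRM ofRX.
Qed.

Lemma analyticP f a : analytic_at f a <-> exists c (r : R), [/\ 0 < r,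
  abs_summable (fun k => c k * ofR (mono1 r k)) &
  forall h, (forall i, nrm (h 0 i) < r) -> has_csum (fun k => c k * mono h k) (f (a + h))].
Proof.
split=> [[c [r [/pos_ofR[er r0] H]]]|[c [r [r0 _ H]]]].
  move: (complex.Re r) er r0 => {r} s -> s0 in H *.
  have H' h : (forall i, nrm (h 0 i) < s) -> has_csum (fun k => c k * mono h k) (f (a + h)).
    by move=> hs; apply: H => i; rewrite nrm_lt.
  exists c, (s / 2); split; first by rewrite divr_gt0.
  - have := H' (const_mx (ofR (s / 2))).
    rewrite (_ : (fun _ => _) = (fun k => c k * ofR (mono1 (s / 2) k))); last first.
      by apply/funext => k; rewrite mono_const.
    move=> h; apply: csummable_abs_summable; eexists; apply: h => i.
    rewrite mxE nrm_ofR ger0_norm; lra.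
  - by move=> h hs; apply: H' => i; have := hs i; lra.
exists c, (ofR r); split; first by rewrite ltr_ofR.
by move=> h hr; apply: H => i; rewrite -nrm_lt.
Qed.

Lemma analytic_family (I : choiceType) (c : I -> C) (e : I -> {ffun 'I_m -> nat}) (r : R) f a : 0 < r ->
  abs_summable (fun i => c i * ofR (mono1 r (e i))) ->
  (forall h, (forall i, nrm (h 0 i) < r) -> has_csum (fun i => c i * mono h (e i)) (f (a + h))) ->
  analytic_at f a.
Proof.
move=> r0 ac H; exists (fun k => csum (restr [set i | e i = k] c)), (ofR r).
split; first by rewrite ltr_ofR.
move=> h hr; have := H h (fun i => etrans (esym (nrm_lt _ _)) (hr i)).
apply: (csum_group (x0 := fun k => ofR (mono1 r k)) (x := fun k => mono h k) _ ac) => k.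
rewrite -nrm_eq0 nrm_ofR normr_eq0; apply/prodf_neq0 => i _.
by rewrite expf_neq0 // gt_eqF.
Qed.

Lemma analytic_const b a : analytic_at (fun=> b) a.
Proof.
have m0 h : mono h [ffun=> 0%N] = 1 by rewrite /mono big1 // => i _; rewrite ffunE expr0.
apply: (@analytic_family unit (fun=> b) (fun=> [ffun=> 0%N]) 1) => [//||h _].
  by apply: csummable_abs_summable; eexists; apply: has_csum_fin.
by apply: (has_csum1 (i := tt)) => [[]|//]; rewrite m0 mulr1.
Qed.

Lemma mono1_le (r s : R) k : 0 <= r -> r <= s -> mono1 r k <= mono1 s k.
Proof.
move=> r0 rs; apply: ler_prod => i _; rewrite exprn_ge0 //= lerXn2r // nnegrE //.
exact: le_trans r0 rs.
Qed.

Lemma abs_summable_mono1 (c : {ffun 'I_m -> nat} -> C) (r s : R) : 0 <= r -> r <= s ->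
  abs_summable (fun k => c k * ofR (mono1 s k)) -> abs_summable (fun k => c k * ofR (mono1 r k)).
Proof.
move=> r0 rs; apply: (abs_summable_le_eq (fun k => nrmM _ _) (fun k => nrmM _ _)) => k.
rewrite ler_wpM2l ?nrm_ge0 // !nrm_ofR !ger0_norm ?mono1_ge0 ?(le_trans r0) //.
exact: mono1_le.
Qed.

Lemma analytic_add f g a : analytic_at f a -> analytic_at g a -> analytic_at (fun p => f p + g p) a.
Proof.
move=> /analyticP[c [r [r0 ac Hf]]] /analyticP[d [s [s0 ad Hg]]].
have [t [t0 tr ts]] := min_radius r0 s0.
apply: (@analytic_family _ (fun k => c k + d k) id t _ _ t0) => [|h hm].
  have := asmD (abs_summable_mono1 (ltW t0) tr ac) (abs_summable_mono1 (ltW t0) ts ad).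
  by congr abs_summable; apply/funext => k; rewrite mulrDl.
have := has_csumD (Hf h (fun i => lt_le_trans (hm i) tr)) (Hg h (fun i => lt_le_trans (hm i) ts)).
by apply: has_csum_ext => k; rewrite mulrDl.
Qed.

Lemma monoD h (k l : {ffun 'I_m -> nat}) : mono h [ffun i => (k i + l i)%N] = mono h k * mono h l.
Proof. by rewrite /mono -big_split; apply: eq_bigr => i _; rewrite ffunE exprD. Qed.

Lemma mono1D (r : R) (k l : {ffun 'I_m -> nat}) : mono1 r [ffun i => (k i + l i)%N] = mono1 r k * mono1 r l.
Proof. by rewrite /mono1 -big_split; apply: eq_bigr => i _; rewrite ffunE exprD. Qed.

Lemma analytic_mul f g a : analytic_at f a -> analytic_at g a -> analytic_at (fun p => f p * g p) a.
Proof.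
move=> /analyticP[c [r [r0 ac Hf]]] /analyticP[d [s [s0 ad Hg]]].
have [t [t0 tr ts]] := min_radius r0 s0.
apply: (@analytic_family _ (fun x => c x.1 * d x.2) (fun x => [ffun i => (x.1 i + x.2 i)%N]) t _ _ t0) => [|h hm].
  have := abs_summable_prod (abs_summable_mono1 (ltW t0) tr ac) (abs_summable_mono1 (ltW t0) ts ad).
  by congr abs_summable; apply/funext => k; rewrite mono1D ofRM mulrACA.
have := has_csum_prod (Hf h (fun i => lt_le_trans (hm i) tr)) (Hg h (fun i => lt_le_trans (hm i) ts)).
by apply: has_csum_ext => k; rewrite monoD mulrACA.
Qed.

Lemma analytic_sum (I : Type) (r : seq I) (P : pred I) (F : I -> 'rV[C]_m -> C) a :
  (forall i, P i -> analytic_at (F i) a) -> analytic_at (fun p => \sum_(i <- r | P i) F i p) a.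
Proof.
move=> H; elim: r => [|i r IH].
  by have := analytic_const 0 a; congr (analytic_at _ _); apply/funext => p; rewrite big_nil.
case: (boolP (P i)) => Pi; last first.
  by move: IH; congr (analytic_at _ _); apply/funext => p; rewrite big_cons (negbTE Pi).
have := analytic_add (H i Pi) IH.
by congr (analytic_at _ _); apply/funext => p; rewrite big_cons Pi.
Qed.

Lemma analytic_prod (I : Type) (r : seq I) (P : pred I) (F : I -> 'rV[C]_m -> C) a :
  (forall i, P i -> analytic_at (F i) a) -> analytic_at (fun p => \prod_(i <- r | P i) F i p) a.
Proof.
move=> H; elim: r => [|i r IH].
  by have := analytic_const 1 a; congr (analytic_at _ _); apply/funext => p; rewrite big_nil.
case: (boolP (P i)) => Pi; last first.
  by move: IH; congr (analytic_at _ _); apply/funext => p; rewrite big_cons (negbTE Pi).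
have := analytic_mul (H i Pi) IH.
by congr (analytic_at _ _); apply/funext => p; rewrite big_cons Pi.
Qed.

Lemma mono_delta h (i : 'I_m) n : mono h [ffun l => if l == i then n else 0%N] = h 0 i ^+ n.
Proof.
rewrite /mono (bigD1 i) //= ffunE eqxx big1 ?mulr1 // => l /negbTE li.
by rewrite ffunE li expr0.
Qed.

(** The binomial expansion of powers of [h 0 i - h 0 j] turns the series of [f] into a family over
    pairs of exponents. The pairs are added coordinatewise, so [i = j] is allowed. *)
Lemma analytic_comp (f : C -> C) a (i j : 'I_m) :
  analytic1_at f (a 0 i - a 0 j) -> analytic_at (fun p => f (p 0 i - p 0 j)) a.
Proof.
move=> /analytic1P[c [r [r0 ac H]]].
have [M hM] := ac.
have hMk (k : nat) : nrm (c k) * r ^+ k <= M.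
  by have := hM [fset k]%fset; rewrite big_seq_fset1 nrm_mono_real // ltW.
(* Binomial coefficients cost a factor [2 ^+ n]; at radius [r / 4] a factor [2^-1 ^+ n] is still
   left. *)
pose t := r / 4; have t0 : 0 < t by rewrite divr_gt0.
pose e (x : nat * nat) : {ffun 'I_m -> nat} := [ffun l => ((if l == i then x.1 else 0) + (if l == j then x.2 else 0))%N].
have eh h x : mono h (e x) = h 0 i ^+ x.1 * h 0 j ^+ x.2.
  rewrite -(mono_delta h i) -(mono_delta h j) -monoD; congr mono.
  by apply/ffunP => l; rewrite !ffunE.
have asm1 : abs_summable (fun x : nat * nat => (c (x.1 + x.2)%N * ('C(x.1 + x.2, x.1))%:R * (-1) ^+ x.2) * ofR (mono1 t (e x))).
  have h2 : nrm (ofR 2^-1 : C) < 1 by rewrite nrm_ofR ger0_norm ?invr_ge0 //; lra.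
  have e1 x : mono1 t (e x) = t ^+ (x.1 + x.2).
    have d1 (l : 'I_m) n : mono1 t [ffun i0 => if i0 == l then n else 0%N] = t ^+ n.
      rewrite /mono1 (bigD1 l) //= ffunE eqxx big1 ?mulr1 // => i0 /negbTE li.
      by rewrite ffunE li expr0.
    rewrite exprD -(d1 i x.1) -(d1 j x.2) -mono1D; congr mono1.
    by apply/ffunP => l; rewrite !ffunE.
  have nu (x : nat * nat) : nrm ((c (x.1 + x.2)%N * ('C(x.1 + x.2, x.1))%:R * (-1) ^+ x.2) * ofR (mono1 t (e x))) =
      nrm (c (x.1 + x.2)%N) * ('C(x.1 + x.2, x.1))%:R * t ^+ (x.1 + x.2).
    rewrite nrmM nrm_ofR ger0_norm ?mono1_ge0 ?(ltW t0) // e1; congr (_ * _).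
    by rewrite nrmM nrmX nrmN nrm1 expr1n mulr1 nrmM nrm_nat.
  have nv (x : nat * nat) : nrm (ofR M * (ofR 2^-1 ^+ x.1 * ofR 2^-1 ^+ x.2)) = `|M| * 2^-1 ^+ (x.1 + x.2).
    have h20 : 0 <= 2^-1 :> R by rewrite invr_ge0.
    by rewrite nrmM nrm_ofR -exprD nrmX nrm_ofR (ger0_norm h20).
  apply: (abs_summable_le_eq nu nv) (asmZ (ofR M) (abs_summable_prod (abs_summable_geom h2) (abs_summable_geom h2))) => -[k l] /=.
  have hC : ('C(k + l, k))%:R <= 2 ^+ (k + l) :> R.
    rewrite -natrX ler_nat; have := Pascal 1 1 (k + l); rewrite addn1 => ->.
    rewrite (bigD1 (Ordinal (leq_addr l k : (k < (k + l).+1)%N))) //= !exp1n !muln1.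
    exact: leq_addr.
  apply: le_trans (_ : nrm (c (k + l)%N) * r ^+ (k + l) * 2^-1 ^+ (k + l) <= _); last first.
    by rewrite ler_wpM2r ?exprn_ge0 ?invr_ge0 //; exact: le_trans (hMk _) (ler_norm _).
  rewrite -!mulrA ler_wpM2l ?nrm_ge0 //.
  apply: le_trans (ler_wpM2r _ hC) _; first by rewrite exprn_ge0 // ltW.
  by rewrite -!exprMn /t (_ : 2 * (r / 4) = r * 2^-1) //; lra.
apply: (@analytic_family _ _ e t _ _ t0 asm1) => h ht.
have hij : nrm (h 0 i - h 0 j) < r.
  apply: le_lt_trans (nrmD _ _) _; rewrite nrmN; have := ht i; have := ht j; rewrite /t; lra.
have [s hs] : csummable (fun x => (c (x.1 + x.2)%N * ('C(x.1 + x.2, x.1))%:R * (-1) ^+ x.2) * mono h (e x)).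
  apply: abs_summable_csummable; move: asm1.
  apply: (abs_summable_le_eq (fun x => nrmM _ _) (fun x => nrmM _ _)) => x.
  rewrite ler_wpM2l ?nrm_ge0 // nrm_ofR ger0_norm ?mono1_ge0 ?(ltW t0) //.
  by apply: nrm_mono_le => l; exact/ltW.
suff -> : f ((a + h) 0 i - (a + h) 0 j) = s by [].
have := H _ hij; rewrite !mxE (_ : a 0 i + h 0 i - (a 0 j + h 0 j) = a 0 i - a 0 j + (h 0 i - h 0 j)); last by ring.
move=> /has_csum_uniq; apply; apply: (has_csum_antidiag hs) => n.
rewrite addrC exprDn mulr_sumr; apply: eq_bigr => l _ /=.
rewrite subnKC; last by rewrite -ltnS.
rewrite eh /= -mulr_natr (exprNn (h 0 j)).
move: (c n) (_ %:R) ((-1) ^+ _) (h 0 i ^+ l) (h 0 j ^+ _) => x y z u v; ring.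
Qed.

End AnalyticRow.

(** * Poles and the identity theorem for meromorphic functions *)

Section Identity.
Variable R : realType.
Local Notation C := (Cplx R).
Implicit Types (f g : C -> C) (a b : C).

(** The centre is left out because a meromorphic function may take any value at a pole. *)
Definition punctured_eq f g a : Prop :=
  exists r : R, 0 < r /\ forall h, h != 0 -> nrm h < r -> f (a + h) = g (a + h).

Lemma small_point (r : R) : 0 < r -> exists h : C, h != 0 /\ nrm h < r.
Proof.
move=> r0; exists (ofR (r / 2)); rewrite -nrm_eq0 nrm_ofR ger0_norm ?divr_ge0 ?(ltW r0) //.
by split; [rewrite gt_eqF // divr_gt0|lra].
Qed.

Lemma analytic1_sub f g a : analytic1_at f a -> analytic1_at g a -> analytic1_at (fun z => f z - g z) a.
Proof. by move=> hf hg; apply: analytic1_add hf (analytic1_opp hg). Qed.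

Lemma analytic1_punctured f g a : analytic1_at f a -> analytic1_at g a ->
  punctured_eq f g a -> f a = g a.
Proof.
move=> hf hg [r [r0 H]].
case: (analytic1_zero (analytic1_sub hf hg)) => [[s [s0 Hs]]|[s [s0 Hs]]].
  by have := Hs 0; rewrite nrm0 addr0 => /(_ s0)/eqP; rewrite subr_eq0 => /eqP.
have [t [t0 tr ts]] := min_radius r0 s0.
have [h [h0 ht]] := small_point t0.
by have := Hs h h0 (lt_le_trans ht ts); rewrite H ?subrr ?eqxx // (lt_le_trans ht tr).
Qed.

Definition pole_at f a : Prop := exists (k : nat) (g : C -> C), [/\ (0 < k)%N, analytic1_at g a, g a != 0 &
   exists r : R, 0 < r /\ forall h, h != 0 -> nrm h < r -> f (a + h) = g (a + h) / h ^+ k].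

Definition mero_at f a : Prop := analytic1_at f a \/ pole_at f a.

Lemma mero_atP f a : mero_at f a <-> (analytic1_at f a \/
    exists (k : nat) (g : C -> C), [/\ (0 < k)%N, analytic1_at g a, g a != 0 &
      \forall z \near a, z != a -> f z = g z / (z - a) ^+ k]).
Proof.
split=> -[h|[k [g [k0 hg ga H]]]]; [by left|right|by left|right]; exists k, g; split=> //.
  have [r [r0 hr]] := H; apply/nbhsCP; exists r; split=> // h hh /= ne.
  rewrite hr //; first by rewrite addrAC subrr add0r.
  by apply: contraNneq ne => ->; rewrite addr0.
have /nbhsCP[r [r0 hr]] := H; exists r; split=> // h h0 hh.
rewrite (hr h hh); first by rewrite addrAC subrr add0r.
by rewrite -subr_eq0 addrAC subrr add0r.
Qed.

Lemma meromorphic1P f : meromorphic1 f <-> forall a, mero_at f a.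
Proof. by split=> H a; have /mero_atP := H a. Qed.

(** After multiplication by [(z - a) ^+ k] the analytic function vanishes at [a], whereas the
    numerator of the pole does not. *)
Lemma pole_not_analytic f g a : pole_at f a -> analytic1_at g a -> ~ punctured_eq f g a.
Proof.
move=> [k [p [k0 hp pa [r [r0 H]]]]] hg [s [s0 Hs]].
pose G z := g z * (z - a) ^+ k.
have hG : analytic1_at G a.
  by apply: analytic1_mul hg (analytic1_exp _ (analytic1_sub (analytic1_id a) (analytic1_const a a))).
have [t [t0 tr ts]] := min_radius r0 s0.
have : p a = G a.
  apply: analytic1_punctured hp hG _; exists t; split=> // h h0 ht.
  rewrite /G addrAC subrr add0r -Hs ?(lt_le_trans ht) // H ?(lt_le_trans ht) //.
  by rewrite divfK // expf_neq0.
by rewrite /G subrr expr0n eqn0Ngt k0 mulr0 => /eqP; rewrite (negbTE pa).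
Qed.

Lemma mero_quot f a : mero_at f a -> exists (k : nat) (g : C -> C), analytic1_at g a /\
  exists r : R, 0 < r /\ forall h, h != 0 -> nrm h < r -> f (a + h) * h ^+ k = g (a + h).
Proof.
case=> [hf|[k [g [k0 hg ga [r [r0 H]]]]]].
  by exists 0%N, f; split=> //; exists 1; split=> // h _ _; rewrite expr0 mulr1.
exists k, g; split=> //; exists r; split=> // h h0 hr.
by rewrite H // divfK // expf_neq0.
Qed.

(* Zeros being isolated, both alternatives are open conditions on [a]. *)
Lemma mero_dichotomy f g a : mero_at f a -> mero_at g a -> punctured_eq f g a \/
  exists r : R, 0 < r /\ forall h, h != 0 -> nrm h < r -> f (a + h) != g (a + h).
Proof.
move=> /mero_quot[k [p [hp [r [r0 Hr]]]]] /mero_quot[l [q [hq [s [s0 Hs]]]]].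
have hX n : analytic1_at (fun z => (z - a) ^+ n) a.
  exact: analytic1_exp _ (analytic1_sub (analytic1_id a) (analytic1_const a a)).
have hF := analytic1_sub (analytic1_mul hp (hX l)) (analytic1_mul hq (hX k)).
have [t [t0 tr ts]] := min_radius r0 s0.
have E h : h != 0 -> nrm h < t ->
    p (a + h) * (a + h - a) ^+ l - q (a + h) * (a + h - a) ^+ k = (f (a + h) - g (a + h)) * h ^+ (k + l).
  move=> h0 ht; rewrite addrAC subrr add0r -Hr ?(lt_le_trans ht) // -Hs ?(lt_le_trans ht) //.
  rewrite exprD; move: (f _) (g _) (h ^+ k) (h ^+ l) => x y z w; ring.
case: (analytic1_zero hF) => -[u [u0 Hu]]; have [v [v0 vt vu]] := min_radius t0 u0; [left|right];
    exists v; split=> // h h0 hv; have := E h h0 (lt_le_trans hv vt).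
  rewrite (Hu h (lt_le_trans hv vu)) => /esym/eqP; rewrite mulf_eq0 expf_eq0 (negbTE h0) andbF orbF.
  by rewrite subr_eq0 => /eqP.
move=> e; have := Hu h h0 (lt_le_trans hv vu); rewrite e mulf_eq0 expf_eq0 (negbTE h0) andbF orbF.
by rewrite subr_eq0.
Qed.

(** Around a point [b] different from [a] the new disc is taken so small that it avoids [a]. *)
Lemma punctured_open (P : C -> Prop) a (r : R) : 0 < r ->
  (forall h, h != 0 -> nrm h < r -> P (a + h)) ->
  forall b, nrm (b - a) < r -> exists s : R, 0 < s /\ forall h, h != 0 -> nrm h < s -> P (b + h).
Proof.
move=> r0 H b hb; have [->|ba] := eqVneq b a; first by exists r.
have n0 : 0 < nrm (b - a) by rewrite lt_def nrm_eq0 subr_eq0 ba nrm_ge0.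
have r1 : 0 < r - nrm (b - a) by lra.
have [t [t0 tr ts]] := min_radius n0 r1.
exists t; split=> // h h0 ht.
rewrite (_ : b + h = a + (b - a + h)); last by rewrite addrA addrCA subrr addr0.
apply: H.
  rewrite addrC addr_eq0; apply/eqP => e; have := nrmN (b - a); rewrite -e; lra.
apply: le_lt_trans (nrmD _ _) _; lra.
Qed.

Lemma path_open (S : C -> Prop) a b :
  (forall c, S c -> exists r : R, 0 < r /\ forall d, nrm (d - c) < r -> S d) ->
  open [set t : R | S (a + ofR t * b)].
Proof.
move=> H; rewrite openE => t /= /H[r [r0 hr]].
have d0 : 0 < nrm b + 1 by rewrite ltr_wpDl // nrm_ge0.
apply/nbhs_ballP; exists (r / (nrm b + 1)); first by rewrite /= divr_gt0.
move=> s; rewrite -ball_normE /ball_ /= ltr_pdivlMr // => hs; apply: hr.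
have -> : a + ofR s * b - (a + ofR t * b) = ofR (s - t) * b by rewrite ofRD ofRN; ring.
rewrite nrmM nrm_ofR distrC; apply: le_lt_trans hs.
by rewrite ler_wpM2l // lerDl.
Qed.

(** The real parameters [t] for which the functions agree around [a + t (b - a)] form an open set.
    By the dichotomy its complement is open too, and the real line is connected. *)
Lemma mero_identity f g a : meromorphic1 f -> meromorphic1 g ->
  punctured_eq f g a -> forall b, punctured_eq f g b.
Proof.
move=> /meromorphic1P mf /meromorphic1P mg fga b.
pose N c := exists r : R, 0 < r /\ forall h, h != 0 -> nrm h < r -> f (c + h) != g (c + h).
have oS c : punctured_eq f g c -> exists r : R, 0 < r /\ forall d, nrm (d - c) < r -> punctured_eq f g d.
  by move=> [r [r0 H]]; exists r; split=> // d; exact: (@punctured_open (fun z => f z = g z) c r r0 H).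
have oN c : N c -> exists r : R, 0 < r /\ forall d, nrm (d - c) < r -> N d.
  by move=> [r [r0 H]]; exists r; split=> // d; exact: (@punctured_open (fun z => f z != g z) c r r0 H).
have SN c : punctured_eq f g c -> N c -> False.
  move=> [r [r0 Hr]] [s [s0 Hs]]; have [t [t0 tr ts]] := min_radius r0 s0.
  have [h [h0 ht]] := small_point t0.
  by have := Hs h h0 (lt_le_trans ht ts); rewrite (Hr h h0 (lt_le_trans ht tr)) eqxx.
have oU := @path_open (punctured_eq f g) a (b - a) oS; have oV := @path_open N a (b - a) oN.
set U := [set t : R | _] in oU; set V := [set t : R | _] in oV.
have UV : U = ~` V.
  apply/seteqP; split=> t /=; first by move=> h1 h2; exact: SN h1 h2.
  by move=> nV; case: (mero_dichotomy (mf (a + ofR t * (b - a))) (mg _)).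
have cR : connected [set: R] by apply/connected_intervalP => x y _ _ z _.
have H := cR U.
have : U = setT.
  apply: H.
  - by exists 0; rewrite /U /= mul0r addr0.
  - by exists U => //; rewrite setTI.
  - by exists U; rewrite ?setTI //; rewrite UV; apply: open_closedC.
by move=> /seteqP[_ /(_ 1 I)]; rewrite /U /= (_ : ofR 1 = 1) // mul1r addrC subrK.
Qed.

End Identity.

(** * The kernel of the exponential and the choice of the twist *)

Section Kernel.
Variable R : realType.
Local Notation C := (Cplx R).

Lemma cexp_twopii_ofR (t : R) : cexp (twopii R * ofR t) = Complex (cos (2 * pi * t)) (sin (2 * pi * t)).
Proof.
rewrite /cexp /= !(mul0r, mulr0, subr0, add0r, oppr0) expR0.
by apply/eqP; rewrite eq_complex /= !(mul0r, mulr0, subr0, addr0, mul1r) !eqxx.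
Qed.

Lemma cexp_twopii_int (k : int) : cexp (twopii R * k%:~R) = 1.
Proof.
rewrite cexpMz -[twopii R]mulr1 (_ : 1 = ofR 1) // cexp_twopii_ofR mulr1 mulr_natl cos2pi sin2pi.
exact: exp1rz.
Qed.

(** For the fractional part [s] of [t], having [0 < s < 1] would give [sin (pi * s) > 0] and hence a
    cosine of [2 * pi * s] below 1. *)
Lemma cexp_twopii_eq1 (t : R) : cexp (twopii R * ofR t) = 1 -> exists k : int, t = k%:~R.
Proof.
move=> h; exists (Num.floor t); have /andP[h1 h2] := floor_itv t.
pose s := t - (Num.floor t)%:~R.
have : cexp (twopii R * ofR s) = 1.
  by rewrite /s ofRD ofRN ofR_int mulrBr cexpD h mul1r cexpN cexp_twopii_int invr1.
rewrite cexp_twopii_ofR => /eqP; rewrite eq_complex /= => /andP[/eqP hc _].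
apply/eqP; rewrite -subr_eq0 -/s; apply/eqP.
have s0 : 0 <= s by rewrite /s subr_ge0.
have s1 : s < 1 by rewrite /s; move: h2; rewrite intrD; lra.
apply/eqP; rewrite eq_le s0 andbT leNgt; apply/negP => sp.
have : 0 < sin (pi * s).
  by apply: sin_gt0_pi; rewrite mulr_gt0 ?pi_gt0 //= gtr_pMr ?pi_gt0.
move: hc; rewrite -mulrA mulr_natl cos_mulr2n.
have := cos2Dsin2 (pi * s); move: (cos _) (sin _) => x y; nra.
Qed.

(** The fractional part of [t] shows that the choice in [twist] is not vacuous; equality of the
    exponentials then makes [t - l] an integer. *)
Lemma twistP (t : R) : let l := twist (cexp (twopii R * ofR t)) in
  [/\ 0 <= l, l < 1 & exists k : int, t = l + k%:~R].
Proof.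
rewrite /twist; set S := [set l : R | _].
have : S (t - (Num.floor t)%:~R).
  have /andP[h1 h2] := floor_itv t; split.
    by rewrite subr_ge0 h1 /=; move: h2; rewrite intrD; lra.
  by rewrite ofRD ofRN ofR_int mulrBr cexpD cexpN cexp_twopii_int invr1 mulr1.
move=> hS; have [/andP[h0 h1] h2] := xgetPex 0 (ex_intro _ _ hS); split=> //.
set l := xget _ _ in h0 h1 h2 *.
have [k hk] : exists k : int, t - l = k%:~R.
  apply: cexp_twopii_eq1.
  by rewrite ofRD ofRN mulrBr cexpD cexpN h2 mulfV // cexp_neq0.
by exists k; rewrite -hk addrC subrK.
Qed.

End Kernel.

(** * The twisted Weierstrass function *)

Lemma ofR1 (R : realType) : ofR 1 = 1 :> Cplx R. Proof. by []. Qed.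

Section TwistedSeries.
Variable R : realType.
Local Notation C := (Cplx R).
Variables (theta tau : C) (lam : R).
Hypothesis theta1 : nrm theta = 1.
Hypothesis tau0 : 0 < complex.Im tau.
Hypothesis lam0 : 0 <= lam.
Hypothesis lam1 : lam < 1.

Definition expo (k : int) : R := k%:~R + lam.
(** |q| = e^(-width), so the annulus |q| < |e^z| < 1 becomes the strip [- width < Re z < 0]. *)
Definition width : R := 2 * pi * complex.Im tau.
Definition qpow (k : int) : C := cexp (twopii R * ofR (expo k) * tau).
Hypothesis nz : forall k, 1 - theta^-1 * qpow k != 0.
Definition ucoef (k : int) : C := (1 - theta^-1 * qpow k)^-1.

Local Notation L := width.
Local Notation u := ucoef.

Lemma width_gt0 : 0 < L.
Proof. by rewrite !mulr_gt0 // pi_gt0. Qed.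

Lemma Re_ofRM (x : R) (z : C) : complex.Re (ofR x * z) = x * complex.Re z.
Proof. by case: z => a b /=; rewrite mul0r subr0. Qed.

Lemma Re_D (z w : C) : complex.Re (z + w) = complex.Re z + complex.Re w.
Proof. by case: z w => a b [c d]. Qed.

Lemma Re_N (z : C) : complex.Re (- z) = - complex.Re z.
Proof. by case: z => a b. Qed.

Lemma Re_twopii_tau : complex.Re (twopii R * tau) = - L.
Proof. by rewrite /width; case: tau => a b /=; rewrite mul0r sub0r. Qed.

Lemma nrm_qpow k : nrm (qpow k) = expR (- (expo k * L)).
Proof.
rewrite /qpow nrm_cexp; congr expR.
rewrite mulrAC [_ * ofR _]mulrC Re_ofRM Re_twopii_tau; ring.
Qed.

Lemma nrm_thq k : nrm (theta^-1 * qpow k) = expR (- (expo k * L)).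
Proof. by rewrite nrmM nrmV theta1 invr1 mul1r nrm_qpow. Qed.

Lemma expo_ge0 (k : int) : 0 <= k -> 0 <= expo k.
Proof. by move=> k0; rewrite addr_ge0 // ler0z. Qed.

Lemma expo_lt0 (k : int) : k < 0 -> expo k < 0.
Proof.
move=> k0; rewrite /expo; have : k%:~R <= (-1)%:~R :> R by rewrite ler_int; lia.
by rewrite mulrN1z; move: lam1; lra.
Qed.

(** As [theta] is unimodular, for |n| >= 1 the denominator is at least 1 - |q| times the larger of 1
    and |q^n|, whether n is positive or negative. *)
Lemma ucoef_bound : exists M : R, 0 < M /\ forall k, nrm (u k) <= M /\ nrm (u k) <= M * expR (expo k * L).
Proof.
have L0 := width_gt0.
have eL : expR (- L) < 1 by rewrite -[ltRHS]expR0 ltr_expR oppr_lt0.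
pose d := 1 - expR (- L); have d0 : 0 < d by rewrite /d subr_gt0.
have id0 : 0 < d^-1 by rewrite invr_gt0.
have nu k : nrm (u k) = (nrm (1 - theta^-1 * qpow k))^-1 by rewrite /ucoef nrmV.
have l1 k : 1 - expR (- (expo k * L)) <= nrm (1 - theta^-1 * qpow k).
  by have := nrm_tri 1 (theta^-1 * qpow k); rewrite nrm1 nrm_thq.
have l2 k : expR (- (expo k * L)) - 1 <= nrm (1 - theta^-1 * qpow k).
  by have := nrm_tri (theta^-1 * qpow k) 1; rewrite nrm1 nrm_thq nrmB.
have eL1 : 1 <= expR L by rewrite -[leLHS]expR0 ler_expR ltW.
(* At the indices 0 and -1 the modulus of q^n may be close or equal to 1, so these coefficients
   enter the constant directly; [expR L] makes up for [expR (expo (-1) * L)], which is at least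
   [expR (- L)]. *)
exists (d^-1 + nrm (u 0) + nrm (u (-1)) * expR L); split.
  by rewrite !ltr_wpDr ?mulr_ge0 ?nrm_ge0 ?expR_ge0.
move=> k; set M := _ + _.
have M1 : d^-1 <= M by rewrite /M -addrA lerDl addr_ge0 ?mulr_ge0 ?nrm_ge0 ?expR_ge0.
have M2 : nrm (u 0) <= M.
  have := nrm_ge0 (u (-1)); have := mulr_ge0 (nrm_ge0 (u (-1))) (expR_ge0 L); rewrite /M; lra.
have M3 : nrm (u (-1)) * expR L <= M by have := nrm_ge0 (u 0); rewrite /M; lra.
have M4 : nrm (u (-1)) <= M.
  by apply: le_trans M3; rewrite ler_peMr // nrm_ge0.
have M0 : 0 < M by exact: lt_le_trans id0 M1.
have pos (x : R) : 0 <= x -> nrm (u k) <= M -> expo k = x -> nrm (u k) <= M /\ nrm (u k) <= M * expR (expo k * L).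
  move=> x0 h ->; split=> //; apply: le_trans h _; rewrite ler_peMr ?(ltW M0) //.
  by rewrite -[leLHS]expR0 ler_expR mulr_ge0 // ltW.
have [k1|k1] := leP 1 k.
  have e1 : 1 <= expo k.
    have : (1%:~R : R) <= k%:~R by rewrite ler_int.
    by rewrite /expo; move: lam0; lra.
  apply: (pos (expo k)) => //; first by lra.
  apply: le_trans M1; rewrite nu lef_pV2 ?posrE //; last by rewrite lt_def nrm_eq0 nz nrm_ge0.
  by apply: le_trans (l1 k); rewrite /d lerD2l lerN2 ler_expR lerN2 ler_peMl // ltW.
have [k2|k2] := leP k (-2).
  have e1 : expo k <= -1.
    have : (k%:~R : R) <= (-2)%:~R by rewrite ler_int.
    rewrite /expo -[(-2)%:~R]/(- 2%:R); move: lam1; lra.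
  have eE : expR (expo k * L) <= 1.
    by rewrite -[leRHS]expR0 ler_expR nmulr_rle0 ?(ltW L0) //; lra.
  have hh : nrm (u k) <= M * expR (expo k * L).
    rewrite nu -[leRHS]invrK invfM -expRN lef_pV2 ?posrE; last first.
      by rewrite mulr_gt0 ?invr_gt0 ?expR_gt0.
      by rewrite lt_def nrm_eq0 nz nrm_ge0.
    apply: le_trans (l2 k); apply: le_trans (_ : d * expR (- (expo k * L)) <= _).
      by rewrite ler_wpM2r ?expR_ge0 // -[leRHS]invrK lef_pV2 ?posrE.
    rewrite /d mulrBl mul1r lerD2l lerN2 -expRD -[leLHS]expR0 ler_expR.
    by have := ler_wpM2r (ltW L0) e1; lra.
  split=> //; apply: le_trans hh _; rewrite ger_pMr //.
have : k = 0 \/ k = -1 by clear -k1 k2; lia.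
case=> ek; first by apply: (pos lam) => //; rewrite ek // /expo add0r.
rewrite ek; split=> //; apply: le_trans (_ : nrm (u (-1)) * expR L * expR (expo (-1) * L) <= _); last first.
  by rewrite ler_wpM2r ?expR_ge0.
rewrite -mulrA ler_peMr ?nrm_ge0 // -expRD -[leLHS]expR0 ler_expR.
by rewrite /expo mulrDl addrA mulrN1z mulN1r subrr add0r mulr_ge0 // ltW.
Qed.

Lemma thq_u k : 1 - u k = - (theta^-1 * qpow k * u k).
Proof. by move: (nz k); rewrite /ucoef; move: (_ * _) => x hx; field. Qed.

(** The subtracted step is the limit of [u] at either end, so what remains decays in both
    directions. *)
Definition wcoef (k : int) : C := u k - (if 0 <= k then 1 else 0).

Lemma coef_bound : exists M : R, [/\ 0 < M,
  forall k, 0 <= k -> nrm (u k) <= M,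
  forall k, k < 0 -> nrm (u k) <= M * expR (expo k * L),
  forall k, 0 <= k -> nrm (1 - u k) <= M * expR (- (expo k * L)) &
  forall k, k < 0 -> nrm (1 - u k) <= M].
Proof.
have [M [M0 H]] := ucoef_bound; exists M.
have e k : nrm (1 - u k) = expR (- (expo k * L)) * nrm (u k).
  by rewrite thq_u nrmN nrmM nrm_thq.
split=> // k k0; have [h1 h2] := H k => //.
  by rewrite e mulrC ler_wpM2r ?expR_ge0.
rewrite e mulrC -ler_pdivlMr ?expR_gt0 // -expRN opprK //.
Qed.

Lemma abs_summable_expo (d : R) : 0 < d -> abs_summable (fun k : int => ofR (expR (- (d * `|expo k|))) : C).
Proof.
move=> d0; have e1 : nrm (ofR (expR (- d)) : C) < 1.
  by rewrite nrm_ofR ger0_norm ?expR_ge0 // -[ltRHS]expR0 ltr_expR oppr_lt0.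
have key (g : nat -> int) : (forall n, n%:R - 1 <= `|expo (g n)|) ->
    abs_summable (fun n => ofR (expR (- (d * `|expo (g n)|))) : C).
  move=> hg; apply: (abs_summable_le_eq (fun n => nrm_ofR _) (fun n => nrmM _ _) _ (asmZ (ofR (expR d)) (abs_summable_geom e1))) => n.
  rewrite nrmX !nrm_ofR !(ger0_norm (expR_ge0 _)) -expRM_natl -expRD ler_expR.
  have := ler_wpM2l (ltW d0) (hg n); rewrite mulrBr mulr1 mulrN [n%:R * d]mulrC; lra.
apply: abs_summable_int; apply: key => n; rewrite /expo.
  rewrite ger0_norm ?addr_ge0 //; move: lam0; lra.
rewrite mulrNz -[(n%:Z)%:~R]/(n%:R).
have := ler_norm (- (- n%:R + lam)); rewrite normrN; move: lam1; lra.
Qed.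

Lemma abs_summable_expo_le (f : int -> C) (M d : R) : 0 < d ->
  (forall k, nrm (f k) <= M * expR (- (d * `|expo k|))) -> abs_summable f.
Proof.
move=> d0 H; apply: (abs_summable_le_eq (fun k => erefl _) (fun k => nrmM _ _) _ (asmZ (ofR M) (abs_summable_expo d0))) => k.
rewrite !nrm_ofR (ger0_norm (expR_ge0 _)); apply: le_trans (H k) _.
by rewrite ler_wpM2r ?expR_ge0 // ler_norm.
Qed.

Definition term_u (k : int) (z : C) : C := cexp (ofR (expo k) * z) * u k.
Definition term_1u (k : int) (z : C) : C := cexp (ofR (expo k) * z) * (1 - u k).
Definition term_w (k : int) (z : C) : C := cexp (ofR (expo k) * z) * wcoef k.

Lemma nrm_cexp_expo k z : nrm (cexp (ofR (expo k) * z)) = expR (expo k * complex.Re z).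
Proof. by rewrite nrm_cexp Re_ofRM. Qed.

(** The distance [d] from both walls of the strip is all that the bound knows about [z]; this yields
    uniform convergence on compact sets. *)
Lemma term_u_bound : exists M : R, 0 < M /\ forall (d : R) z k, 0 < d ->
  d - L <= complex.Re z <= - d -> nrm (term_u k z) <= M * expR (- (d * `|expo k|)).
Proof.
have [M [M0 h1 h2 _ _]] := coef_bound; exists M; split=> // d z k d0 /andP[x1 x2].
rewrite nrmM nrm_cexp_expo mulrC; have [k0|k0] := leP 0 k.
  apply: ler_pM; rewrite ?nrm_ge0 ?expR_ge0 ?h1 // ler_expR ger0_norm ?expo_ge0 //.
  by rewrite -mulNr mulrC ler_wpM2r // expo_ge0.
apply: le_trans (ler_wpM2r (expR_ge0 _) (h2 k k0)) _.
rewrite -mulrA ler_wpM2l ?(ltW M0) // -expRD ler_expR ltr0_norm ?expo_lt0 //.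
rewrite -mulrDr mulrN opprK mulrC ler_wnM2r ?(ltW (expo_lt0 k0)) //; lra.
Qed.

Lemma wcoef_bound : exists M : R, 0 < M /\ forall k, nrm (wcoef k) <= M * expR (- (L * `|expo k|)).
Proof.
have [M [M0 _ h2 h3 _]] := coef_bound; exists M; split=> // k.
rewrite /wcoef; have [k0|k0] := leP 0 k.
  by rewrite nrmB ger0_norm ?expo_ge0 // [L * _]mulrC; exact: h3.
by rewrite subr0 ltr0_norm ?expo_lt0 // mulrN opprK [L * _]mulrC; exact: h2.
Qed.

Definition wsum (z : C) : C := csum (term_w ^~ z).

(** Each exponential is expanded about [a], and the double series over [k] and the Taylor order
    converges absolutely by Tonelli. *)
Lemma analytic1_wsum a : `|complex.Re a| < L -> analytic1_at wsum a.
Proof.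
move=> ha; have [M [M0 hM]] := wcoef_bound.
(* Of the distance [2 * r] to the walls of the strip, one [r] pays for the growth of the Taylor
   series in the disc and the other remains as decay in [k]. *)
have [r [r0 hra]] : exists r, 0 < r /\ `|complex.Re a| = L - 2 * r.
  by exists ((L - `|complex.Re a|) / 2); split; lra.
pose c (x : int * nat) : C := term_w x.1 a * (ofR (expo x.1) ^+ x.2 / (x.2`!)%:R).
have nt k : nrm (term_w k a) * expR (`|expo k| * r) <= M * expR (- (r * `|expo k|)).
  rewrite nrmM nrm_cexp_expo mulrAC -expRD.
  apply: le_trans (ler_wpM2l (expR_ge0 _) (hM k)) _.
  rewrite mulrCA ler_wpM2l ?(ltW M0) // -expRD ler_expR.
  have := ler_norm (expo k * complex.Re a); rewrite normrM => h.
  have : `|expo k| * `|complex.Re a| = `|expo k| * (L - 2 * r) by rewrite hra.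
  lra.
have ac : abs_summable (fun x => c x * ofR r ^+ x.2).
  have nc k (j : nat) : nrm (c (k, j) * ofR r ^+ j) = nrm (term_w k a) * nrm (expterm (ofR (`|expo k| * r)) j).
    rewrite nrm_mono_real ?(ltW r0) // /c /= nrmM -mulrA; congr (_ * _).
    have e x : nrm (expterm (ofR x : C) j) = exp_coeff `|x| j by rewrite nrm_expterm nrm_ofR.
    transitivity (exp_coeff `|expo k| j * r ^+ j); first by congr (_ * _); exact: e.
    rewrite e /exp_coeff /=.
    by rewrite normrM normr_id (ger0_norm (ltW r0)) exprMn [RHS]mulrAC.
  have [B hB] := abs_summable_expo r0.
  apply: (@abs_summable_tonelli _ _ _ _ (fun k => M * expR (- (r * `|expo k|))) (M * B)) => [k A|A].
    rewrite (eq_bigr (fun j => nrm (term_w k a) * nrm (expterm (ofR (`|expo k| * r)) j))) => [|j _]; last exact: nc.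
    rewrite -mulr_sumr; apply: le_trans (nt k); rewrite ler_wpM2l ?nrm_ge0 //.
    apply: le_trans (expterm_abs_bounded _ _) _.
    by rewrite nrm_ofR ger0_norm // mulr_ge0 // ltW.
  rewrite -mulr_sumr ler_wpM2l ?(ltW M0) //.
  apply: le_trans (hB A); apply: ler_sum => k _; by rewrite nrm_ofR (ger0_norm (expR_ge0 _)).
apply: (@analytic1_family _ _ c snd r _ _ r0 ac) => h hr.
have tm k : term_w k (a + h) = term_w k a * cexp (ofR (expo k) * h).
  by rewrite /term_w (mulrDr _ a h) cexpD mulrAC.
have he k : has_csum (fun j => c (k, j) * h ^+ j) (term_w k (a + h)).
  rewrite tm; have := has_csumZ (term_w k a) (cexp_series (ofR (expo k) * h)).
  by apply: has_csum_ext => j; rewrite /c /expterm exprMn -mulrA; congr (_ * _); rewrite mulrAC.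
have aw : abs_summable (term_w ^~ (a + h)).
  apply: (abs_summable_expo_le (M := M) r0) => k; apply: le_trans (nt k).
  rewrite tm nrmM ler_wpM2l ?nrm_ge0 // nrm_cexp_expo ler_expR.
  apply: le_trans (ler_norm _) _; rewrite normrM ler_wpM2l //.
  exact: le_trans (nrm_Re h) (ltW hr).
apply: (has_csum_fubini _ he (csumP (abs_summable_csummable aw))).
move: ac; apply: (abs_summable_le_eq (fun x => nrm_mono _ _ _) (fun x => nrm_mono_real _ _ (ltW r0))) => x.
by rewrite ler_wpM2l ?nrm_ge0 // lerXn2r ?nnegrE ?nrm_ge0 ?(ltW r0) // ltW.
Qed.


(* The coefficients [u k] tend to 1 as [k] tends to infinity; splitting off the
   geometric series leaves a series converging on [|q| < |e^z| < 1/|q|]. *)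
Definition geo_annulus (z : C) : C := - (cexp (ofR lam * z) / (1 - cexp z)) - wsum z.

Lemma abs_summable_term_w z : `|complex.Re z| < L -> abs_summable (term_w ^~ z).
Proof.
move=> hz; have [M [M0 hM]] := wcoef_bound.
have d0 : 0 < L - `|complex.Re z| by lra.
apply: (abs_summable_expo_le (M := M) d0) => k; rewrite nrmM nrm_cexp_expo.
apply: le_trans (ler_wpM2l (expR_ge0 _) (hM k)) _.
rewrite mulrCA ler_wpM2l ?(ltW M0) // -expRD ler_expR.
have := ler_norm (expo k * complex.Re z); rewrite normrM; lra.
Qed.

Lemma has_csum_wsum z : `|complex.Re z| < L -> has_csum (term_w ^~ z) (wsum z).
Proof. by move=> hz; apply/csumP/abs_summable_csummable/abs_summable_term_w. Qed.

Lemma cexp_expo k z : cexp (ofR (expo k) * z) = cexp (ofR lam * z) * cexp z ^ k.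
Proof. by rewrite /expo ofRD ofR_int mulrDl cexpD [k%:~R * z]mulrC cexpMz mulrC. Qed.

Lemma geo_pos z : complex.Re z < 0 ->
  has_csum (fun k : int => if 0 <= k then cexp (ofR (expo k) * z) else 0) (cexp (ofR lam * z) / (1 - cexp z)).
Proof.
move=> hz; have z1 : nrm (cexp z) < 1 by rewrite nrm_cexp -[ltRHS]expR0 ltr_expR.
have h := has_csumZ (cexp (ofR lam * z)) (has_csum_geom z1).
apply: (has_csum_inj (h := Posz) _ _ _ h); first by move=> x y [].
  by move=> n; rewrite /= cexp_expo.
by move=> [n|n] hn //; case: (hn n).
Qed.

(** On this side the same rational function expands in negative powers of [cexp z], with the
    opposite sign. *)
Lemma geo_neg z : 0 < complex.Re z ->
  has_csum (fun k : int => if 0 <= k then 0 else cexp (ofR (expo k) * z)) (- (cexp (ofR lam * z) / (1 - cexp z))).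
Proof.
move=> hz; have z1 : nrm (cexp (- z)) < 1 by rewrite nrm_cexp -[ltRHS]expR0 ltr_expR Re_N oppr_lt0.
have h := has_csumZ (cexp (ofR lam * z) * cexp (- z)) (has_csum_geom z1).
have -> : - (cexp (ofR lam * z) / (1 - cexp z)) = cexp (ofR lam * z) * cexp (- z) / (1 - cexp (- z)).
  have w0 : cexp z != 0 := cexp_neq0 z.
  have w1 : 1 - cexp z != 0.
    rewrite subr_eq0; apply/eqP => e; have := nrm_cexp (- z); rewrite cexpN -e invr1 nrm1 => e2.
    by move: z1; rewrite nrm_cexp -e2 ltxx.
  rewrite cexpN; move: (cexp (ofR lam * z)) (cexp z) w0 w1 => x w w0 w1.
  field; rewrite ?w0 ?w1 ?andbT //=.
  by rewrite -opprB oppr_eq0.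
apply: (has_csum_inj (h := Negz) _ _ _ h); first by move=> x y [].
  move=> n; rewrite /= cexp_expo NegzE -exprnN cexpN exprS exprVn invfM; exact: mulrA.
by move=> [n|n] hn //; case: (hn n).
Qed.

Lemma annulus_left z : - L < complex.Re z < 0 -> has_csum (term_u ^~ z) (- geo_annulus z).
Proof.
move=> /andP[h1 h2]; have hz : `|complex.Re z| < L by rewrite ltr0_norm //; lra.
rewrite /geo_annulus opprD !opprK; apply: has_csum_ext (has_csumD (geo_pos h2) (has_csum_wsum hz)) => k.
rewrite /term_w /term_u /wcoef; case: ifP => _; first by rewrite mulrBr mulr1 addrC subrK.
by rewrite subr0 add0r.
Qed.

(** Crossing [Re z = 0] replaces minus the geometric series over [k >= 0] by plus the one over
    [k < 0], which turns the coefficients [- u k] into [1 - u k]. *)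
Lemma annulus_right z : 0 < complex.Re z < L -> has_csum (term_1u ^~ z) (geo_annulus z).
Proof.
move=> /andP[h1 h2]; have hz : `|complex.Re z| < L by rewrite gtr0_norm.
rewrite /geo_annulus; apply: has_csum_ext (has_csumB (geo_neg h1) (has_csum_wsum hz)) => k.
rewrite /term_w /term_1u /wcoef; case: ifP => _; first by rewrite sub0r -mulrN opprB.
by rewrite subr0 mulrBr mulr1.
Qed.

(** The shift carries the right half of the annulus onto the left one. It multiplies the [k]-th
    exponential by [qpow k], and [theta^-1 * qpow k * u k = u k - 1]. *)
Lemma annulus_quasi z : 0 < complex.Re z < L ->
  geo_annulus (z + twopii R * tau) = theta * geo_annulus z.
Proof.
move=> /[dup] hz /andP[h1 h2].
have h3 : - L < complex.Re (z + twopii R * tau) < 0.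
  by rewrite Re_D Re_twopii_tau; apply/andP; split; lra.
have t0 : theta != 0 by rewrite -nrm_eq0 theta1 oner_eq0.
have := has_csumN (annulus_left h3); rewrite opprK => /has_csum_uniq; apply.
apply: has_csum_ext (has_csumZ theta (annulus_right hz)) => k.
rewrite /term_1u /term_u thq_u mulrDr cexpD.
have -> : cexp (ofR (expo k) * (twopii R * tau)) = qpow k by rewrite /qpow mulrCA mulrA.
move: (cexp _) (qpow k) (u k) => x y w.
rewrite mulrN mulrN mulrCA -[theta^-1 * y * w]mulrA (mulrA theta) mulfV // mul1r mulrA //.
Qed.

(* The integer [j] brings the real part of [z + 2 pi i tau j] into [[-L/2, L/2)]. *)
Definition P1cont (z : C) : C :=
  let j := Num.floor (complex.Re z / L + 2^-1) in
  theta ^ (- j) * geo_annulus (z + twopii R * tau * j%:~R).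

Lemma Re_shift z (j : int) : complex.Re (z + twopii R * tau * j%:~R) = complex.Re z - L * j%:~R.
Proof. by rewrite Re_D -ofR_int [_ * ofR _]mulrC Re_ofRM Re_twopii_tau; ring. Qed.

(** Every admissible shift [j] gives the same value: it differs from the chosen one by at most one
    step, which quasi-periodicity absorbs. *)
Lemma P1cont_local z (j : int) : `|complex.Re z - L * j%:~R| < L ->
  P1cont z = theta ^ (- j) * geo_annulus (z + twopii R * tau * j%:~R).
Proof.
have L0 := width_gt0; have t0 : theta != 0 by rewrite -nrm_eq0 theta1 oner_eq0.
rewrite /P1cont; set i := Num.floor _; rewrite ltr_norml => /andP[h1 h2].
have [/= h3 h4] : (L * i%:~R <= complex.Re z + L / 2) /\ complex.Re z + L / 2 < L * (i%:~R + 1).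
  have /andP[a b] := floor_itv (complex.Re z / L + 2^-1).
  have e : complex.Re z + L / 2 = L * (complex.Re z / L + 2^-1) by field; rewrite gt_eqF.
  by rewrite e ler_pM2l // ltr_pM2l //; split=> //; move: b; rewrite intrD.
have quasi (m : int) : 0 < complex.Re z - L * m%:~R < L ->
   theta ^ (- (m + 1)) * geo_annulus (z + twopii R * tau * (m + 1)%:~R) =
   theta ^ (- m) * geo_annulus (z + twopii R * tau * m%:~R).
  rewrite -Re_shift => hm.
  have e : twopii R * tau * (m + 1)%:~R = twopii R * tau * m%:~R + twopii R * tau.
    by rewrite -[(m + 1)%:~R]/((m + 1)%:~R) intrD mulrDr mulr1.
  rewrite e addrA annulus_quasi // opprD expfzDr //.
  by rewrite mulrA -(mulrA (theta ^ (- m))) exprN1 mulVf // mulr1.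
have ij : (i - 1 <= j <= i + 1)%R.
  have lt (a b : int) : L * a%:~R < L * (b%:~R + 1) -> a <= b.
    by rewrite ltr_pM2l // -[1]/(1%:~R) -intrD ltr_int ltzD1.
  apply/andP; split; [rewrite lerBlDr|]; apply: lt; rewrite ?intrD; lra.
have [->//|[e|e]] : i = j \/ (j = i + 1 \/ i = j + 1) by clear -ij; lia.
  rewrite e quasi // ; move: h1 h2; rewrite e intrD => h1 h2; apply/andP; split; lra.
by rewrite e quasi //; move: h3 h4; rewrite e intrD => h3 h4; apply/andP; split; lra.
Qed.

Lemma P1cont_left z : - L < complex.Re z < 0 -> P1cont z = geo_annulus z.
Proof.
move=> /andP[h1 h2]; rewrite (@P1cont_local z 0) ?mulr0 ?subr0 ?addr0 ?expr0z ?mul1r //.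
by rewrite ltr0_norm //; lra.
Qed.

(** The quotient has the expansion with coefficients [- 1 / (k+1)!]; dividing by it isolates the
    simple pole of [1 / (1 - cexp z)]. *)
Lemma analytic1_expm1_quot a : cexp a = 1 ->
  exists E : C -> C, [/\ analytic1_at E a, E a = -1 & forall h, h != 0 -> E (a + h) = (1 - cexp (a + h)) / h].
Proof.
move=> ea; exists (fun z => if z == a then -1 else (1 - cexp z) / (z - a)); split; last 2 first.
- by rewrite eqxx.
- by move=> h h0; rewrite addrC -subr_eq0 addrK (negbTE h0).
apply: (@analytic1_family _ nat (fun k => - (k.+1`!%:R)^-1) id 1) => [//||h _].
  apply: abs_summable_le (expterm_abs_summable 1) => k; rewrite ofR1 /expterm !expr1n mulr1 mul1r nrmN !nrmV !nrm_nat.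
  by rewrite lef_pV2 ?posrE ?ltr0n ?fact_gt0 // ler_nat factS leq_pmull.
have [->|h0] := eqVneq h 0.
  by rewrite addr0 eqxx; apply: (has_csum1 (i := 0%N)) => [[//|k] _|]; [rewrite expr0n mulr0|rewrite /= invr1 mulr1].
rewrite addrC -subr_eq0 addrK (negbTE h0) cexpD ea mulr1.
have h1 := has_csumB (@has_csum1 _ _ (fun k : nat => if k == 0%N then 1 else 0) 0%N 1 (fun j => ifN_eq _ _ ) erefl) (cexp_series h).
have [s hs] : csummable (fun k => expterm h k.+1).
  apply: abs_summable_csummable; apply: (abs_summable_inj (h := S)) (expterm_abs_summable h); exact: succn_inj.
have e : 1 - cexp h = - s.
  have := has_csum_uniq (has_csum_nat0 hs) (cexp_series h).
  by rewrite /expterm expr0 mul1r invr1 => <-; rewrite opprD addNKr.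
rewrite e mulrC; apply: has_csum_ext (has_csumZ h^-1 (has_csumN hs)) => k.
by rewrite /expterm exprS mulrN mulrA mulKf // mulNr mulrC.
Qed.

Lemma analytic1_geo_annulus a : `|complex.Re a| < L -> cexp a != 1 -> analytic1_at geo_annulus a.
Proof.
move=> ha e1; apply: analytic1_sub (analytic1_wsum ha); apply: analytic1_opp.
apply: analytic1_mul; first exact: analytic1_cexp.
apply: analytic1_inv; last by rewrite subr_eq0 eq_sym.
apply: analytic1_sub; first exact: analytic1_const.
exact: analytic1_ext (fun z => congr1 (@cexp R) (mul1r z)) (analytic1_cexp 1 a).
Qed.

Lemma mero_geo_annulus a : `|complex.Re a| < L -> mero_at geo_annulus a.
Proof.
move=> ha; have hw := analytic1_wsum ha.
have [e1|e1] := eqVneq (cexp a) 1; last by left; exact: analytic1_geo_annulus.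
right; have [E [hE Ea hEh]] := analytic1_expm1_quot e1.
(* This is [(z - a) * geo_annulus z] with [1 - cexp z] written as [(z - a) * E z]. *)
exists 1%N, (fun z => - (cexp (ofR lam * z) * (E z)^-1) - (z - a) * wsum z).
have E0 : E a != 0 by rewrite Ea oppr_eq0 oner_eq0.
split=> //.
- apply: analytic1_sub; last first.
    exact: analytic1_mul (analytic1_sub (analytic1_id a) (analytic1_const a a)) hw.
  apply: analytic1_opp; apply: analytic1_mul; first exact: analytic1_cexp.
  exact: analytic1_inv.
- by rewrite subrr mul0r subr0 Ea invrN invr1 mulrN1 opprK cexp_neq0.
- exists 1; split=> // h h0 _; rewrite /geo_annulus expr1 hEh // (addrC a h) addrK mulrBl.
  congr (_ - _); last by rewrite mulrAC mulfV // mul1r.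
  by rewrite mulNr invfM invrK mulrAC mulrA mulrAC mulfK // mulrAC.
Qed.

Lemma meromorphic1_P1cont : meromorphic1 P1cont.
Proof.
have L0 := width_gt0; have t0 : theta != 0 by rewrite -nrm_eq0 theta1 oner_eq0.
apply/meromorphic1P => a; pose j := Num.floor (complex.Re a / L + 2^-1).
pose b := twopii R * tau * j%:~R.
(* The offset is at most half a period, so a single shift [j] serves the whole disc of radius
   [L / 2] around [a]. *)
have hj : `|complex.Re a - L * j%:~R| <= L / 2.
  have /andP[x y] := floor_itv (complex.Re a / L + 2^-1).
  have e : complex.Re a + L / 2 = L * (complex.Re a / L + 2^-1) by field; rewrite gt_eqF.
  move: x y; rewrite intrD -(ler_pM2l L0) -e -(ltr_pM2l L0) -e -/j => x y.
  rewrite ler_norml; apply/andP; split; lra.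
have loc h : nrm h < L / 2 -> P1cont (a + h) = theta ^ (- j) * geo_annulus (a + h + b).
  move=> hh; apply: P1cont_local; rewrite Re_D.
  have := nrm_Re h; move: hj; rewrite ler_norml => /andP[x y]; rewrite ler_norml => /andP[z w].
  rewrite ltr_norml; apply/andP; split; lra.
have L2 : 0 < L / 2 by rewrite divr_gt0.
have : mero_at geo_annulus (a + b).
  by apply: mero_geo_annulus; rewrite Re_shift; apply: le_lt_trans hj _; lra.
case=> [H|[k [g [k0 hg ga [r [r0 H]]]]]].
  left; apply: (analytic1_near L2 (f := fun z => theta ^ (- j) * geo_annulus (z + b))).
    by move=> h hh; rewrite loc.
  by apply: analytic1_mul; [exact: analytic1_const|exact: (analytic1_shift H)].
right; exists k, (fun z => theta ^ (- j) * g (z + b)); split=> //.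
- by apply: analytic1_mul; [exact: analytic1_const|exact: (analytic1_shift hg)].
- by rewrite mulf_neq0 // expfz_neq0.
have [s [s0 sr sL]] := min_radius r0 L2.
exists s; split=> // h h0 hs; rewrite loc ?(lt_le_trans hs) // addrAC H ?(lt_le_trans hs) //.
by rewrite mulrA.
Qed.

End TwistedSeries.

Section P1Facts.
Variable R : realType.
Local Notation C := (Cplx R).
Variables (theta phi tau : C).
Hypothesis theta1 : nrm theta = 1.
Hypothesis tau0 : 0 < complex.Im tau.
Let lam := twist phi.
Hypothesis lam0 : 0 <= lam.
Hypothesis lam1 : lam < 1.
Hypothesis nz : forall k, 1 - theta^-1 * qpow tau lam k != 0.
Local Notation L := (width tau).

Lemma nrm_nome : nrm (nome tau) = expR (- L).
Proof. by rewrite /nome nrm_cexp Re_twopii_tau. Qed.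

Lemma annulusE z : (`|nome tau| < `|cexp z| < 1) = (- L < complex.Re z < 0).
Proof.
rewrite !normE -(ofR1 R) !ltr_ofR nrm_nome nrm_cexp.
by rewrite -(expR0 R) !ltr_expR.
Qed.

Lemma P1_seriesE z : - L < complex.Re z < 0 -> P1_series theta phi tau z = geo_annulus theta tau lam z.
Proof.
move=> hz; rewrite /P1_series.
by rewrite (csumE (annulus_left theta1 tau0 lam0 lam1 nz hz)) opprK.
Qed.

(** [P1] is defined by choice among the continuations; [P1cont] shows that there is one to
    choose. *)
Lemma P1P : mero_continuation1
       [set z | `|nome tau| < `|cexp z| < 1] (P1_series theta phi tau) (P1 theta phi tau).
Proof.
apply: (@xgetPex _ (fun=> 0) [set f | mero_continuation1 [set z | `|nome tau| < `|cexp z| < 1] (P1_series theta phi tau) f]).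
exists (P1cont theta tau lam); split; first exact: meromorphic1_P1cont.
move=> z; rewrite inE /= annulusE => hz.
by rewrite P1cont_left // P1_seriesE.
Qed.

Lemma P1_left z : - L < complex.Re z < 0 -> P1 theta phi tau z = P1_series theta phi tau z.
Proof. by move=> hz; case: P1P => _; apply; rewrite inE /= annulusE. Qed.

Lemma has_csum_P1_left z : - L < complex.Re z < 0 -> has_csum (term_u theta tau lam ^~ z) (- P1 theta phi tau z).
Proof. by move=> hz; rewrite P1_left // P1_seriesE //; exact: annulus_left. Qed.

Lemma Re_ball (z h : C) (d : R) : nrm h < d -> complex.Re z - d < complex.Re (z + h) < complex.Re z + d.
Proof.
move=> hd; have := nrm_Re h; rewrite ler_norml Re_D => /andP[x y].
by apply/andP; split; lra.
Qed.

(** Both functions equal the series on a disc around the centre [- L / 2] of the strip, and the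
    identity theorem carries the agreement to every point. *)
Lemma P1_eq_cont z : 
  exists r : R, 0 < r /\ forall h, h != 0 -> nrm h < r -> P1 theta phi tau (z + h) = P1cont theta tau lam (z + h).
Proof.
have L0 := width_gt0 tau0.
apply: (@mero_identity _ _ _ (ofR (- (L / 2)))); first by case: P1P.
  exact: meromorphic1_P1cont.
have L2 : 0 < L / 2 by rewrite divr_gt0.
exists (L / 2); split=> // h _ hh.
have hz : - L < complex.Re (ofR (- (L / 2)) + h) < 0.
  have /andP[] := Re_ball (ofR (- (L / 2))) hh; rewrite [complex.Re (ofR _)]/=; lra.
by rewrite P1_left // P1cont_left // P1_seriesE.
Qed.

(** Off [Re z = 0] the explicit model is analytic in the annulus, so the chosen continuation cannot
    have a pole there and its value is forced. *)
Lemma P1_analytic z : `|complex.Re z| < L -> complex.Re z != 0 ->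
  analytic1_at (P1 theta phi tau) z /\ P1 theta phi tau z = geo_annulus theta tau lam z.
Proof.
move=> hz z0; have zc : cexp z != 1.
  apply: contra_neq z0 => e; have := nrm_cexp z; rewrite e nrm1 => e1.
  by apply: expR_inj; rewrite expR0.
have hA := analytic1_geo_annulus theta1 tau0 lam0 lam1 nz hz zc.
have hP : punctured_eq (P1 theta phi tau) (geo_annulus theta tau lam) z.
  have [r [r0 H]] := P1_eq_cont z.
  have l0 : 0 < L - `|complex.Re z| by rewrite subr_gt0.
  have [s [s0 sr sl]] := min_radius r0 l0.
  exists s; split=> // h h0 hs; rewrite H ?(lt_le_trans hs) //.
  rewrite (@P1cont_local _ _ _ _ theta1 tau0 lam0 lam1 nz _ 0) ?mulr0 ?subr0 ?addr0 ?expr0z ?mul1r //.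
  rewrite Re_D; apply: le_lt_trans (ler_normD _ _) _.
  have := nrm_Re h; have := lt_le_trans hs sl; lra.
have hM : mero_at (P1 theta phi tau) z by case: P1P => /meromorphic1P.
case: hM => [hM|hM]; last by case: (pole_not_analytic hM hA hP).
by split=> //; exact: analytic1_punctured hM hA hP.
Qed.

Lemma has_csum_P1_right z : 0 < complex.Re z < L ->
  has_csum (term_1u theta tau lam ^~ z) (P1 theta phi tau z).
Proof.
move=> /[dup] hz /andP[h1 h2]; have [||_ ->] := @P1_analytic z; last exact: annulus_right.
  by rewrite gtr0_norm.
by rewrite gt_eqF.
Qed.

End P1Facts.

(** * Fermion modes on the Fock basis *)

Section BasisCoordinates.
Variables (K : numFieldType) (V : lmodType K) (I : choiceType) (e : I -> V).
Hypothesis he : is_basis e.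
Local Notation coord := (coord_in e).

Lemma is_coordP (v : V) (c : I -> K) : is_coord e v c <->
  exists A : {fset I}, (forall i, i \notin A -> c i = 0) /\ v = \sum_(i <- A) c i *: e i.
Proof.
split=> [[fc ->]|[A [cA ->]]].
  exists (fset_set [set i | c i != 0]); have h i : i \notin fset_set [set i | c i != 0] -> c i = 0.
    by rewrite in_fset_set // notin_setE /= => /negP; rewrite negbK => /eqP.
  by split=> //; apply: fsbigTE => i /h ->; rewrite scale0r.
split; last by apply/esym/fsbigTE => i /cA ->; rewrite scale0r.
apply: sub_finite_set (finite_fset A) => i /= ci.
by apply: contraNT ci => /cA ->; rewrite eqxx.
Qed.

Lemma coordP v : is_coord e v (coord v).
Proof. by have [c [hc _]] := he v; apply: (@xgetPex _ (fun=> 0) (is_coord e v)); exists c. Qed.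

Lemma coord_uniq v c : is_coord e v c -> coord v = c.
Proof. by move=> hc; have [d [_ hd]] := he v; rewrite -(hd _ hc) (hd _ (coordP v)). Qed.

Lemma is_coord_linear (a : K) u v c d : is_coord e u c -> is_coord e v d ->
  is_coord e (a *: u + v) (fun i => a * c i + d i).
Proof.
move=> /is_coordP[A [cA ->]] /is_coordP[B [dB ->]]; apply/is_coordP.
exists (A `|` B)%fset; split=> [i|].
  by rewrite inE negb_or => /andP[/cA -> /dB ->]; rewrite mulr0 addr0.
have ext (D D' : {fset I}) (g : I -> K) : fsubset D D' -> (forall i, i \notin D -> g i = 0) ->
    \sum_(i <- D) g i *: e i = \sum_(i <- D') g i *: e i.
  move=> sub g0; rewrite -(fsbigTE D) => [|i /g0 ->]; last by rewrite scale0r.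
  rewrite (fsbigTE D') // => i iD'; rewrite g0 ?scale0r //.
  by apply: contra iD'; exact: (fsubsetP sub).
rewrite (ext _ _ _ (fsubsetUl A B) cA) (ext _ _ _ (fsubsetUr A B) dB).
rewrite scaler_sumr -big_split; apply: eq_bigr => i _.
by rewrite scalerA scalerDl.
Qed.

Lemma coord_linear (a : K) u v i : coord (a *: u + v) i = a * coord u i + coord v i.
Proof. by rewrite (coord_uniq (is_coord_linear a (coordP u) (coordP v))). Qed.

Lemma is_coord0 : is_coord e 0 (fun=> 0).
Proof. by apply/is_coordP; exists fset0; rewrite big_seq_fset0. Qed.

Lemma coord0 i : coord 0 i = 0.
Proof. by rewrite (coord_uniq is_coord0). Qed.

Lemma coordZ a u i : coord (a *: u) i = a * coord u i.
Proof. by rewrite -[a *: u]addr0 coord_linear coord0 addr0. Qed.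

Lemma coord_basis i j : coord (e i) j = (j == i)%:R.
Proof.
have -> : coord (e i) = fun j => (j == i)%:R.
  apply: coord_uniq; apply/is_coordP; exists [fset i]%fset; split.
    by move=> k; rewrite inE => /negbTE ->.
  by rewrite big_seq_fset1 eqxx scale1r.
by [].
Qed.

Lemma basis_neq0 i : e i != 0.
Proof.
apply/eqP => ei; have := coord_basis i i; rewrite ei coord0 eqxx => /esym/eqP.
by rewrite oner_eq0.
Qed.

Section Diagonal.
Variables (A : V -> V) (mu : I -> K).
Hypothesis A_linear : forall (a : K) u v, A (a *: u + v) = a *: A u + A v.
Hypothesis A_diag : forall i, A (e i) = mu i *: e i.

Lemma linear_map0 : A 0 = 0.
Proof. by have := A_linear (-1) 0 0; rewrite scaler0 addr0 scaleN1r addNr. Qed.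

Lemma coord_diag v i : coord (A v) i = mu i * coord v i.
Proof.
have /is_coordP[B [cB hv]] := coordP v.
suff h : A v = \sum_(i <- B) (mu i * coord v i) *: e i.
  rewrite (coord_uniq (c := fun i => mu i * coord v i)) //; apply/is_coordP; exists B; split=> // j jB.
  by rewrite cB // mulr0.
rewrite {1}hv; elim: (enum_fset B) => [|j s IH]; first by rewrite !big_nil linear_map0.
by rewrite !big_cons A_linear IH A_diag scalerA mulrC.
Qed.

(** All nonzero coordinates of a vector of eigenvalue [nu] have [mu i = nu], so scaling the [i]-th
    coordinate by [g (mu i)] acts on it as [g nu]. This supplies the operators selected by
    [expop]. *)
Lemma diag_map_ex (g : K -> K) : exists E : V -> V,
    (forall (a : K) u v, E (a *: u + v) = a *: E u + E v) /\
    (forall (nu : K) v, A v = nu *: v -> E v = g nu *: v).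
Proof.
pose c v i := g (mu i) * coord v i.
have ex v : exists w, is_coord e w (c v).
  have /is_coordP[B [cB hv]] := coordP v.
  exists (\sum_(i <- B) c v i *: e i); apply/is_coordP; exists B; split=> // i iB.
  by rewrite /c cB // mulr0.
have [E hE] := choice ex.
have inj u v : coord u = coord v -> u = v.
  move=> uv; have /is_coordP[B [cB hu]] := coordP u; rewrite hu.
  have [d [hd _]] := he v; have [fc hv] := coordP v; rewrite [RHS]hv -uv.
  by apply/esym/fsbigTE => i /cB ->; rewrite scale0r.
exists E; split=> [a u v|nu v hv]; apply: inj; apply/funext => i.
  rewrite coord_linear !(coord_uniq (hE _)) /c coord_linear; ring.
rewrite coordZ (coord_uniq (hE _)) /c.
have := congr1 (fun w => coord w i) hv; rewrite coord_diag coordZ => h.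
have [->|ci] := eqVneq (coord v i) 0; first by rewrite !mulr0.
by rewrite (mulIf ci h).
Qed.

End Diagonal.
End BasisCoordinates.

(** * Commutators and iterates from the Jacobi identity *)

Section VosaAlgebra.
Variables (K : numFieldType) (V : vosa K).
Implicit Types (u v w : V).
Local Notation vac := (vacuum V).

Lemma mode0r u n : mode u n 0 = 0 :> V.
Proof. by have := vosa_mode_linearr u n (-1) 0 0; rewrite scaler0 addr0 scaleN1r addNr. Qed.
Lemma modeDr u n v w : mode u n (v + w) = mode u n v + mode u n w.
Proof. by have := vosa_mode_linearr u n 1 v w; rewrite !scale1r. Qed.
Lemma modeZr u n (a : K) v : mode u n (a *: v) = a *: mode u n v.
Proof. by have := vosa_mode_linearr u n a v 0; rewrite mode0r !addr0. Qed.
Lemma modeNr u n v : mode u n (- v) = - mode u n v.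
Proof. by rewrite -[- v]scaleN1r modeZr scaleN1r. Qed.
Lemma mode0l n w : mode (0 : V) n w = 0.
Proof. by have := vosa_mode_linearl (-1) (0 : V) 0 n w; rewrite scaler0 addr0 scaleN1r addNr. Qed.
Lemma modeDl u v n w : mode (u + v) n w = mode u n w + mode v n w.
Proof. by have := vosa_mode_linearl 1 u v n w; rewrite !scale1r. Qed.
Lemma modeZl (a : K) u n w : mode (a *: u) n w = a *: mode u n w.
Proof. by have := vosa_mode_linearl a u 0 n w; rewrite mode0l !addr0. Qed.
Lemma gbinom0r (m : int) : gbinom K m 0 = 1.
Proof. by rewrite /gbinom big_ord0 mul1r invr1. Qed.
Lemma gbinom0l j : gbinom K 0 j = (j == 0%N)%:R.
Proof. by case: j => [|j]; rewrite ?gbinom0r // /gbinom big_ord_recl subrr mul0r mul0r. Qed.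
Lemma gbinom1l j : gbinom K 1 j = (j < 2)%N%:R.
Proof.
case: j => [|[|j]]; first by rewrite gbinom0r.
  by rewrite /gbinom big_ord_recl big_ord0 subr0 !mulr1 divr1.
by rewrite /gbinom !big_ord_recl /= subrr !(mul0r, mulr0).
Qed.

(** The Jacobi identity at [l = m = 0], used for [a(0)]; its neighbour with [m = 1] serves [L(0)],
    which is mode 1 of [omega]. *)
Lemma mode_comm0 p u v (n : int) w : sector false u -> sector p v ->
  mode u 0 (mode v n w) = mode v n (mode u 0 w) + mode (mode u 0 v) n w.
Proof.
move=> hu hv; have [N /(_ N.+1 (leqnSn N))] := vosa_jacobi hu hv 0 0 n w.
rewrite !big_ord_recl /= big1 ?addr0 => [|j _]; last by rewrite gbinom0l scale0r.
rewrite big1 ?addr0 => [|j _]; last by rewrite gbinom0l mulr0 scale0r.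
rewrite !gbinom0r !expr0 expr0z !mulr1 !scale1r add0r => ->.
by rewrite addrC subrK.
Qed.

Lemma mode_comm1 p u v (n : int) w : sector false u -> sector p v ->
  mode u 1 (mode v n w) = mode v n (mode u 1 w) + mode (mode u 0 v) (n + 1) w + mode (mode u 1 v) n w.
Proof.
move=> hu hv; have [N /(_ N.+2 (leqW (leqnSn N)))] := vosa_jacobi hu hv 0 1 n w.
rewrite [X in X = _]big_ord_recl [X in _ + X = _]big_ord_recl /= big1 ?addr0 => [|j _]; last by rewrite gbinom1l scale0r.
rewrite big_ord_recl big1 ?addr0 => [|j _]; last by rewrite gbinom0l mulr0 scale0r.
rewrite !gbinom1l !gbinom0r expr0 expr0z !mulr1 !scale1r.
have -> : 0 + Posz (bump 0 0) = 1 by [].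
have -> : 1 + n - Posz (bump 0 0) = n by rewrite /bump /=; lia.
rewrite [1 + n]addrC -addrA => ->.
by rewrite addrC subrK.
Qed.

(** The Jacobi identity at [m = 0]. The hypotheses leave only the term [j = 0], which suffices to
    evaluate quadratic expressions on the generators. *)
Lemma mode_assoc_odd u v (l n : int) w : sector true u -> sector true v ->
  (forall j : nat, (0 < j)%N -> mode u j w = 0) ->
  (forall j : nat, (0 < j)%N -> mode v (n + j%:Z) w = 0) ->
  mode (mode u l v) n w = mode u l (mode v n w) + (-1) ^ l *: mode v (n + l) (mode u 0 w).
Proof.
move=> hu hv u0 v0; have [N /(_ N.+1 (leqnSn N))] := vosa_jacobi hu hv l 0 n w.
rewrite !big_ord_recl /= big1 ?addr0 => [|j _]; last by rewrite gbinom0l scale0r.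
rewrite big1 ?addr0 => [|j _]; last first.
  by rewrite add0r u0 // v0 // !mode0r scaler0 subrr scaler0.
rewrite !gbinom0r expr0 mulr1 !scale1r expr1 !add0r => ->.
by rewrite mulrN1 scaleNr opprK.
Qed.

End VosaAlgebra.

Section Fermions.
Variables (K : numFieldType) (V : vosa K) (psip psim : V).
Hypothesis HV : rank_two_fermion psip psim.
Implicit Types (u v w : V) (m n : int) (e : bool).
Local Notation vac := (vacuum V).
Local Notation heis := (heis psip psim).
Local Notation Lh0 := (Lh0 psip psim).
Local Notation fock := (fock psip psim).

Definition psi e : V := if e then psip else psim.
Definition charge_sign e : K := if e then 1 else -1.

Lemma psi_odd e : sector true (psi e).
Proof. by case: e; [exact: fermion_psip_odd HV|exact: fermion_psim_odd HV]. Qed.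

Lemma psi_anti e e' m n v : mode (psi e) m (mode (psi e') n v) =
  - mode (psi e') n (mode (psi e) m v) + (if (e != e') && (m == - n - 1) then v else 0).
Proof.
case: e e' => [] [] /=.
- by apply/eqP; rewrite addr0 -addr_eq0 (fermion_pp HV).
- by rewrite -(fermion_pm HV) addrC addrK.
- have -> : (m == - n - 1) = (n == - m - 1) by apply/eqP/eqP => ->; lia.
  by rewrite -(fermion_pm HV) addKr.
- by apply/eqP; rewrite addr0 -addr_eq0 (fermion_mm HV).
Qed.

(** Writing the vector as its mode -1 applied to the vacuum reduces the claim to an
    anticommutator. *)
Lemma psi_on_psi e e' (j : nat) :
  mode (psi e) j (psi e') = if (e != e') && (j == 0%N) then vac else 0.
Proof.
rewrite -{1}(vosa_creation (psi e')) psi_anti vosa_creation0 // mode0r oppr0 add0r opprK.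
by rewrite (_ : (Posz j == 1 - 1) = (j == 0%N)).
Qed.

Lemma heisE : heis = mode psip (-1) psim.
Proof. by rewrite /Defs.heis vosa_creation. Qed.

Lemma heis_even : sector false heis.
Proof. by rewrite heisE; exact: vosa_mode_parity (psi_odd true) (psi_odd false). Qed.

Lemma heis_psi e : mode heis 0 (psi e) = charge_sign e *: psi e.
Proof.
rewrite heisE (mode_assoc_odd (-1) (n := 0) (w := psi e) (psi_odd true) (psi_odd false)) => [|j j0|j j0]; last 2 first.
- by rewrite (psi_on_psi true) gtn_eqF // andbF.
- by rewrite add0r (psi_on_psi false) gtn_eqF // andbF.
rewrite (psi_on_psi true e 0) (psi_on_psi false e 0) add0r exprN1 invrN1 scaleN1r.
by case: e => /=; rewrite mode0r ?oppr0 ?addr0 ?add0r vosa_creation ?scale1r ?scaleN1r.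
Qed.

(** Each half of [omega] sees only one of the two fermions; this is the origin of their weight
    1/2. *)
Lemma quad_psi e e' : mode (mode (psi (~~ e)) (-2) (psi e)) 1 (psi e') = if e == e' then psi e' else 0.
Proof.
rewrite (mode_assoc_odd (-2) (n := 1) (w := psi e') (psi_odd (~~ e)) (psi_odd e)) => [|j j0|j j0]; last 2 first.
- by rewrite psi_on_psi gtn_eqF // andbF.
- by rewrite -PoszD psi_on_psi gtn_eqF ?addn_gt0 // andbF.
rewrite (psi_on_psi _ _ 1) (psi_on_psi _ _ 0) andbF mode0r add0r.
have -> : (-1 : K) ^ (-2) = 1 by rewrite -[LHS]/(((-1) ^+ 2)^-1) sqrrN expr1n invr1.
rewrite scale1r; by case: e e' => [] [] /=; rewrite ?mode0r // vosa_creation.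
Qed.

Lemma omegaE : omega V = 2^-1 *: (mode psip (-2) psim + mode psim (-2) psip).
Proof. by rewrite (fermion_omega HV) !vosa_creation. Qed.

Lemma omega_psi e : mode (omega V) 1 (psi e) = 2^-1 *: psi e.
Proof.
rewrite omegaE modeZl modeDl (quad_psi false e) (quad_psi true e).
by case: e => /=; rewrite ?addr0 ?add0r.
Qed.

Lemma heis_comm e n w :
  mode heis 0 (mode (psi e) n w) = mode (psi e) n (mode heis 0 w) + charge_sign e *: mode (psi e) n w.
Proof. by rewrite (mode_comm0 n w heis_even (psi_odd e)) heis_psi modeZl. Qed.

(** The commutator is (L(-1) psi)(n + 1) = - (n + 1) psi(n) plus the weight term psi(n) / 2. *)
Lemma omega_comm e n w : mode (omega V) 1 (mode (psi e) n w) =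
  mode (psi e) n (mode (omega V) 1 w) + (- n%:~R - 2^-1) *: mode (psi e) n w.
Proof.
rewrite (mode_comm1 n w (vosa_omega_even V) (psi_odd e)) vosa_translation omega_psi modeZl addrK.
rewrite -addrA -scalerDl; congr (_ + _ *: _); rewrite intrD; by field.
Qed.

(** h(-2) 1 = L(-1) h, and mode 1 of L(-1) h is - h(0). *)
Lemma Lh0E kappa w : Lh0 kappa w = mode (omega V) 1 w - kappa *: mode heis 0 w.
Proof.
rewrite /Defs.Lh0 /omega_shift modeDl modeZl modeZl; congr (_ + _).
have -> : mode heis (-2) vac = mode (omega V) 0 heis.
  by rewrite -[RHS]vosa_creation vosa_translation mulrN1z opprK scale1r.
by rewrite vosa_translation subrr mulr1z scaleN1r scalerN.
Qed.

Lemma Lh0_comm kappa e n w : Lh0 kappa (mode (psi e) n w) =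
  mode (psi e) n (Lh0 kappa w) + (- n%:~R - 2^-1 - charge_sign e * kappa) *: mode (psi e) n w.
Proof.
rewrite !Lh0E omega_comm heis_comm modeDr modeNr modeZr scalerDr scalerA.
by rewrite [X in _ = _ + X]scalerBl opprD addrACA [kappa * _]mulrC.
Qed.

Lemma heis_vac : mode heis 0 vac = 0. Proof. exact: vosa_creation0. Qed.
Lemma Lh0_vac kappa : Lh0 kappa vac = 0. Proof. exact: vosa_creation0. Qed.

Lemma Lh0_linear kappa (a : K) u v : Lh0 kappa (a *: u + v) = a *: Lh0 kappa u + Lh0 kappa v.
Proof. exact: vosa_mode_linearr. Qed.

Definition additive_wt (wt : bool -> nat -> K) (b : fock_index) : K :=
  \sum_(k <- val b.1) wt true k + \sum_(l <- val b.2) wt false l.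

Lemma fock_diag (D : V -> V) (wt : bool -> nat -> K) : D vac = 0 ->
  (forall e k w, D (mode (psi e) (- k%:Z) w) = mode (psi e) (- k%:Z) (D w) + wt e k *: mode (psi e) (- k%:Z) w) ->
  forall b, D (fock b) = additive_wt wt b *: fock b.
Proof.
move=> D0 Dc [[s hs] [t ht]]; rewrite /Defs.fock /additive_wt /= {hs ht}.
elim: s => [|k s IH] /=.
  rewrite big_nil add0r; elim: t => [|l t IH] /=; first by rewrite big_nil D0 scale0r.
  by rewrite (Dc false) IH big_cons modeZr -scalerDl addrC.
rewrite (Dc true) IH big_cons modeZr -scalerDl; congr (_ *: _).
by rewrite [LHS]addrC addrA.
Qed.

Definition fock_charge : fock_index -> K := additive_wt (fun e _ => charge_sign e).
Definition fock_weight kappa : fock_index -> K := additive_wt (fun e k => k%:R - 2^-1 - charge_sign e * kappa).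

Lemma heis_fock b : mode heis 0 (fock b) = fock_charge b *: fock b.
Proof. by apply: fock_diag b => [|e k w]; [exact: heis_vac|exact: heis_comm]. Qed.

Lemma Lh0_fock kappa b : Lh0 kappa (fock b) = fock_weight kappa b *: fock b.
Proof.
apply: fock_diag b => [|e k w]; first exact: Lh0_vac.
by rewrite Lh0_comm mulrNz opprK.
Qed.

Lemma fock_sector b : sector (odd (size (val b.1) + size (val b.2))) (fock b).
Proof.
case: b => [[s hs] [t ht]]; rewrite /Defs.fock /= {hs ht}.
elim: s => [|k s IH] /=; last exact: vosa_mode_parity (psi_odd true) IH.
elim: t => [|l t IH] /=; first exact: vosa_vacuum_even.
exact: vosa_mode_parity (psi_odd false) IH.
Qed.

(** A basis vector is nonzero and the two sectors meet only in 0, so the parity is determined. *)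
Lemma fock_sectorP p b : sector p (fock b) <-> p = odd (size (val b.1) + size (val b.2)).
Proof.
split=> [hp|->]; last exact: fock_sector.
have h := fock_sector b; apply/eqP; apply: contraT => ne.
have nz := basis_neq0 (fermion_fock HV) b.
by case: p (odd _) ne hp h => [] [] // _ h1 h2; case/eqP: nz; exact: vosa_sector_direct.
Qed.

(** The levels may come in any order, so that they can be permuted and removed up to sign before
    sorting. *)
Definition chain e (s : seq nat) w : V := foldr (fun k => mode (psi e) (- k%:Z)) w s.

Lemma fockE b : fock b = chain true (val b.1) (chain false (val b.2) vac).
Proof. by []. Qed.

Lemma psi_sq e m w : mode (psi e) m (mode (psi e) m w) = 0.
Proof.
have := psi_anti e e m m w; rewrite eqxx addr0 => /eqP.
by rewrite -addr_eq0 -mulr2n -scaler_nat scaler_eq0 pnatr_eq0 /= => /eqP.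
Qed.

Lemma chainZ e s (a : K) w : chain e s (a *: w) = a *: chain e s w.
Proof. by elim: s => //= k s ->; rewrite modeZr. Qed.

Lemma chain0 e s : chain e s 0 = 0.
Proof. by elim: s => //= k s ->; rewrite mode0r. Qed.

(** The hypothesis excludes all contractions with the chain, so only the anticommutation sign
    remains. *)
Lemma chain_move e e' m s w : (forall k, k \in s -> (e != e') && (m == k%:Z - 1) = false) ->
  mode (psi e) m (chain e' s w) = (-1) ^+ size s *: chain e' s (mode (psi e) m w).
Proof.
elim: s => [|k s IH] H /=; first by rewrite scale1r.
rewrite psi_anti opprK H ?inE ?eqxx // addr0 IH => [|l ls]; last by rewrite H // inE ls orbT.
by rewrite modeZr exprS mulN1r scaleNr.
Qed.

Lemma chain_perm e s t w : perm_eq s t -> exists b : bool, chain e s w = (-1) ^+ b *: chain e t w.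
Proof.
elim: s t => [|k s IH] t.
  by rewrite perm_sym => /perm_nilP ->; exists false; rewrite scale1r.
move=> h; have kt : k \in t by rewrite -(perm_mem h) inE eqxx.
case/splitPr: kt h => t1 t2; rewrite perm_sym perm_catC /= perm_cons perm_catC perm_sym => /IH[b hb].
exists (b (+) odd (size t1)); rewrite /= hb modeZr signr_addb -scalerA; congr (_ *: _).
rewrite /chain !foldr_cat /= -/(chain _ _ _).
rewrite -/(chain e t2 w) -/(chain e t1 (chain e t2 w)) -/(chain e t1 (mode (psi e) (- k%:Z) (chain e t2 w))).
rewrite chain_move ?signr_odd // => l _; by rewrite eqxx.
Qed.

Lemma chain_create e s (k : nat) w t : perm_eq t (k :: s) -> exists b : bool,
  mode (psi e) (- k%:Z) (chain e s w) = (-1) ^+ b *: chain e t w.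
Proof. by rewrite perm_sym => /(chain_perm e w)[b hb]; exists b. Qed.

Lemma chain_create0 e s (k : nat) w : k \in s -> mode (psi e) (- k%:Z) (chain e s w) = 0.
Proof.
move=> ks; have [b ->] := chain_perm e w (perm_to_rem ks).
by rewrite modeZr /= psi_sq scaler0.
Qed.

Lemma chain_kill e s (k : nat) w : mode (psi (~~ e)) k w = 0 -> k.+1 \notin s ->
  mode (psi (~~ e)) k (chain e s w) = 0.
Proof.
move=> kw ks; rewrite chain_move ?kw ?chain0 ?scaler0 // => l ls.
apply/negbTE; rewrite negb_and orbC; apply/orP; left; apply/eqP => e1.
by move: ks; rewrite (_ : k.+1 = l) ?ls //; lia.
Qed.

Lemma chain_annihilate e s (k : nat) w t : uniq s -> perm_eq (k.+1 :: t) s -> mode (psi (~~ e)) k w = 0 ->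
  exists b : bool, mode (psi (~~ e)) k (chain e s w) = (-1) ^+ b *: chain e t w.
Proof.
move=> us h kw; have kt : k.+1 \notin t by move: us; rewrite -(perm_uniq h) /= => /andP[].
have [b ->] : exists b : bool, chain e s w = (-1) ^+ b *: chain e (k.+1 :: t) w.
  by apply: chain_perm; rewrite perm_sym.
exists b; rewrite modeZr /= psi_anti chain_kill // mode0r oppr0 add0r.
rewrite (_ : (_ && _) = true) //; case: (e) => /=; apply/eqP; lia.
Qed.

End Fermions.

(** * Occupied levels and the action of a single mode *)

Section Toggle.

(** Sorting returns to the indexing of the basis; the sign this costs is left to the coefficient of
    the vector. *)
Definition toggle (k : nat) (s : seq nat) : seq nat := sort leq (if k \in s then rem k s else k :: s).

Lemma fock_seqP (s : seq nat) : path ltn 0%N s = [&& sorted ltn s & all (ltn 0%N) s].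
Proof. by rewrite (path_sortedE ltn_trans) andbC. Qed.

Lemma fock_seq_uniq (s : fock_seq) : uniq (val s).
Proof. by case: s => s /=; rewrite fock_seqP => /andP[/(sorted_uniq ltn_trans ltnn)]. Qed.

Lemma fock_seq_pos (s : fock_seq) k : k \in val s -> (0 < k)%N.
Proof. by case: s => s /=; rewrite fock_seqP => /andP[_ /allP]; apply. Qed.

Lemma toggle_path k (s : fock_seq) : path ltn 0%N (toggle k.+1 (val s)).
Proof.
have us := fock_seq_uniq s.
rewrite fock_seqP ltn_sorted_uniq_leq sort_sorted ?andbT /=; last exact: leq_total.
rewrite sort_uniq; apply/andP; split.
  by case: ifP => ks; [exact: rem_uniq|rewrite /= ks].
apply/allP => x; rewrite mem_sort; case: ifP => ks; first by move/mem_rem/fock_seq_pos.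
by rewrite inE => /orP[/eqP ->//|/fock_seq_pos].
Qed.

Definition toggle_seq k (s : fock_seq) : fock_seq := Sub (toggle k.+1 (val s)) (toggle_path k s).

Lemma mem_toggle k (s : fock_seq) x : (x \in val (toggle_seq k s)) = (x == k.+1) (+) (x \in val s).
Proof.
rewrite /= mem_sort; case: ifP => ks.
  by rewrite rem_filter ?fock_seq_uniq // mem_filter /=; case: eqP => [->|]; rewrite ?ks.
by rewrite inE; case: eqP => [->|]; rewrite ?ks.
Qed.

Lemma fock_seq_eq (s t : fock_seq) : val s =i val t -> s = t.
Proof.
move=> st; apply: val_inj; case: s t st => [s hs] [t ht] /=.
move: hs ht; rewrite !fock_seqP => /andP[h1 _] /andP[h2 _]; exact: (irr_sorted_eq ltn_trans ltnn).
Qed.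

Lemma toggle_seqK k : involutive (toggle_seq k).
Proof. by move=> s; apply: fock_seq_eq => x; rewrite !mem_toggle addbA addbb. Qed.

Lemma size_toggle k (s : fock_seq) : odd (size (val (toggle_seq k s))) = ~~ odd (size (val s)).
Proof.
rewrite /= size_sort; case: ifP => ks //=.
rewrite size_rem //; by case: (val s) ks => [//|x t] _ /=; rewrite negbK.
Qed.

Definition toggle_fock (e : bool) (k : nat) (b : fock_index) : fock_index :=
  if e then (toggle_seq k b.1, b.2) else (b.1, toggle_seq k b.2).

Lemma toggle_fockK e k : involutive (toggle_fock e k).
Proof. by case: e => -[s t]; rewrite /toggle_fock /= toggle_seqK. Qed.

Definition fock_odd (b : fock_index) : bool := odd (size (val b.1) + size (val b.2)).

Lemma toggle_fock_odd e k b : fock_odd (toggle_fock e k b) = ~~ fock_odd b.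
Proof. by case: e; case: b => s t; rewrite /fock_odd !oddD [in LHS]size_toggle ?addNb ?addbN. Qed.

End Toggle.

Arguments psi : simpl never.

Section Action.
Variables (K : numFieldType) (V : vosa K) (psip psim : V).
Hypothesis HV : rank_two_fermion psip psim.
Local Notation fock := (fock psip psim).
Local Notation psi := (psi psip psim).

(** psi^+(k) and psi^-(-k-1) are dual, and likewise with signs exchanged. So [Posz k] removes level
    [k.+1] of the opposite charge, and [Negz k], the mode [- k.+1], creates level [k.+1] of the same
    charge. *)
Definition psi_toggle (e : bool) (m : int) : fock_index -> fock_index :=
  match m with Posz k => toggle_fock (~~ e) k | Negz k => toggle_fock e k end.

Lemma psi_toggleK e m : involutive (psi_toggle e m).
Proof. by case: m => k; exact: toggle_fockK. Qed.

Lemma psi_toggle_odd e m b : fock_odd (psi_toggle e m b) = ~~ fock_odd b.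
Proof. by case: m => k; exact: toggle_fock_odd. Qed.

Lemma chain_toggle_create e (k : nat) (s : fock_seq) w : exists a : K, `|a| <= 1 /\
  mode (psi e) (Negz k) (chain psip psim e (val s) w) = a *: chain psip psim e (val (toggle_seq k s)) w.
Proof.
rewrite NegzE; case: (boolP (k.+1 \in val s)) => ks.
  by exists 0; rewrite normr0 ler01 scale0r (chain_create0 HV).
have [|b hb] := chain_create HV e w (s := val s) (k := k.+1) (t := val (toggle_seq k s)).
  by rewrite /= /toggle; case: ifP => h; [case/negP: ks|rewrite perm_sort].
by exists ((-1) ^+ b); rewrite normr_sign.
Qed.

Lemma chain_toggle_annihilate e (k : nat) (s : fock_seq) w : mode (psi (~~ e)) k w = 0 ->
  exists a : K, `|a| <= 1 /\
  mode (psi (~~ e)) k (chain psip psim e (val s) w) = a *: chain psip psim e (val (toggle_seq k s)) w.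
Proof.
move=> kw; case: (boolP (k.+1 \in val s)) => ks; last first.
  by exists 0; rewrite normr0 ler01 scale0r (chain_kill HV).
have [|b hb] := chain_annihilate HV (t := val (toggle_seq k s)) (fock_seq_uniq s) _ kw.
  rewrite /= /toggle; case: ifP => [h|/negP//].
  by rewrite perm_sym (perm_trans (perm_to_rem h)) // perm_cons perm_sym perm_sort.
by exists ((-1) ^+ b); rewrite normr_sign.
Qed.

(** A mode that kills the vector gets coefficient 0; in this way a total involution of the basis
    describes the action. *)
Lemma psi_fock e m b : exists a : K, `|a| <= 1 /\ mode (psi e) m (fock b) = a *: fock (psi_toggle e m b).
Proof.
have vac0 e' (k : nat) : mode (psi e') k (vacuum V) = 0 by exact: vosa_creation0.
have thru (f : bool) (g : V) (a : K) : `|a| <= 1 -> `|(-1) ^+ size (val b.1) * a| <= 1.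
  by move=> ha; rewrite normrM normrX normrN1 expr1n mul1r.
case: b thru => s t thru; rewrite !fockE; case: m e => k [] /=.
- have [a [ha h]] := chain_toggle_annihilate (e := false) t (vac0 true k).
  exists ((-1) ^+ size (val s) * a); split; first exact: (thru true 0).
  by rewrite (chain_move HV) // h chainZ scalerA.
- apply: (@chain_toggle_annihilate true k s).
  by rewrite (chain_move HV) //= vac0 chain0 scaler0.
- exact: (chain_toggle_create true).
- have [a [ha h]] := chain_toggle_create false k t (vacuum V).
  exists ((-1) ^+ size (val s) * a); split; first exact: (thru true 0).
  rewrite (chain_move HV) ?h ?chainZ ?scalerA // => l ls.
  apply/negbTE; rewrite negb_and; apply/orP; right; apply/eqP.
  by have := fock_seq_pos ls; lia.
Qed.

End Action.

(** * Wick's theorem *)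

Section WickDeterminant.
Variables (K : comNzRingType) (X : eqType) (x0 : X) (plus : X -> bool).
Variables (contr m : X -> X -> K) (T : seq X -> K).

Definition remove_at (j : nat) (w : seq X) : seq X := take j w ++ drop j.+1 w.

Hypothesis contr_same : forall a b, plus a = plus b -> contr a b = 0.
Hypothesis T_rec : forall a w, odd (size w) ->
  T (a :: w) = \sum_(j < size w) (-1) ^+ j * contr a (nth x0 w j) * T (remove_at j w).

(* The entry attached to a plus and a minus letter depends on which comes first. *)
Definition time_ordered (w : seq X) : bool :=
  pairwise (fun a b => (plus a != plus b) ==> (contr a b == if plus a then m a b else - m b a)) w.

(* Parity of the number of minus letters preceding a plus letter, plus n(n-1)/2;
   both contributions obey this single recursion. *)
Fixpoint wick_sign (w : seq X) : bool :=
  if w is a :: w' then wick_sign w' (+) odd (count plus w') else false.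

Definition wick_det (n : nat) (xs ys : seq X) : K :=
  \det (\matrix_(i < n, j < n) m (nth x0 xs i) (nth x0 ys j)).

Lemma nth_bump (s t : seq X) b j : nth x0 (s ++ b :: t) (bump (size s) j) = nth x0 (s ++ t) j.
Proof.
rewrite !nth_cat /bump; have [h|h] := leqP (size s) j; last by rewrite add0n h.
by rewrite add1n ltnNge (leq_trans h (leqnSn _)) /= subSn.
Qed.

Lemma nth_remove_at k (s : seq X) j : nth x0 (remove_at k s) j = nth x0 s (bump k j).
Proof.
rewrite /remove_at; have [h|h] := leqP (size s) k.
  rewrite take_oversize // drop_oversize ?cats0; last exact: leqW.
  rewrite /bump; case: leqP => hj /=; rewrite ?add0n // add1n.
  by have h2 := leq_trans h hj; rewrite (nth_default x0 h2) (nth_default x0 (leqW h2)).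
have := nth_bump (take k s) (drop k.+1 s) (nth x0 s k) j.
by rewrite -drop_nth // cat_take_drop size_takel // ltnW.
Qed.

Lemma wick_det_row n a xs ys : wick_det n.+1 (a :: xs) ys =
  \sum_(k < n.+1) (-1) ^+ k * m a (nth x0 ys k) * wick_det n xs (remove_at k ys).
Proof.
rewrite /wick_det (expand_det_row _ ord0); apply: eq_bigr => k _.
rewrite mxE /= /cofactor add0n mulrCA mulrA; congr (_ * _ * \det _).
apply/matrixP => i j; by rewrite !mxE /= add0n nth_remove_at.
Qed.

Lemma wick_det_col n b xs ys : wick_det n.+1 xs (b :: ys) =
  \sum_(k < n.+1) (-1) ^+ k * m (nth x0 xs k) b * wick_det n (remove_at k xs) ys.
Proof.
rewrite /wick_det (expand_det_col _ ord0); apply: eq_bigr => k _.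
rewrite mxE /= /cofactor addn0 mulrCA mulrA; congr (_ * _ * \det _).
apply/matrixP => i j; by rewrite !mxE /= add0n nth_remove_at.
Qed.

(** The number of [p]-letters before a [p]-letter runs through 0, 1, 2 and so on, which converts a
    sum over positions into one over rows or columns. *)
Lemma sum_count_index (p : pred X) (g : nat -> K) (w : seq X) :
  \sum_(j < size w) (if p (nth x0 w j) then g (count p (take j w)) else 0) = \sum_(k < count p w) g k.
Proof.
elim: w g => [|a w IH] g /=; first by rewrite !big_ord0.
rewrite big_ord_recl /=; have := IH (fun k => g (p a + k)%N) => /= ->.
case: (p a) => /=; first by rewrite big_ord_recl.
by rewrite add0r.
Qed.

Lemma wick_sign_cat u b v : wick_sign (u ++ b :: v) =
  wick_sign (u ++ v) (+) odd (count plus v) (+) (plus b && odd (size u)).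
Proof.
elim: u => [|a u IH] /=; first by rewrite andbF addbF.
rewrite IH !count_cat /= !oddD oddb.
by case: (plus b) (odd (size u)) (wick_sign _) (odd (count plus u)) (odd (count plus v)) => [] [] [] [] [].
Qed.

(** For a leading plus letter contracted with [b]: the sign from the position of [b] in the word is
    traded for the sign from its rank among the minus letters. *)
Lemma wick_sign_minus u v b : plus b = false ->
  (-1) ^+ (wick_sign (u ++ b :: v) (+) odd (count plus (u ++ b :: v))) * (-1) ^+ count (predC plus) u =
  (-1) ^+ size u * (-1) ^+ wick_sign (u ++ v) :> K.
Proof.
move=> pb; rewrite wick_sign_cat pb /= addbF count_cat /= pb add0n -(count_predC plus u).
rewrite -[(-1) ^+ count _ _]signr_odd -[(-1) ^+ (_ + _)]signr_odd -!signr_addb !oddD.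
by congr (_ ^+ _); case: (wick_sign _) (odd (count plus u)) (odd (count plus v)) (odd (count (predC plus) u)) => [] [] [] [].
Qed.

(** The extra sign is matched by the negative entry that [time_ordered] prescribes for a minus
    letter followed by a plus letter. *)
Lemma wick_sign_plus u v b : plus b ->
  (-1) ^+ (wick_sign (u ++ b :: v) (+) odd (count plus (u ++ b :: v))) * (-1) ^+ count plus u =
  - ((-1) ^+ size u * (-1) ^+ wick_sign (u ++ v)) :> K.
Proof.
move=> pb; rewrite wick_sign_cat pb /= count_cat /= pb.
rewrite -[(-1) ^+ count _ _]signr_odd -[(-1) ^+ size _]signr_odd -!signr_addb !oddD /=.
rewrite -[RHS]mulN1r -[X in X * _]/((-1) ^+ true) -signr_addb.
by congr (_ ^+ _); case: (wick_sign _) (odd (count plus u)) (odd (count plus v)) (odd (size u)) => [] [] [] [].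
Qed.

Lemma size_count (w : seq X) : size w = (count plus w + count (predC plus) w)%N.
Proof. by rewrite count_predC. Qed.

Lemma wick_theorem n (w : seq X) : time_ordered w ->
  count plus w = n -> count (predC plus) w = n ->
  T w = (-1) ^+ wick_sign w * T [::] * wick_det n [seq x <- w | plus x] [seq x <- w | predC plus x].
Proof.
elim: n w => [|n IH] w hw hp hm.
  have : size w = 0%N by rewrite size_count hp hm.
  by move/size0nil => ->; rewrite /wick_det det_mx00 mulr1 mul1r.
case: w hw hp hm => [//|a w]; rewrite /time_ordered pairwise_cons => /andP[ha hw] hp hm.
have sw : odd (size w).
  have : size (a :: w) = n.*2.+2 by rewrite size_count hp hm addSn addnS addnn.
  by move=> [->] /=; rewrite odd_double.
rewrite T_rec //.
have split_w j : (j < size w)%N -> w = take j w ++ nth x0 w j :: drop j.+1 w.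
  by move=> jw; rewrite -drop_nth // cat_take_drop.
have ord_rem j : time_ordered (remove_at j w).
  apply: subseq_pairwise hw; rewrite -[X in subseq _ X](cat_take_drop j w); apply: cat_subseq => //.
  by rewrite -add1n -drop_drop; exact: drop_subseq.
have mem_j (j : 'I_(size w)) : (plus a != plus (nth x0 w j)) ->
    contr a (nth x0 w j) = if plus a then m a (nth x0 w j) else - m (nth x0 w j) a.
  move=> ne; move/all_nthP: ha => /(_ x0 j (ltn_ord j)); rewrite ne /= => /eqP ->//.
case pa: (plus a) ha hp hm mem_j => ha /= hp hm mem_j; rewrite pa /= in hp hm *.
- set xs := [seq x <- w | plus x]; set ys := [seq x <- w | predC plus x].
  rewrite wick_det_row mulr_sumr.
  have cw : count plus w = n by move: hp; rewrite add1n => -[].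
  have cm : count (predC plus) w = n.+1 by move: hm; rewrite add0n.
  (* The [k]-th term of the row expansion; position [j] of the word corresponds to
     [k = count (predC plus) (take j w)]. *)
  pose g k := (-1) ^+ (wick_sign w (+) odd (count plus w)) * T [::] * ((-1) ^+ k * m a (nth x0 ys k) * wick_det n xs (remove_at k ys)).
  transitivity (\sum_(k < count (predC plus) w) g k); last by rewrite cm.
  rewrite -(sum_count_index (predC plus) g w).
  apply: eq_bigr => j _; rewrite /=; case: (boolP (plus _)) => pj /=.
    by rewrite contr_same ?mulr0 ?mul0r ?pa ?pj.
  have jw := ltn_ord j; have sw' := split_w j jw; set u := take j w in sw'; set b := nth x0 w j in sw' pj *.
  set v := drop j.+1 w in sw'.
  have su : size u = j by rewrite size_takel // ltnW.
  rewrite mem_j ?pa ?(negbTE pj) // -/b.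
  have ey : ys = [seq x <- u | predC plus x] ++ b :: [seq x <- v | predC plus x].
    by rewrite /ys sw' filter_cat /= (negbTE pj).
  have kz : size [seq x <- u | predC plus x] = count (predC plus) u by rewrite size_filter.
  have ex : xs = [seq x <- u ++ v | plus x].
    by rewrite /xs sw' !filter_cat /= (negbTE pj).
  have er : remove_at (count (predC plus) u) ys = [seq x <- u ++ v | predC plus x].
    rewrite /remove_at ey -kz take_size_cat // filter_cat; congr (_ ++ _).
    by rewrite -cat_rcons drop_size_cat // size_rcons.
  have en : nth x0 ys (count (predC plus) u) = b by rewrite ey -kz nth_cat ltnn subnn.
  rewrite /g en er ex -/(remove_at j w) (IH (remove_at j w) (ord_rem j)); first last.
  + rewrite /remove_at -/u -/v count_cat; move: cm; rewrite sw' count_cat /= pj; lia.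
  + rewrite /remove_at -/u -/v count_cat; move: cw; rewrite sw' count_cat /= (negbTE pj); lia.
  rewrite /remove_at -/u -/v.
  have es : (-1) ^+ (wick_sign w (+) odd (count plus w)) * (-1) ^+ count (predC plus) u = (-1) ^+ j * (-1) ^+ wick_sign (u ++ v) :> K.
    by have := wick_sign_minus u v (negbTE pj); rewrite -sw' su.
  transitivity (T [::] * (((-1) ^+ j * (-1) ^+ wick_sign (u ++ v)) * (m a b * wick_det n [seq x <- u ++ v | plus x] [seq x <- u ++ v | predC plus x]))); first ring.
  by rewrite -es; ring.
- set xs := [seq x <- w | plus x]; set ys := [seq x <- w | predC plus x].
  rewrite wick_det_col mulr_sumr.
  have cw : count plus w = n.+1 by move: hp; rewrite add0n.
  have cm : count (predC plus) w = n by move: hm; rewrite add1n => -[].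
  pose g k := (-1) ^+ (wick_sign w (+) odd (count plus w)) * T [::] * ((-1) ^+ k * m (nth x0 xs k) a * wick_det n (remove_at k xs) ys).
  transitivity (\sum_(k < count plus w) g k); last by rewrite -cw.
  rewrite -(sum_count_index plus g w).
  apply: eq_bigr => j _; rewrite /=; case: (boolP (plus _)) => pj /=; last first.
    by rewrite contr_same ?mulr0 ?mul0r ?pa ?(negbTE pj).
  have jw := ltn_ord j; have sw' := split_w j jw; set u := take j w in sw'; set b := nth x0 w j in sw' pj *.
  set v := drop j.+1 w in sw'.
  have su : size u = j by rewrite size_takel // ltnW.
  rewrite mem_j ?pa ?pj // -/b.
  have ex : xs = [seq x <- u | plus x] ++ b :: [seq x <- v | plus x].
    by rewrite /xs sw' filter_cat /= pj.
  have kz : size [seq x <- u | plus x] = count plus u by rewrite size_filter.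
  have ey : ys = [seq x <- u ++ v | predC plus x].
    by rewrite /ys sw' !filter_cat /= pj.
  have er : remove_at (count plus u) xs = [seq x <- u ++ v | plus x].
    rewrite /remove_at ex -kz take_size_cat // filter_cat; congr (_ ++ _).
    by rewrite -cat_rcons drop_size_cat // size_rcons.
  have en : nth x0 xs (count plus u) = b by rewrite ex -kz nth_cat ltnn subnn.
  rewrite /g en er ey -/(remove_at j w) (IH (remove_at j w) (ord_rem j)); first last.
  + rewrite /remove_at -/u -/v count_cat; move: cm; rewrite sw' count_cat /= pj; lia.
  + rewrite /remove_at -/u -/v count_cat; move: cw; rewrite sw' count_cat /= pj; lia.
  rewrite /remove_at -/u -/v.
  have es : (-1) ^+ (wick_sign w (+) odd (count plus w)) * (-1) ^+ count plus u = - ((-1) ^+ j * (-1) ^+ wick_sign (u ++ v)) :> K.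
    by have := wick_sign_plus u v pj; rewrite -sw' su.
  transitivity (T [::] * (- ((-1) ^+ j * (-1) ^+ wick_sign (u ++ v)) * (m b a * wick_det n [seq x <- u ++ v | plus x] [seq x <- u ++ v | predC plus x]))); first ring.
  by rewrite -es; ring.
Qed.

End WickDeterminant.

(** * Supertraces *)

Section FockSums.
Variable R : realType.
Local Notation C := (Cplx R).

Lemma le_sum_finType (I : finType) (G : I -> R) (A : {fset I}) : (forall i, 0 <= G i) ->
  \sum_(i <- A) G i <= \sum_i G i.
Proof.
move=> G0; have -> : \sum_i G i = \sum_(i <- [fset i in I]%fset) G i.
  rewrite -big_enum /=; apply: perm_big; apply: uniq_perm; rewrite ?fset_uniq ?enum_uniq // => i.
  by rewrite mem_enum !inE.
by apply: le_sum_fset => //; apply/fsubsetP => i _; rewrite !inE.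
Qed.

(** Finitely many sequences use only levels below some [N]. Over all subsets of these the products
    sum to the product of the [1 + a k], and [1 + a <= expR a] makes the bound independent of
    [N]. *)
Lemma abs_summable_fock_seq (a : nat -> R) (M : R) : (forall k, 0 <= a k) ->
  (forall N, \sum_(k < N) a k <= M) -> abs_summable (fun s : fock_seq => ofR (\prod_(k <- val s) a k) : C).
Proof.
move=> a0 aM; exists (expR M) => A.
have [N hN] : exists N, forall s k, s \in A -> k \in val s -> (k < N)%N.
  exists (\max_(s <- A) \max_(k <- val s) k).+1 => s k sA ks; rewrite ltnS.
  have le_max (t : seq nat) x : x \in t -> (x <= \max_(y <- t) y)%N.
    elim: t => [//|y t IH]; rewrite inE big_cons => /orP[/eqP ->|/IH h]; first exact: leq_maxl.
    exact: leq_trans h (leq_maxr _ _).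
  by rewrite (big_fsetD1 s) //=; apply: leq_trans (le_max _ _ ks) (leq_maxl _ _).
pose F (i : 'I_N) (b : bool) : R := if b then a i else 1.
pose G (g : {ffun 'I_N -> bool}) : R := \prod_i F i (g i).
have G0 g : 0 <= G g by apply: prodr_ge0 => i _; rewrite /F; case: ifP.
pose phi (s : fock_seq) : {ffun 'I_N -> bool} := [ffun i : 'I_N => (i : nat) \in val s].
have Gphi s : s \in A -> nrm (ofR (\prod_(k <- val s) a k) : C) = G (phi s).
  move=> sA; rewrite nrm_ofR ger0_norm; last by apply: prodr_ge0.
  rewrite /G (eq_bigr (fun i : 'I_N => if (i : nat) \in val s then a i else 1)) => [|i _]; last first.
    by rewrite ffunE.
  rewrite -big_mkcond /= -(big_mkord (fun i => i \in val s) a) /index_iota subn0 -[RHS]big_filter.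
  apply: perm_big; apply: uniq_perm; rewrite ?filter_uniq ?iota_uniq ?fock_seq_uniq // => k.
  rewrite mem_filter mem_iota add0n /=; case: (boolP (k \in val s)) => ks //=.
  by rewrite (hN s).
have inj : {in A &, injective phi}.
  move=> s t sA tA /ffunP e; apply: fock_seq_eq => k.
  apply/idP/idP => hk; have kN := hN _ _ _ hk; [have := e (Ordinal (kN sA))|have := e (Ordinal (kN tA))];
    by rewrite !ffunE /= hk => // /esym.
rewrite big_seq (eq_bigr (fun s => G (phi s))) => [|s]; last exact: Gphi.
rewrite -big_seq; have := @le_sum_finType _ G (phi @` A)%fset G0; rewrite big_imfset //= => h.
apply: le_trans h _; rewrite /G -(bigA_distr_bigA F).
apply: le_trans (_ : \prod_(i < N) expR (a i) <= _).
  apply: ler_prod => i _; rewrite big_bool /F /= addr_ge0 //= addrC.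
  exact: expR_ge1Dx.
rewrite -(big_morph expR (id1 := 1) (op1 := *%R) (@expRD R) (expR0 R)).
by rewrite ler_expR.
Qed.

End FockSums.

Section Traces.
Variables (R : realType) (V : vosa (Cplx R)) (psip psim : V).
Local Notation C := (Cplx R).
Hypothesis HV : rank_two_fermion psip psim.
Variables (beta alpha : R) (tau : C).
Hypothesis tau0 : 0 < complex.Im tau.
Local Notation fock := (fock psip psim).
Local Notation psi := (psi psip psim).
Local Notation kappa := (ofR (beta + 1 / 2)).
Local Notation coord := (coord_in fock).
Let hb := fermion_fock HV.

Lemma expop_spec (z : C) (A : V -> V) (mu : fock_index -> C) :
  (forall (a : C) u v, A (a *: u + v) = a *: A u + A v) ->
  (forall b, A (fock b) = mu b *: fock b) ->
  (forall (a : C) u v, expop z A (a *: u + v) = a *: expop z A u + expop z A v) /\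
  (forall (nu : C) v, A v = nu *: v -> expop z A v = cexp (z * nu) *: v).
Proof.
move=> lA dA.
exact: (xgetPex (fun=> 0) (diag_map_ex hb lA dA (fun nu => cexp (z * nu)))).
Qed.

Definition fop : V -> V := expop (twopii R * ofR alpha) (mode (heis psip psim) 0).
Definition qop : V -> V := qL psip psim kappa tau.
Definition feig (b : fock_index) : C := cexp (twopii R * ofR alpha * fock_charge C b).
Definition qeig (b : fock_index) : C :=
  cexp (twopii R * tau * (fock_weight kappa b - charge_shift kappa / 24)).

Lemma fop_linear (a : C) u v : fop (a *: u + v) = a *: fop u + fop v.
Proof. exact: (expop_spec _ (vosa_mode_linearr _ _) (heis_fock HV)).1. Qed.

Lemma fop_fock b : fop (fock b) = feig b *: fock b.
Proof. exact: (expop_spec _ (vosa_mode_linearr _ _) (heis_fock HV)).2 _ _ (heis_fock HV b). Qed.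

Lemma Lshift_linear (a : C) u v (D := fun w : V => Lh0 psip psim kappa w - (charge_shift kappa / 24) *: w) :
  D (a *: u + v) = a *: D u + D v.
Proof.
rewrite /D Lh0_linear scalerDr opprD addrACA scalerBr; congr (_ + _ + _).
by rewrite !scalerA mulrC.
Qed.

Lemma Lshift_fock b : Lh0 psip psim kappa (fock b) - (charge_shift kappa / 24) *: fock b =
  (fock_weight kappa b - charge_shift kappa / 24) *: fock b.
Proof. by rewrite (Lh0_fock HV) scalerBl. Qed.

Lemma qop_fock b : qop (fock b) = qeig b *: fock b.
Proof. exact: (expop_spec _ Lshift_linear Lshift_fock).2 _ _ (Lshift_fock b). Qed.

Lemma expop_psi e z : expop z (Lh0 psip psim kappa) (psi e) = cexp (z * (2^-1 - charge_sign C e * kappa)) *: psi e.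
Proof.
apply: (expop_spec _ (@Lh0_linear _ _ psip psim kappa) (Lh0_fock HV kappa)).2.
have := Lh0_comm HV kappa e (-1) (vacuum V).
rewrite Lh0_vac mode0r add0r vosa_creation => ->; congr (_ *: _).
rewrite mulrN1z opprK; by congr (_ - _); field.
Qed.

Definition word_op (w : seq (bool * int)) (v : V) : V := foldr (fun p => mode (psi p.1) p.2) v w.

Lemma word_op_cons p w v : word_op (p :: w) v = mode (psi p.1) p.2 (word_op w v).
Proof. by []. Qed.

Lemma word_op_rcons p w v : word_op (rcons w p) v = word_op w (mode (psi p.1) p.2 v).
Proof. by rewrite /word_op foldr_rcons. Qed.

Lemma word_opZ w (a : C) v : word_op w (a *: v) = a *: word_op w v.
Proof. by elim: w => //= p w ->; rewrite modeZr. Qed.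

Lemma word_op_fock w b : exists (a : C) c, nrm a <= 1 /\ word_op w (fock b) = a *: fock c.
Proof.
elim: w => [|[e m] w [a [c [ha IH]]]] /=.
  by exists 1, b; rewrite nrm1 scale1r.
have [s [hs h]] := psi_fock HV e m c.
exists (a * s), (psi_toggle e m c); split; last by rewrite IH modeZr h scalerA.
rewrite nrmM -[leRHS]mulr1; apply: ler_pM; rewrite ?nrm_ge0 //.
by rewrite -ler_ofR -normE.
Qed.

Definition entry w b : C := diag_entry psip psim (fop \o word_op w \o qop) b.

Lemma entryE w b : entry w b = qeig b * feig b * coord (word_op w (fock b)) b.
Proof.
rewrite /entry /diag_entry /= qop_fock word_opZ (coord_diag hb fop_linear fop_fock) (coordZ hb).
by rewrite mulrCA mulrA.
Qed.

Definition level (e : bool) (k : nat) : C := k%:R - 2^-1 - charge_sign C e * kappa.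
Definition level_norm (e : bool) (k : nat) : R := nrm (cexp (twopii R * tau * level e k)).

Lemma nrm_feig b : nrm (feig b) = 1.
Proof.
have [k hk] : exists k : int, fock_charge C b = k%:~R.
  exists ((size (val b.1))%:Z - (size (val b.2))%:Z).
  rewrite /fock_charge /additive_wt /charge_sign !big_const_seq !count_predT !iter_addr_0 intrB; congr (_ + _).
  by rewrite mulNrn.
rewrite /feig hk -mulrA -ofR_int -ofRM cexp_twopii_ofR.
rewrite /nrm normc_def /= cos2Dsin2 sqrtr1 //.
Qed.

Lemma nrm_qeig b : nrm (qeig b) = nrm (cexp (- (twopii R * tau * (charge_shift kappa / 24)))) *
  ((\prod_(k <- val b.1) level_norm true k) * (\prod_(k <- val b.2) level_norm false k)).
Proof.
rewrite /qeig mulrBr addrC cexpD nrmM; congr (_ * _).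
rewrite /fock_weight /additive_wt mulrDr cexpD nrmM.
by rewrite !mulr_sumr !cexp_sum !nrm_prod.
Qed.

Lemma level_normE e k : level_norm e k = expR (- (width tau * (k%:R - 2^-1 - (if e then 1 else -1) * (beta + 1 / 2)))).
Proof.
rewrite /level_norm nrm_cexp; congr expR.
have -> : level e k = ofR (k%:R - 2^-1 - (if e then 1 else -1) * (beta + 1 / 2)).
  rewrite /level !(ofRD, ofRN, ofRM) ofR_nat ofRV ofR_nat; congr (_ - _ - _ * _).
  by case: e; rewrite /charge_sign ?ofRN ?ofR1.
by rewrite mulrC Re_ofRM Re_twopii_tau mulrN mulrC.
Qed.

(** Low levels may have weight above 1 when [beta] is large; only the geometric decay in [k]
    matters. *)
Lemma level_norm_bound e : exists M, forall N, \sum_(k < N) level_norm e k <= M.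
Proof.
have L0 := width_gt0 tau0.
have r1 : nrm (ofR (expR (- width tau)) : C) < 1.
  by rewrite nrm_ofR ger0_norm ?expR_ge0 // -[ltRHS]expR0 ltr_expR oppr_lt0.
have [M hM] := abs_summable_geom r1.
pose d : R := expR (width tau * (2^-1 + (if e then 1 else -1) * (beta + 1 / 2))).
exists (d * M) => N; have h := hM [fset k in iota 0 N]%fset.
have : \sum_(k < N) nrm (ofR (expR (- width tau)) ^+ k : C) <= M.
  apply: le_trans h; rewrite -(big_mkord xpredT (fun k => nrm (ofR (expR (- width tau)) ^+ k : C))).
  rewrite /index_iota subn0 le_eqVlt; apply/orP; left; apply/eqP; apply: perm_big.
  by apply: uniq_perm; rewrite ?fset_uniq ?iota_uniq // => k; rewrite !inE.
move=> /(ler_wpM2l (expR_ge0 (width tau * (2^-1 + (if e then 1 else -1) * (beta + 1 / 2))))).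
apply: le_trans; rewrite mulr_sumr; apply: ler_sum => k _.
rewrite nrmX nrm_ofR (ger0_norm (expR_ge0 _)) -expRM_natl -expRD level_normE ler_expR.
by rewrite le_eqVlt; apply/orP; left; apply/eqP; ring.
Qed.

Lemma abs_summable_eig : abs_summable (fun b => qeig b * feig b).
Proof.
have h e : abs_summable (fun s : fock_seq => ofR (\prod_(k <- val s) level_norm e k) : C).
  by have [M hM] := level_norm_bound e; apply: (abs_summable_fock_seq _ hM) => k; exact: nrm_ge0.
have p0 e (s : fock_seq) : 0 <= \prod_(k <- val s) level_norm e k.
  by apply: prodr_ge0 => k _; exact: nrm_ge0.
apply: (abs_summable_le_eq (fun b => nrmM _ _) (fun b => nrmM _ _) _
   (asmZ (cexp (- (twopii R * tau * (charge_shift kappa / 24)))) (abs_summable_prod (h true) (h false)))) => b /=.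
rewrite nrm_feig mulr1 nrm_qeig; apply: ler_wpM2l; first exact: nrm_ge0.
by rewrite nrmM !nrm_ofR !ger0_norm ?p0.
Qed.

Lemma nrm_coord_op w b c : nrm (coord (word_op w (fock b)) c) <= 1.
Proof.
have [a [d [ha ->]]] := word_op_fock w b; rewrite (coordZ hb) (coord_basis hb) nrmM.
by case: eqP => _; rewrite ?nrm1 ?mulr1 // nrm0 mulr0.
Qed.

Lemma abs_summable_entry w : abs_summable (entry w).
Proof.
apply: abs_summable_le abs_summable_eig => b; rewrite entryE [leLHS]nrmM.
by rewrite -[leRHS]mulr1 ler_wpM2l ?nrm_ge0 // nrm_coord_op.
Qed.

Definition signed w b : C := (-1) ^+ fock_odd b * entry w b.

Lemma abs_summable_signed w : abs_summable (signed w).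
Proof.
apply: abs_summable_le (abs_summable_entry w) => b; rewrite nrmM nrmX nrmN nrm1 expr1n mul1r //.
Qed.

Definition word_trace w : C := csum (signed w).

Lemma word_trace_has w : has_csum (signed w) (word_trace w).
Proof. exact/csumP/abs_summable_csummable/abs_summable_signed. Qed.

(** The traces over the two sectors restrict one absolutely convergent sum to complementary sets of
    basis vectors, so their difference is a single signed sum. *)
Lemma STr_scaled (X : V -> V) (a : C) w :
  (forall b, diag_entry psip psim X b = a * entry w b) -> STr psip psim X = a * word_trace w.
Proof.
move=> hX; have aX : abs_summable (diag_entry psip psim X).
  by rewrite (funext hX); apply: asmZ; exact: abs_summable_entry.
rewrite /STr /trace_on; have h p := csumP (abs_summable_csummable (abs_summable_restr [set b | sector p (fock b)] aX)).
apply: (has_csum_uniq _ (has_csumZ a (word_trace_has w))); apply: has_csum_ext (has_csumB (h false) (h true)) => b.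
rewrite /restr /signed hX; have := fock_sectorP HV.
move=> sp; case eb : (fock_odd b).
  rewrite asboolF; last by move=> /= /sp; rewrite -/(fock_odd b) eb.
  by rewrite asboolT ?expr1 ?mulN1r ?mulrN ?sub0r //=; apply/sp; rewrite -/(fock_odd b) eb.
rewrite asboolT; last by apply/sp; rewrite -/(fock_odd b) eb.
by rewrite asboolF ?expr0 ?mul1r ?subr0 //= => /sp; rewrite -/(fock_odd b) eb.
Qed.

(** The ratio of the eigenvalues of f q^(L_h(0) - c_h/24) after and before the mode [p] acts. *)
Definition cyclic_factor (p : bool * int) : C :=
  cexp (twopii R * ofR alpha * charge_sign C p.1) * cexp (twopii R * tau * (- p.2%:~R - 2^-1 - charge_sign C p.1 * kappa)).

(** The factor [s] is kept on both sides: where the mode kills the vector, the toggled vector need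
    not have the shifted eigenvalue. *)
Lemma eig_shift e m b (s : C) : mode (psi e) m (fock b) = s *: fock (psi_toggle e m b) ->
  s * (qeig (psi_toggle e m b) * feig (psi_toggle e m b)) = s * (cyclic_factor (e, m) * (qeig b * feig b)).
Proof.
move=> h; set c := psi_toggle e m b in h *.
have [->|s0] := eqVneq s 0; first by rewrite !mul0r.
have cancel (x y : C) : (s * x) *: fock c = (s * y) *: fock c -> x = y.
  move=> /(congr1 (fun v => coord v c)); rewrite !(coordZ hb) (coord_basis hb) eqxx !mulr1.
  exact: mulfI.
have ec : fock_charge C c = fock_charge C b + charge_sign C e.
  apply: cancel; have := heis_comm HV e m (fock b).
  rewrite h modeZr !(heis_fock HV) modeZr h !scalerA -scalerDl => ->.
  by congr (_ *: _); ring.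
have ew : fock_weight kappa c = fock_weight kappa b + (- m%:~R - 2^-1 - charge_sign C e * kappa).
  apply: cancel; have := Lh0_comm HV kappa e m (fock b).
  rewrite h !(Lh0_fock HV) modeZr h.
  have -> : Lh0 psip psim kappa (s *: fock c) = s *: Lh0 psip psim kappa (fock c) by rewrite /Lh0 modeZr.
  rewrite (Lh0_fock HV) !scalerA -scalerDl => ->.
  by congr (_ *: _); ring.
congr (s * _); rewrite /qeig /feig ec ew /cyclic_factor /=.
rewrite (addrAC (fock_weight _ _)) !(mulrDr (twopii R * tau)) (mulrDr _ _ (charge_sign C e)) !cexpD.
move: (cexp _) (cexp _) (cexp _) (cexp _) (cexp _) => x1 x2 x3 x4 x5; ring.
Qed.

Lemma coord_toggle e m w b (s : fock_index -> C) :
  (forall b, mode (psi e) m (fock b) = s b *: fock (psi_toggle e m b)) ->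
  coord (word_op ((e, m) :: w) (fock (psi_toggle e m b))) (psi_toggle e m b) =
  coord (word_op (rcons w (e, m)) (fock b)) b.
Proof.
move=> hs; rewrite word_op_cons word_op_rcons /= hs word_opZ.
have [a [c [_ ->]]] := word_op_fock w (psi_toggle e m b).
rewrite modeZr hs scalerA !(coordZ hb) !(coord_basis hb).
rewrite (can_eq (@psi_toggleK e m)); case: eqP => [->|_]; last by rewrite !mulr0.
by rewrite !mulr1 mulrC.
Qed.

(** Toggling permutes the Fock basis, so the sum can be reindexed by it; each toggle flips the
    parity, whence the minus sign. *)
Lemma word_trace_cyclic p w : word_trace (p :: w) = - (cyclic_factor p) * word_trace (rcons w p).
Proof.
case: p => e m; have [s hs] := choice (psi_fock HV e m).
have hs' b := (hs b).2.
apply: (has_csum_uniq (has_csum_bij (@psi_toggleK e m) (@psi_toggleK e m) (word_trace_has ((e, m) :: w)))).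
apply: has_csum_ext (has_csumZ _ (word_trace_has (rcons w (e, m)))) => b.
rewrite /signed psi_toggle_odd !entryE (coord_toggle w b hs').
have -> : coord (word_op (rcons w (e, m)) (fock b)) b = s b * coord (word_op w (fock (psi_toggle e m b))) b.
  by rewrite word_op_rcons hs' word_opZ (coordZ hb).
have es := eig_shift (hs' b); have -> : (-1) ^+ (~~ fock_odd b) = - (-1) ^+ fock_odd b :> C.
  by case: (fock_odd b); rewrite ?expr0 ?expr1 ?opprK.
move: (coord _ _) (fock_odd b) es => x o.
move: (qeig _ * feig _) (qeig _ * feig _) (s b) (cyclic_factor _) ((-1) ^+ o) => y z sb r t es.
have -> : - t * (z * (sb * x)) = - t * x * (sb * z) by ring.
by rewrite es; ring.
Qed.

Definition bracket (p q : bool * int) : C := if (p.1 != q.1) && (p.2 == - q.2 - 1) then 1 else 0.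

Lemma word_op_move p w v x0 : word_op (p :: w) v =
  \sum_(j < size w) ((-1) ^+ j * bracket p (nth x0 w j)) *: word_op (remove_at j w) v +
  (-1) ^+ size w *: word_op (rcons w p) v.
Proof.
elim: w => [|q w IH]; first by rewrite big_ord0 add0r expr0 scale1r.
have -> : word_op [:: p, q & w] v = - mode (psi q.1) q.2 (word_op (p :: w) v) + bracket p q *: word_op w v.
  rewrite /= (psi_anti HV) /bracket; case: ifP => _; by rewrite ?scale1r ?scale0r.
rewrite IH big_ord_recl /= expr0 mul1r {2}/remove_at /= drop0 modeDr opprD addrAC.
rewrite [X in X - _ = _]addrC; congr (_ + _ + _).
  rewrite (big_morph (mode (psi q.1) q.2) (id1 := 0) (op1 := +%R)) => [||]; last first.
  - exact: mode0r.
  - exact: modeDr.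
  rewrite -sumrN; apply: eq_bigr => j _; rewrite /bump add1n modeZr /remove_at /=.
  by rewrite exprS !mulN1r mulNr scaleNr.
by rewrite modeZr exprS mulN1r scaleNr.
Qed.

Lemma word_op_moveC p w v x0 : word_op (p :: w) v = (-1) ^+ size w *: word_op (rcons w p) v +
  \sum_(j < size w) ((-1) ^+ j * bracket p (nth x0 w j)) *: word_op (remove_at j w) v.
Proof. rewrite [RHS]addrC; exact: word_op_move. Qed.

Lemma word_trace_move p w x0 : word_trace (p :: w) =
  \sum_(j < size w) ((-1) ^+ j * bracket p (nth x0 w j)) * word_trace (remove_at j w) + (-1) ^+ size w * word_trace (rcons w p).
Proof.
apply: (has_csum_uniq (word_trace_has _)).
have hj (j : 'I_(size w)) := has_csumZ ((-1) ^+ j * bracket p (nth x0 w j)) (word_trace_has (remove_at j w)).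
apply: has_csum_ext (has_csumD (has_csum_sum (index_enum _) xpredT hj) (has_csumZ ((-1) ^+ size w) (word_trace_has (rcons w p)))) => b.
have cs : coord (word_op (p :: w) (fock b)) b = \sum_(j < size w) ((-1) ^+ j * bracket p (nth x0 w j)) * coord (word_op (remove_at j w) (fock b)) b +
    (-1) ^+ size w * coord (word_op (rcons w p) (fock b)) b.
  rewrite [RHS]addrC (word_op_moveC p w (fock b) x0) (coord_linear hb); congr (_ + _).
  elim/big_ind2: _ => [|x1 y1 x2 y2 h1 h2|j _]; first exact: coord0.
  - by rewrite -[y1]scale1r (coord_linear hb) mul1r; congr (_ + _).
  - exact: coordZ.
rewrite /signed !entryE cs mulrDr mulrDr; congr (_ + _).
  rewrite !mulr_sumr; apply: eq_bigr => j _; rewrite entryE.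
  move: (coord _ _) (_ * bracket _ _) (qeig b) (feig b) => x y z t; ring.
move: (coord _ _) (qeig b) (feig b) => x z t; ring.
Qed.

(** With T' the trace of the rotated word, S the contracted terms and r the cyclic factor, odd
    [size w] gives T = S - T' and T = - r T', hence (1 - 1/r) T = S. *)
Lemma word_trace_rec p w x0 : odd (size w) -> 1 - (cyclic_factor p)^-1 != 0 ->
  word_trace (p :: w) = \sum_(j < size w) (-1) ^+ j * ((1 - (cyclic_factor p)^-1)^-1 * bracket p (nth x0 w j)) * word_trace (remove_at j w).
Proof.
move=> sw nz; have r0 : cyclic_factor p != 0 by rewrite mulf_neq0 // cexp_neq0.
have h1 := word_trace_move p w x0; have h2 := word_trace_cyclic p w.
set S := (X in _ = X + _) in h1.
have -> : \sum_(j < size w) (-1) ^+ j * ((1 - (cyclic_factor p)^-1)^-1 * bracket p (nth x0 w j)) * word_trace (remove_at j w) =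
    (1 - (cyclic_factor p)^-1)^-1 * S.
  rewrite /S mulr_sumr; apply: eq_bigr => j _.
  move: (_ ^-1) (bracket _ _) (word_trace _) ((-1) ^+ j) => x y z t; ring.
rewrite -signr_odd sw expr1 mulN1r in h1.
apply: (mulfI nz); rewrite mulrA mulfV // mul1r mulrBl mul1r {2}h2 mulNr mulrN mulKf // opprK.
by rewrite h1 subrK.
Qed.

End Traces.

(** * The n-point function *)

Section Interleave.

Definition interleave (I A : Type) (r : seq I) (a b : I -> A) : seq A :=
  flatten [seq [:: a i; b i] | i <- r].

Lemma interleave_cons (I A : Type) i (r : seq I) (a b : I -> A) :
  interleave (i :: r) a b = [:: a i, b i & interleave r a b].
Proof. by []. Qed.

Lemma zip_interleave (I A B : Type) (r : seq I) (a b : I -> A) (c d : I -> B) :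
  zip (interleave r a b) (interleave r c d) = interleave r (fun i => (a i, c i)) (fun i => (b i, d i)).
Proof. by elim: r => //= i r IH; rewrite !interleave_cons /= IH. Qed.

Lemma map_interleave (I A B : Type) (f : A -> B) (r : seq I) (a b : I -> A) :
  map f (interleave r a b) = interleave r (f \o a) (f \o b).
Proof. by elim: r => //= i r IH; rewrite !interleave_cons /= IH. Qed.

Lemma size_interleave (I A : Type) (r : seq I) (a b : I -> A) : size (interleave r a b) = (size r).*2.
Proof. by elim: r => //= i r IH; rewrite doubleS IH. Qed.

Lemma big_interleave (T : Type) (idx : T) (mop : Monoid.com_law idx) (I A : Type) (r : seq I) (a b : I -> A) (F : A -> T) :
  \big[mop/idx]_(x <- interleave r a b) F x = \big[mop/idx]_(i <- r) mop (F (a i)) (F (b i)).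
Proof. by elim: r => [|i r IH]; rewrite ?big_nil // interleave_cons !big_cons IH Monoid.mulmA. Qed.

Lemma interleave_enum (A : Type) n (a b : nat -> A) :
  interleave (enum 'I_n) (fun i => a i) (fun i => b i) = interleave (iota 0 n) a b.
Proof. by rewrite /interleave -val_enum_ord -map_comp. Qed.

Lemma nth_interleave (A : Type) (d : A) n (a b : nat -> A) i : (i < n)%N ->
  nth d (interleave (iota 0 n) a b) i.*2 = a i /\ nth d (interleave (iota 0 n) a b) i.*2.+1 = b i.
Proof.
have gen m : (i < n)%N -> nth d (interleave (iota m n) a b) i.*2 = a (m + i)%N /\ nth d (interleave (iota m n) a b) i.*2.+1 = b (m + i)%N.
  elim: n m i => [//|n IH] m [|i]; rewrite /= ?addn0 // => /IH -/(_ m.+1) [h1 h2].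
  by rewrite addnS -addSn -h1 -h2.
exact: gen.
Qed.

Lemma nth_interleave_gen (I A : Type) (i0 : I) (d : A) (r : seq I) (a b : I -> A) k : (k < size r)%N ->
  nth d (interleave r a b) k.*2 = a (nth i0 r k) /\ nth d (interleave r a b) k.*2.+1 = b (nth i0 r k).
Proof. by elim: r k => [//|i r IH] [|k] //= /IH. Qed.

Lemma nth_interleave_ord (A : Type) (d : A) n (a b : 'I_n -> A) (i : 'I_n) :
  nth d (interleave (enum 'I_n) a b) i.*2 = a i /\ nth d (interleave (enum 'I_n) a b) i.*2.+1 = b i.
Proof.
by have := nth_interleave_gen i d a b (r := enum 'I_n) (k := i); rewrite size_enum_ord ltn_ord nth_ord_enum; apply.
Qed.

Lemma interleave_nth (A : Type) (d : A) n (s : seq A) : size s = n.*2 ->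
  s = interleave (iota 0 n) (fun i => nth d s i.*2) (fun i => nth d s i.*2.+1).
Proof.
move=> hs; apply: (@eq_from_nth _ d); rewrite ?size_interleave ?size_iota // => k; rewrite hs => hk.
have ik : (k./2 < n)%N by lia.
have [h1 h2] := nth_interleave d (fun i => nth d s i.*2) (fun i => nth d s i.*2.+1) ik.
case ok : (odd k); have := odd_double_half k; rewrite ok /= ?add0n ?add1n => e; by rewrite -[in LHS]e -[in RHS]e ?h1 ?h2.
Qed.

Lemma filter_interleave (I A : Type) (p : pred A) (r : seq I) (a b : I -> A) :
  (forall i, p (a i)) -> (forall i, ~~ p (b i)) ->
  [seq x <- interleave r a b | p x] = map a r /\ [seq x <- interleave r a b | predC p x] = map b r.
Proof.
move=> pa pb; elim: r => [//|i r [h1 h2]]; rewrite interleave_cons /= pa (negbTE (pb i)) /=.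
by rewrite h1 h2.
Qed.

End Interleave.

Arguments interleave : simpl never.

(** * Traces of alternating words as determinants *)

Section AlternatingTrace.
Variables (R : realType) (V : vosa (Cplx R)) (psip psim : V).
Local Notation C := (Cplx R).
Hypothesis HV : rank_two_fermion psip psim.
Variables (beta alpha : R) (tau : C).
Hypothesis tau0 : 0 < complex.Im tau.
Local Notation theta := (cexp (- twopii R * ofR alpha)).
Local Notation phi := (cexp (- twopii R * ofR beta)).
Local Notation lam := (twist phi).
Hypothesis nz : forall k, 1 - theta^-1 * qpow tau lam k != 0.
Variable k0 : int.
Hypothesis hk0 : - beta = lam + k0%:~R.
Local Notation u := (ucoef theta tau lam).
Local Notation cyclic_factor := (cyclic_factor beta alpha tau).
Local Notation word_trace := (word_trace psip psim beta alpha tau).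

(** Here - m - 1/2 - kappa = - beta - m - 1; with [- beta = lam + k0] the exponents produced by the
    modes are those of [P1]. *)
Lemma expo_plus (m : int) : ofR (expo lam (k0 - m - 1)) = - m%:~R - 2^-1 - ofR (beta + 1 / 2) :> C.
Proof.
have -> : expo lam (k0 - m - 1) = - m%:~R - 2^-1 - (beta + 1 / 2).
  by rewrite /expo !intrB; move: hk0; lra.
by rewrite !(ofRD, ofRN) ofR_int ofRV ofR_nat.
Qed.

Lemma cyclic_factor_plus m : cyclic_factor (true, m) = theta^-1 * qpow tau lam (k0 - m - 1).
Proof.
rewrite /cyclic_factor /= mulr1 (mul1r (ofR _)) mulNr cexpN invrK; congr (_ * cexp _).
by rewrite expo_plus mulrAC.
Qed.

(** psi^-(m) is dual to psi^+(-m-1), whose factor is the inverse. *)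
Lemma cyclic_factor_minus m : cyclic_factor (false, m) = (theta^-1 * qpow tau lam (m + k0))^-1.
Proof.
have -> : m + k0 = k0 - (- m - 1) - 1 by ring.
rewrite invfM invrK /qpow -cexpN /cyclic_factor /= mulrN1 (mulN1r (ofR _)) mulNr; congr (_ * cexp _).
rewrite expo_plus intrB mulrNz; move: (ofR _) (twopii R) (m%:~R : C) => x y z.
by field.
Qed.

(** The identity 1/(1 - 1/x) = 1 - 1/(1 - x) at x = theta^-1 q^n. *)
Lemma inv_plus m : (1 - (cyclic_factor (true, m))^-1)^-1 = 1 - u (k0 - m - 1).
Proof.
have x0 : theta^-1 * qpow tau lam (k0 - m - 1) != 0.
  by rewrite mulf_neq0 ?invr_neq0 ?cexp_neq0.
have := nz (k0 - m - 1); rewrite cyclic_factor_plus /ucoef; move: (theta^-1 * _) x0 => x x0 x1.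
by field; rewrite x0 x1 -opprB oppr_eq0 x1.
Qed.

Lemma inv_minus m : (1 - (cyclic_factor (false, m))^-1)^-1 = u (m + k0).
Proof. by rewrite cyclic_factor_minus invrK. Qed.

Lemma cyclic_factor_neq1 p : 1 - (cyclic_factor p)^-1 != 0.
Proof.
case: p => -[] m; last by rewrite cyclic_factor_minus invrK.
have x0 : theta^-1 * qpow tau lam (k0 - m - 1) != 0.
  by rewrite mulf_neq0 ?invr_neq0 ?cexp_neq0.
have := nz (k0 - m - 1); rewrite cyclic_factor_plus; move: (theta^-1 * _) x0 => x x0.
rewrite !subr_eq0; apply: contra => /eqP e; by rewrite -(invrK x) -e invr1.
Qed.

Local Notation letter := (nat * (bool * int))%type.

Definition pair_contr (a b : letter) : C := (1 - (cyclic_factor a.2)^-1)^-1 * bracket R a.2 b.2.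

(* The labels record positions; a contraction of a later plus letter with an earlier
   minus letter carries the other expansion of the same meromorphic function. *)
Definition pair_entry (a b : letter) : C :=
  bracket R a.2 b.2 * (1 - u (k0 - a.2.2 - 1) - (if (b.1 < a.1)%N then 1 else 0)).

Variables (n : nat) (M Lf : nat -> int).

Definition alt_word : seq (bool * int) :=
  interleave (iota 0 n) (fun i => (true, M i)) (fun i => (false, Lf i)).

(** The same letter may occur at several places, so the order of two letters can be read off only
    after numbering them. *)
Definition alt_labelled (i n : nat) : seq letter :=
  interleave (iota i n) (fun i => (i.*2, (true, M i))) (fun i => (i.*2.+1, (false, Lf i))).

Lemma alt_labels i k : map fst (alt_labelled i k) = iota i.*2 k.*2.
Proof.
rewrite /alt_labelled; elim: k i => [//|k IH] i.
by rewrite doubleS; congr [:: _, _ & _]; exact: (IH i.+1).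
Qed.

Lemma bracket_sym p q : bracket R p q = bracket R q p.
Proof.
rewrite /bracket eq_sym; case: (_ != _) => //=.
by have -> : (p.2 == - q.2 - 1) = (q.2 == - p.2 - 1) by apply/eqP/eqP; lia.
Qed.

Lemma alt_time_ordered : time_ordered (fun a : letter => a.2.1) pair_contr pair_entry (alt_labelled 0 n).
Proof.
have : pairwise (fun a b : letter => (a.1 < b.1)%N) (alt_labelled 0 n).
  by rewrite -(pairwise_map fst ltn) alt_labels -(sorted_pairwise ltn_trans) iota_ltn_sorted.
apply: sub_pairwise => -[i [s m]] [j [t l]] /= ij; apply/implyP; case: s t => [] [] //= _.
  by rewrite /pair_contr /pair_entry inv_plus /= ltnNge (ltnW ij) /= subr0 mulrC.
(* With the minus letter first, the 1 subtracted in [pair_entry] leaves [- u], and the sign in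
   [time_ordered] turns this into the contraction [u] of the minus letter. *)
rewrite /pair_contr /pair_entry inv_minus /= ij (bracket_sym (true, l)).
rewrite addrAC subrr add0r mulrN opprK mulrC /bracket /=.
apply/eqP; case: (m =P - l - 1) => [->|_]; last by rewrite !mul0r.
by congr (_ * u _); ring.
Qed.

(** A plus letter and the minus letter right after it are followed by the same number of plus
    letters, so their contributions cancel. *)
Lemma alt_sign i k : wick_sign (fun a : letter => a.2.1) (alt_labelled i k) = false.
Proof. by rewrite /alt_labelled; elim: k i => [//|k IH] i; have e := IH i.+1; rewrite /= in e; rewrite /= e add0n addFb addbb. Qed.

Lemma word_trace_alternating : word_trace alt_word = word_trace [::] * \det (\matrix_(i < n, j < n)
  (bracket R (true, M i) (false, Lf j) * (1 - u (k0 - M i - 1) - (if (j < i)%N then 1 else 0)))).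
Proof.
pose T (w : seq letter) := word_trace (map snd w).
have -> : word_trace alt_word = T (alt_labelled 0 n) by rewrite /T /alt_labelled map_interleave.
pose x0 : letter := (0%N, (true, 0)).
have same (a b : letter) : a.2.1 = b.2.1 -> pair_contr a b = 0.
  by move=> ab; rewrite /pair_contr /bracket ab eqxx /= mulr0.
have Trec (a : letter) w : odd (size w) -> T (a :: w) =
    \sum_(j < size w) (-1) ^+ j * pair_contr a (nth x0 w j) * T (remove_at j w).
  move=> sw; rewrite /T map_cons (word_trace_rec HV tau0 (true, 0)) ?cyclic_factor_neq1 ?size_map //.
  apply: eq_bigr => j _.
  by rewrite (nth_map x0) // /remove_at map_cat map_take map_drop.
have [hp hm] := filter_interleave (I := nat) (p := fun a : letter => a.2.1) (iota 0 n)
   (a := fun i => (i.*2, (true, M i))) (b := fun i => (i.*2.+1, (false, Lf i))) (fun=> isT) (fun=> isT).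
rewrite (wick_theorem same Trec (n := n) alt_time_ordered); first last.
- by rewrite -size_filter hm size_map size_iota.
- by rewrite -size_filter hp size_map size_iota.
rewrite alt_sign expr0 mul1r hp hm /wick_det; congr (_ * \det _).
apply/matrixP => i j; rewrite !mxE !(nth_map 0%N) ?size_iota // !nth_iota //.
rewrite /pair_entry /= !add0n.
by have -> : (j.*2.+1 < i.*2)%N = (j < i)%N by apply/idP/idP; lia.
Qed.

End AlternatingTrace.

Section NPoint.
Variables (R : realType) (V : vosa (Cplx R)) (psip psim : V).
Local Notation C := (Cplx R).
Hypothesis HV : rank_two_fermion psip psim.
Variables (beta alpha : R) (tau : C).
Hypothesis tau0 : 0 < complex.Im tau.
Local Notation theta := (cexp (- twopii R * ofR alpha)).
Local Notation phi := (cexp (- twopii R * ofR beta)).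
Local Notation lam := (twist phi).
Local Notation kappa := (ofR (beta + 1 / 2)).
Hypothesis theta1 : nrm theta = 1.
Hypothesis lam0 : 0 <= lam.
Hypothesis lam1 : lam < 1.
Hypothesis nz : forall k, 1 - theta^-1 * qpow tau lam k != 0.
Variable k0 : int.
Hypothesis hk0 : - beta = lam + k0%:~R.
Local Notation u := (ucoef theta tau lam).
Local Notation word_trace := (word_trace psip psim beta alpha tau).
Local Notation word_op := (word_op psip psim).
Local Notation L := (width tau).
Local Notation f := (fop psip psim alpha).
Local Notation entry := (entry psip psim beta alpha tau).

Lemma foldr_modes (I : Type) (r : seq I) (xs ys : I -> C) (M Lf : I -> int) v :
  foldr (fun p : (V * C) * int => mode (expop p.1.2 (Lh0 psip psim kappa) p.1.1) p.2) v
    (interleave r (fun i => ((psip, xs i), M i)) (fun i => ((psim, ys i), Lf i))) =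
  (\prod_(i <- r) (cexp (xs i * (2^-1 - kappa)) * cexp (ys i * (2^-1 + kappa)))) *:
    word_op (interleave r (fun i => (true, M i)) (fun i => (false, Lf i))) v.
Proof.
have ep z : expop z (Lh0 psip psim kappa) psip = cexp (z * (2^-1 - kappa)) *: psip.
  by have := expop_psi HV beta true z; rewrite /charge_sign (mul1r kappa).
have em z : expop z (Lh0 psip psim kappa) psim = cexp (z * (2^-1 + kappa)) *: psim.
  by have := expop_psi HV beta false z; rewrite /charge_sign (mulN1r kappa) opprK.
pose F (p : (V * C) * int) : V -> V := mode (expop p.1.2 (Lh0 psip psim kappa) p.1.1) p.2.
rewrite -[LHS]/(foldr F v _); elim: r => [|i r IH]; first by rewrite big_nil scale1r.
rewrite -[LHS]/(F (psip, xs i, M i) (F (psim, ys i, Lf i) (foldr F v (interleave r _ _)))) IH big_cons.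
rewrite !interleave_cons !word_op_cons /F ep em !modeZl !modeZr !scalerA.
by congr (_ *: _); rewrite mulrA.
Qed.

Variables (n : nat) (p : 'rV[C]_(n + n)).

Definition plus_modes (ms : seq int) (i : nat) : int := nth 0 ms i.*2.
Definition minus_modes (ms : seq int) (i : nat) : int := nth 0 ms i.*2.+1.

Definition prefactor (ms : seq int) : C :=
  \prod_(i < n) (cexp (xpt p i * (2^-1 - kappa)) * cexp (ypt p i * (2^-1 + kappa))).

Lemma insertionsE : insertions psip psim p =
  interleave (enum 'I_n) (fun i => (psip, xpt p i)) (fun i => (psim, ypt p i)).
Proof. by []. Qed.

Lemma size_insertions : size (insertions psip psim p) = n.*2.
Proof. by rewrite insertionsE size_interleave size_enum_ord. Qed.

Lemma zip_insertions ms : size ms = n.*2 -> zip (insertions psip psim p) ms =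
  interleave (enum 'I_n) (fun i => ((psip, xpt p i), plus_modes ms i)) (fun i => ((psim, ypt p i), minus_modes ms i)).
Proof.
move=> hs; rewrite {1}(interleave_nth 0 hs) insertionsE -(interleave_enum n (plus_modes ms) (minus_modes ms)).
exact: zip_interleave.
Qed.

Lemma mode_product_entry ms b : size ms = n.*2 ->
  diag_entry psip psim (mode_product psip psim kappa f (insertions psip psim p) tau ms) b =
  prefactor ms * entry (alt_word n (plus_modes ms) (minus_modes ms)) b.
Proof.
move=> hs; rewrite /diag_entry /mode_product (zip_insertions hs) foldr_modes big_enum /=.
rewrite (interleave_enum n (fun i => (true, plus_modes ms i)) (fun i => (false, minus_modes ms i))).
have fZ (a : C) v : f (a *: v) = a *: f v.
  have f0 := linear_map0 (@fop_linear _ _ _ _ HV alpha).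
  by have := @fop_linear _ _ _ _ HV alpha a v 0; rewrite addr0 f0 addr0.
by rewrite fZ (coordZ (fermion_fock HV)); congr (_ * coord_in _ (f _) _).
Qed.

Lemma traceable_mode_product ms : size ms = n.*2 ->
  traceable psip psim (mode_product psip psim kappa f (insertions psip psim p) tau ms).
Proof.
move=> hs; apply: abs_summable_csummable; rewrite (funext (fun b => mode_product_entry b hs)).
by apply: asmZ; exact: abs_summable_entry.
Qed.

Definition coef_plus (i : 'I_n) (m : int) : C := cexp (xpt p i) ^ (- m - 1) * cexp (xpt p i * (2^-1 - kappa)).
Definition coef_minus (i : 'I_n) (m : int) : C := cexp (ypt p i) ^ (- m - 1) * cexp (ypt p i * (2^-1 + kappa)).

(** The case [j < i] is that of y_j standing before x_i in the operator product. *)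
Definition pair_series (i j : 'I_n) (m : int) : C :=
  cexp (ofR (expo lam (k0 - m - 1)) * (xpt p i - ypt p j)) *
  (1 - u (k0 - m - 1) - (if (j < i)%N then 1 else 0)).

(** For dual modes the powers of e^(x_i) and e^(y_j), including the fractional ones from the shifted
    weights, are opposite, so only the difference of the points survives. *)
Lemma coef_pair i j m : coef_plus i m * coef_minus j (- m - 1) =
  cexp (ofR (expo lam (k0 - m - 1)) * (xpt p i - ypt p j)).
Proof.
rewrite /coef_plus /coef_minus -!cexpMz -!cexpD; congr cexp.
rewrite (expo_plus hk0) !(intrB, mulrNz); move: (ofR _) (m%:~R : C) (xpt p i) (ypt p j) => a b x y.
by field.
Qed.

Lemma npoint_termE ms : size ms = n.*2 ->
  npoint_term psip psim kappa f (insertions psip psim p) tau ms =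
  word_trace [::] * \sum_(s : 'S_n) (-1) ^+ s * \prod_(i < n)
    (if plus_modes ms i == - minus_modes ms (s i) - 1 then pair_series i (s i) (plus_modes ms i) else 0).
Proof.
move=> hs; rewrite /npoint_term (STr_scaled HV tau0 (fun b => mode_product_entry b hs)).
rewrite (zip_insertions hs) big_interleave big_enum /= mulrA /prefactor -big_split /=.
rewrite (word_trace_alternating HV tau0 nz hk0) mulrCA; congr (_ * _).
have -> : \prod_(i < n) (cexp (xpt p i) ^ (- plus_modes ms i - 1) * cexp (ypt p i) ^ (- minus_modes ms i - 1) *
      (cexp (xpt p i * (2^-1 - kappa)) * cexp (ypt p i * (2^-1 + kappa)))) =
    (\prod_(i < n) coef_plus i (plus_modes ms i)) * \prod_(i < n) coef_minus i (minus_modes ms i).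
  rewrite -big_split; apply: eq_bigr => i _; rewrite /coef_plus /coef_minus /=.
  exact: mulrACA.
rewrite /determinant mulr_sumr; apply: eq_bigr => s _; rewrite mulrCA; congr (_ * _).
(* In the Leibniz term of [s], row [i] meets column [s i]; the factors of the minus points are
   reordered accordingly. *)
rewrite [X in _ * X * _](reindex_inj (@perm_inj _ s)) /= -!big_split; apply: eq_bigr => i _ /=.
rewrite mxE /bracket /=; case: eqP => [e|_]; last by rewrite mul0r mulr0.
rewrite mul1r /pair_series -coef_pair; congr (_ * coef_minus _ _ * _).
by rewrite e; ring.
Qed.

(** The brackets make each minus mode dual to the plus mode that [s] assigns to it, so only the plus
    modes are free and the sum factorises. *)
Lemma has_csum_pair (s : 'S_n) (P : 'I_n -> 'I_n -> C) :
  (forall i j, has_csum (pair_series i j) (P i j)) ->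
  has_csum (restr [set ms : seq int | size ms = n.*2] (fun ms => \prod_(i < n)
    (if plus_modes ms i == - minus_modes ms (s i) - 1 then pair_series i (s i) (plus_modes ms i) else 0)))
    (\prod_i P i (s i)).
Proof.
(* The minus point [j] is paired with the plus point [s^-1 j], whose mode determines its own. *)
move=> hP; pose h (M : {ffun 'I_n -> int}) : seq int :=
  interleave (enum 'I_n) M (fun j => - M ((s^-1)%g j) - 1).
have hM M (i : 'I_n) : plus_modes (h M) i = M i.
  exact: (nth_interleave_ord 0 M (fun j => - M ((s^-1)%g j) - 1) i).1.
have hL M (i : 'I_n) : minus_modes (h M) i = - M ((s^-1)%g i) - 1.
  exact: (nth_interleave_ord 0 M (fun j => - M ((s^-1)%g j) - 1) i).2.
have sz M : size (h M) = n.*2 by rewrite size_interleave size_enum_ord.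
apply: (has_csum_inj (h := h) _ _ _ (has_csum_ffun (fun i => hP i (s i)))).
- by move=> M M' e; apply/ffunP => i; rewrite -!hM e.
- move=> M; rewrite /restr asboolT //; apply: eq_bigr => i _.
  rewrite hM hL permK; case: eqP => // -[]; ring.
- move=> ms hms; rewrite /restr; case: asboolP => //= sms.
  have [/forallP H|] := boolP [forall i : 'I_n, plus_modes ms i == - minus_modes ms (s i) - 1]; last first.
    by rewrite negb_forall => /existsP[i hi]; rewrite (bigD1 i) //= (negbTE hi) mul0r.
  exfalso; apply: (hms [ffun i : 'I_n => plus_modes ms i]).
  rewrite [RHS](interleave_nth 0 sms) -(interleave_enum n (plus_modes ms) (minus_modes ms)) /h /interleave.
  congr flatten; apply: eq_map => i; rewrite !ffunE; congr [:: _; _].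
  rewrite (eqP (H ((s^-1)%g i))) permKV; ring.
Qed.

Lemma has_csum_npoint (P : 'I_n -> 'I_n -> C) :
  (forall i j, has_csum (pair_series i j) (P i j)) ->
  has_csum (restr [set ms : seq int | size ms = size (insertions psip psim p)]
    (npoint_term psip psim kappa f (insertions psip psim p) tau))
  (word_trace [::] * \det (\matrix_(i, j) P i j)).
Proof.
move=> hP; rewrite size_insertions.
have hs (s : 'S_n) := has_csumZ ((-1) ^+ s) (has_csum_pair s hP).
have -> : \det (\matrix_(i, j) P i j) = \sum_(s : 'S_n) (-1) ^+ s * \prod_i P i (s i).
  by apply: eq_bigr => s _; congr (_ * _); apply: eq_bigr => i _; rewrite mxE.
have := has_csumZ (word_trace [::]) (has_csum_sum (index_enum _) xpredT hs).
apply: has_csum_ext => ms; rewrite /restr; case: asboolP => /= sms; last first.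
  by rewrite big1 ?mulr0 // => s _; rewrite mulr0.
by rewrite npoint_termE.
Qed.

Lemma has_csum_pair_series (i j : 'I_n) :
  ((i <= j)%N -> 0 < complex.Re (xpt p i - ypt p j) < L) ->
  ((j < i)%N -> - L < complex.Re (xpt p i - ypt p j) < 0) ->
  has_csum (pair_series i j) (P1 theta phi tau (xpt p i - ypt p j)).
Proof.
(* This involution passes between the mode number [m] and the summation index of [P1]. *)
move=> h1 h2; have kK : cancel (fun m : int => k0 - m - 1) (fun m => k0 - m - 1) by move=> m; ring.
rewrite /pair_series; case: (ltnP j i) => ij.
  have := has_csumN (has_csum_P1_left theta1 tau0 lam0 lam1 nz (h2 ij)); rewrite opprK.
  move=> /(has_csum_bij kK kK); apply: has_csum_ext => m.
  by rewrite /term_u -mulrN; congr (_ * _); move: (u _) => y; ring.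
have := has_csum_P1_right theta1 tau0 lam0 lam1 nz (h1 ij).
move=> /(has_csum_bij kK kK); apply: has_csum_ext => m.
by rewrite /term_1u subr0.
Qed.

End NPoint.

(** * Real parts in the operator-ordering region *)

Section Region.
Variables (R : realType) (V : vosa (Cplx R)) (psip psim : V).
Local Notation C := (Cplx R).
Variable tau : C.
Hypothesis tau0 : 0 < complex.Im tau.
Local Notation L := (width tau).
Variables (n : nat) (p : 'rV[C]_(n + n)).

(** The ordering makes the real parts decrease along x_1, y_1, x_2, y_2 and so on, while its last
    condition keeps the total drop below [L]. *)
Lemma region_Re (i j : 'I_n) : G_region psip psim tau p ->
  ((i <= j)%N -> 0 < complex.Re (xpt p i - ypt p j) < L) /\
  ((j < i)%N -> - L < complex.Re (xpt p i - ypt p j) < 0).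
Proof.
rewrite /G_region /= /op_ordered.
have -> : unzip2 (insertions psip psim p) = interleave (enum 'I_n) (xpt p) (ypt p).
  by rewrite insertionsE; exact: map_interleave.
set zs := interleave _ _ _ => /andP[hsort hlast].
have nx (k : 'I_n) : nth 0 zs k.*2 = xpt p k := (nth_interleave_ord 0 (xpt p) (ypt p) k).1.
have ny (k : 'I_n) : nth 0 zs k.*2.+1 = ypt p k := (nth_interleave_ord 0 (xpt p) (ypt p) k).2.
have sz : size zs = n.*2 by rewrite size_interleave size_enum_ord.
pose gt (z w : C) : bool := complex.Re w < complex.Re z.
have gtt : transitive gt by move=> y x z h1 h2; exact: lt_trans h2 h1.
have lt_cexp (z w : C) : (`|cexp w| < `|cexp z|) = (complex.Re w < complex.Re z).
  by rewrite !normE ltr_ofR !nrm_cexp ltr_expR.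
have hs : sorted gt zs by apply: sub_sorted hsort => z w; rewrite lt_cexp.
have mono a b : (a < b < n.*2)%N -> complex.Re (nth 0 zs b) < complex.Re (nth 0 zs a).
  move=> /andP[ab bn]; apply: (sorted_ltn_nth gtt 0 hs) => //; rewrite inE sz //.
  exact: ltn_trans ab bn.
have monoe a b : (a <= b < n.*2)%N -> complex.Re (nth 0 zs b) <= complex.Re (nth 0 zs a).
  move=> /andP[]; rewrite leq_eqVlt => /orP[/eqP ->//|ab] bn; apply: ltW; apply: mono; by rewrite ab.
have hl : complex.Re (nth 0 zs 0%N) - L < complex.Re (nth 0 zs n.*2.-1).
  have e : nome tau * cexp (head 0 zs) = cexp (twopii R * tau + head 0 zs) by rewrite cexpD.
  move: hlast; rewrite e lt_cexp Re_D Re_twopii_tau nth0 (last_nth 0).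
  (* The index [i] shows that the list is not empty, so [last] returns a true entry and not its
     default. *)
  have n0 : (0 < n)%N by apply: leq_ltn_trans (ltn_ord i).
  have -> : nth 0 (0 :: zs) (size zs) = nth 0 zs n.*2.-1 by rewrite sz; case: n n0 => //.
  lra.
have bnd a b : (a < b < n.*2)%N -> complex.Re (nth 0 zs a) - complex.Re (nth 0 zs b) < L.
  move=> /andP[ab bn].
  have h1 : complex.Re (nth 0 zs a) <= complex.Re (nth 0 zs 0%N) by apply: monoe; rewrite leq0n (ltn_trans ab).
  have h2 : complex.Re (nth 0 zs n.*2.-1) <= complex.Re (nth 0 zs b).
    by apply: monoe; rewrite prednK ?leqnn ?andbT; lia.
  lra.
rewrite Re_D Re_N -nx -ny; split=> ij.
  have h : (i.*2 < j.*2.+1 < n.*2)%N by have := ltn_ord j; lia.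
  have := mono _ _ h; have := bnd _ _ h => h1 h2; apply/andP; split; lra.
have h : (j.*2.+1 < i.*2 < n.*2)%N by have := ltn_ord i; lia.
have := mono _ _ h; have := bnd _ _ h => h1 h2; apply/andP; split; lra.
Qed.

End Region.

(** * Meromorphy in several variables *)

Section Fractions.
Variables (R : realType) (m : nat).
Local Notation C := (Cplx R).
Implicit Types (f g : 'rV[C]_m -> C) (a h v : 'rV[C]_m).

(* The line through [a] in direction [v] witnesses that the denominator is not
   identically zero near [a]; a common direction makes this stable under products. *)
Definition frac_at v f a : Prop := exists g d : 'rV[C]_m -> C,
  [/\ analytic_at g a, analytic_at d a,
      exists r : R, 0 < r /\ forall t : C, t != 0 -> nrm t < r -> d (a + t *: v) != 0 &
      exists r : R, 0 < r /\ forall h, (forall i, nrm (h 0 i) < r) -> d (a + h) != 0 ->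
        f (a + h) = g (a + h) / d (a + h)].

Lemma frac_analytic v f a : analytic_at f a -> frac_at v f a.
Proof.
move=> hf; exists f, (fun=> 1); split=> //; first exact: analytic_const.
  by exists 1; split=> // t _ _; exact: oner_neq0.
by exists 1; split=> // h _ _; rewrite divr1.
Qed.

(** Sums and products of fractions share the denominator [d1 * d2]; only the numerator [num]
    distinguishes them. *)
Lemma frac_op v (o : C -> C -> C) (num : C -> C -> C -> C -> C) f g a :
  (forall F1 F2 F3 F4 : 'rV[C]_m -> C, analytic_at F1 a -> analytic_at F2 a -> analytic_at F3 a ->
     analytic_at F4 a -> analytic_at (fun p => num (F1 p) (F2 p) (F3 p) (F4 p)) a) ->
  (forall x1 x2 d1 d2 : C, d1 != 0 -> d2 != 0 -> o (x1 / d1) (x2 / d2) = num x1 x2 d1 d2 / (d1 * d2)) ->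
  frac_at v f a -> frac_at v g a -> frac_at v (fun p => o (f p) (g p)) a.
Proof.
move=> hnum ho [g1 [d1 [hg1 hd1 [r1 [r10 H1]] [s1 [s10 S1]]]]] [g2 [d2 [hg2 hd2 [r2 [r20 H2]] [s2 [s20 S2]]]]].
have [r [r0 ra rb]] := min_radius r10 r20; have [s [s0 sa sb]] := min_radius s10 s20.
exists (fun p => num (g1 p) (g2 p) (d1 p) (d2 p)), (fun p => d1 p * d2 p); split.
- exact: hnum.
- exact: analytic_mul.
- exists r; split=> // t t0 tr; rewrite mulf_neq0 // ?H1 ?H2 // ?(lt_le_trans tr) //.
- exists s; split=> // h hs; rewrite mulf_eq0 negb_or => /andP[n1 n2].
  rewrite S1 // ?S2 // ?ho // => i; exact: lt_le_trans (hs i) _.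
Qed.

Lemma frac_mul v f g a : frac_at v f a -> frac_at v g a -> frac_at v (fun p => f p * g p) a.
Proof.
apply: (@frac_op _ (fun x y => x * y) (fun x1 x2 _ _ => x1 * x2)).
  by move=> F1 F2 F3 F4 h1 h2 _ _; exact: analytic_mul.
by move=> x1 x2 d1 d2 h1 h2; rewrite invfM mulrACA.
Qed.

Lemma frac_add v f g a : frac_at v f a -> frac_at v g a -> frac_at v (fun p => f p + g p) a.
Proof.
apply: (@frac_op _ (fun x y => x + y) (fun x1 x2 d1 d2 => x1 * d2 + x2 * d1)).
  by move=> F1 F2 F3 F4 h1 h2 h3 h4; apply: analytic_add; exact: analytic_mul.
by move=> x1 x2 d1 d2 h1 h2; field; rewrite h1 h2.
Qed.

Lemma frac_sum v (I : Type) (r : seq I) (F : I -> 'rV[C]_m -> C) a :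
  (forall i, frac_at v (F i) a) -> frac_at v (fun p => \sum_(i <- r) F i p) a.
Proof.
move=> H; elim: r => [|i r IH].
  rewrite (_ : (fun _ => _) = fun=> 0); first exact/frac_analytic/analytic_const.
  by apply/funext => p; rewrite big_nil.
rewrite (_ : (fun _ => _) = (fun p => F i p + \sum_(j <- r) F j p)); first exact: frac_add.
by apply/funext => p; rewrite big_cons.
Qed.

Lemma frac_prod v (I : Type) (r : seq I) (F : I -> 'rV[C]_m -> C) a :
  (forall i, frac_at v (F i) a) -> frac_at v (fun p => \prod_(i <- r) F i p) a.
Proof.
move=> H; elim: r => [|i r IH].
  rewrite (_ : (fun _ => _) = fun=> 1); first exact/frac_analytic/analytic_const.
  by apply/funext => p; rewrite big_nil.
rewrite (_ : (fun _ => _) = (fun p => F i p * \prod_(j <- r) F j p)); first exact: frac_mul.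
by apply/funext => p; rewrite big_cons.
Qed.

Lemma frac_meromorphic v f : (forall i, nrm (v 0 i) <= 1) -> (forall a, frac_at v f a) -> meromorphic f.
Proof.
move=> hv H a; have [g [d [hg hd [r [r0 Hr]] [s [s0 Hs]]]]] := H a.
exists g, d; split=> //.
  move=> U /nbhs_rowP[t [t0 Ht]]; have [q [q0 qr qt]] := min_radius r0 t0.
  have [x [x0 xq]] := small_point q0.
  exists (a + x *: v); last by apply: Hr => //; exact: lt_le_trans xq qr.
  apply: Ht => i; rewrite mxE nrmM; apply: le_lt_trans (lt_le_trans xq qt).
  by rewrite ler_piMr ?nrm_ge0.
by apply/nbhs_rowP; exists s; split.
Qed.

(** In the direction [v] the denominator, a power of [p 0 i - p 0 j - z0], restricts to [t ^+ k]. *)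
Lemma frac_mero1 v (f : C -> C) (i j : 'I_m) a : v 0 i - v 0 j = 1 ->
  mero_at f (a 0 i - a 0 j) -> frac_at v (fun p => f (p 0 i - p 0 j)) a.
Proof.
move=> vij [hf|[k [g [k0 hg ga [r [r0 H]]]]]]; first exact/frac_analytic/analytic_comp.
set z0 := a 0 i - a 0 j in hg ga H.
exists (fun p => g (p 0 i - p 0 j)), (fun p => (p 0 i - p 0 j - z0) ^+ k); split.
- exact: analytic_comp.
- apply: (analytic_comp (f := fun z => (z - z0) ^+ k)).
  exact: analytic1_exp _ (analytic1_sub (analytic1_id _) (analytic1_const _ _)).
- exists 1; split=> // t t0 _; rewrite !mxE expf_neq0 //.
  have -> : a 0 i + t * v 0 i - (a 0 j + t * v 0 j) - z0 = t * (v 0 i - v 0 j) by rewrite /z0; ring.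
  by rewrite vij mulr1.
- exists (r / 2); split; first by rewrite divr_gt0.
  move=> h hr; rewrite !mxE.
  have -> : a 0 i + h 0 i - (a 0 j + h 0 j) = z0 + (h 0 i - h 0 j) by rewrite /z0; ring.
  rewrite (addrAC z0) subrr add0r expf_eq0 k0 /= => hij; apply: H => //.
  by apply: le_lt_trans (nrmD _ _) _; rewrite nrmN (splitr r) ltrD.
Qed.

End Fractions.

(** * Uniform convergence on compact sets and the determinant formula *)

Section Final.
Variable R : realType.
Local Notation C := (Cplx R).

(** Extrema over a compact set are attained, hence lie strictly inside the interval and leave a
    margin. *)
Lemma compact_Re_range (m : nat) (K : set 'rV[C]_m) (i j : 'I_m) (lo hi : R) : compact K ->
  (forall p, K p -> lo < complex.Re (p 0 i - p 0 j) < hi) ->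
  exists d : R, 0 < d /\ forall p, K p -> lo + d <= complex.Re (p 0 i - p 0 j) <= hi - d.
Proof.
move=> cK H; have [->|K0] := eqVneq K set0; first by exists 1.
pose g (p : 'rV[C]_m) : R := complex.Re (p 0 i - p 0 j).
have cg : continuous g.
  move=> p U /nbhs_ballP[e /= e0 He]; rewrite nbhs_filterE /=; apply/nbhs_rowP.
  exists (e / 2); split; first by rewrite divr_gt0.
  move=> h hh /=; apply: He; rewrite -ball_normE /ball_ /= /g !mxE.
  have -> : p 0 i + h 0 i - (p 0 j + h 0 j) = (p 0 i - p 0 j) + (h 0 i - h 0 j) by ring.
  rewrite (Re_D (p 0 i - p 0 j)) opprD addNKr normrN; apply: le_lt_trans (nrm_Re _) _.
  by apply: le_lt_trans (nrmD _ _) _; rewrite nrmN (splitr e) ltrD.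
have Kne : K !=set0 by apply/set0P.
have [c cK1 hc] := compact_EVT_max Kne cK (continuous_subspaceT cg).
have [b bK1 hb] := compact_EVT_min Kne cK (continuous_subspaceT cg).
have /andP[_ c2] := H c (set_mem cK1); have /andP[b1 _] := H b (set_mem bK1).
have h1 : 0 < hi - g c by rewrite subr_gt0.
have h2 : 0 < g b - lo by rewrite subr_gt0.
have [d [d0 dc db]] := min_radius h1 h2.
exists d; split=> // p Kp; have x := hc p (mem_set Kp); have y := hb p (mem_set Kp).
rewrite -/(g p); apply/andP; split; lra.
Qed.

(** The margin on [K] gives a summable majorant that does not depend on the point. *)
Lemma P1_term_unif (theta phi tau : C) (n : nat) (K : set 'rV[C]_(n + n)) (i j : 'I_n) :
  nrm theta = 1 -> 0 < complex.Im tau -> 0 <= twist phi -> twist phi < 1 ->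
  (forall k, 1 - theta^-1 * qpow tau (twist phi) k != 0) ->
  compact K -> K `<=` P_domain tau ->
  abs_unif_cvg K (fun (k : int) p => P1_term theta phi tau k (xpt p i - ypt p j)).
Proof.
move=> theta1 tau0 lam0 lam1 nz cK hK e /pos_ofR[ee e0].
have [|d [d0 hd]] := compact_Re_range (i := lshift n i) (j := rshift n j) (lo := - width tau) (hi := 0) cK.
  by move=> p /hK/(_ i j); rewrite annulusE.
have [M [M0 hM]] := term_u_bound theta1 tau0 lam0 lam1 nz.
have [A hA] := abs_summable_tail (asmZ (ofR M) (abs_summable_expo lam0 lam1 d0)) e0.
exists A => B /hA hB p Kp; rewrite ee.
have -> : \sum_(k <- B) `|P1_term theta phi tau k (xpt p i - ypt p j)| =
    ofR (\sum_(k <- B) nrm (P1_term theta phi tau k (xpt p i - ypt p j))).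
  by rewrite ofR_sum; apply: eq_bigr => k _; rewrite normE.
rewrite ltr_ofR; apply: le_lt_trans hB; apply: ler_sum => k _.
rewrite nrmM !nrm_ofR (ger0_norm (ltW M0)) (ger0_norm (expR_ge0 _)).
by apply: hM => //; have := hd p Kp; rewrite add0r addrC.
Qed.

End Final.

Theorem proposition6p4 (R : realType) (V : vosa (Cplx R)) (psip psim : V)
    (HV : rank_two_fermion psip psim)
    (n : nat) (n_gt0 : (0 < n)%N) (alpha beta : R)
    (tau : Cplx R) (tau_gt0 : 0 < complex.Im tau) :
  let kappa := ofR (beta + 1 / 2) in
  let f := expop (twopii R * ofR alpha) (mode (heis psip psim) 0) in
  let theta := cexp (- twopii R * ofR alpha) in
  let phi := cexp (- twopii R * ofR beta) in
  (theta, phi) <> (1, 1) ->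
  traceable psip psim (f \o qL psip psim kappa tau) /\
  exists G : 'rV[Cplx R]_(n + n) -> Cplx R,
    [/\ is_G psip psim kappa f tau G,
        forall p, G p =
          \det (P_matrix tau theta phi p) * Z_fun psip psim kappa f tau,
        forall p, P_domain tau p -> analytic_at G p,
        forall p, P_domain tau p ->
          G p = \det (\matrix_(i < n, j < n)
                        P1_series theta phi tau (xpt p i - ypt p j)) *
                Z_fun psip psim kappa f tau &
        forall K : set 'rV[Cplx R]_(n + n),
          compact K -> K `<=` P_domain tau ->
          forall i j : 'I_n,
            abs_unif_cvg K (fun (k : int) p =>
              P1_term theta phi tau k (xpt p i - ypt p j))].
Proof.
move=> kappa f theta phi thetaphi.
have phiE : phi = cexp (twopii R * ofR (- beta)) by rewrite /phi ofRN mulrN mulNr.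
have [lam0 lam1 [k0 hk0]] := twistP (- beta); rewrite -phiE in lam0 lam1 hk0.
have theta1 : nrm theta = 1.
  by rewrite /theta nrm_cexp mulrC Re_ofRM Re_N /= oppr0 mulr0 expR0.
have L0 := width_gt0 tau_gt0.
(* If a denominator vanishes, comparing moduli forces the exponent to be 0. Then q^n = 1 gives
   [theta = 1], and [beta] is an integer, so [phi = 1]. *)
have nz k : 1 - theta^-1 * qpow tau (twist phi) k != 0.
  apply/negP => /eqP/subr0_eq e; apply: thetaphi.
  have := nrm_thq tau (twist phi) theta1 k; rewrite -e nrm1 => /esym e1.
  have ek : expo (twist phi) k = 0.
    move: e1; rewrite -[RHS]expR0 => /expR_inj/eqP; rewrite oppr_eq0 mulf_eq0 (gt_eqF L0) orbF.
    by move/eqP.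
  have q1 : qpow tau (twist phi) k = 1 by rewrite /qpow ek mulr0 mul0r cexp0.
  have th1 : theta = 1 by move: e; rewrite q1 mulr1 => e; rewrite -(invrK theta) -e invr1.
  have ph1 : phi = 1.
    rewrite phiE (_ : - beta = (k0 - k)%:~R) ?ofR_int ?cexp_twopii_int //.
    by rewrite hk0 intrB; move: ek; rewrite /expo; lra.
  by rewrite th1 ph1.
have hdiag b : diag_entry psip psim (f \o qL psip psim kappa tau) b = 1 * entry psip psim beta alpha tau [::] b.
  by rewrite mul1r.
have hZ : Z_fun psip psim kappa f tau = word_trace psip psim beta alpha tau [::].
  by rewrite /Z_fun (STr_scaled HV tau_gt0 hdiag) mul1r.
split.
  by apply: abs_summable_csummable; rewrite (funext hdiag); apply: asmZ; exact: abs_summable_entry.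
have hser (p : 'rV[Cplx R]_(n + n)) : G_region psip psim tau p -> has_csum
    (restr [set ms : seq int | size ms = size (insertions psip psim p)]
      (npoint_term psip psim kappa f (insertions psip psim p) tau))
    (\det (P_matrix tau theta phi p) * Z_fun psip psim kappa f tau).
  move=> hp; rewrite hZ mulrC; apply: (has_csum_npoint HV tau_gt0 nz hk0) => i j.
  have [h1 h2] := region_Re tau_gt0 i j hp.
  exact: (has_csum_pair_series tau_gt0 theta1 lam0 lam1 nz).
have dom (p : 'rV[Cplx R]_(n + n)) i j : P_domain tau p -> - width tau < complex.Re (xpt p i - ypt p j) < 0.
  by move=> /(_ i j); rewrite annulusE.
(* The function is defined by the determinant formula; the content lies in showing that it continues
   the n-point series. *)
exists (fun p => \det (P_matrix tau theta phi p) * Z_fun psip psim kappa f tau); split; [|by []| | |].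
- split=> [p hp|].
    split; last by eexists; exact: hser hp.
    move=> ms hms; exact: (traceable_mode_product HV beta alpha tau_gt0 p (etrans hms (size_insertions psip psim p))).
  split; last first.
    by move=> p /set_mem hp; rewrite /G_series /npoint (csumE (hser p hp)).
  (* In this direction every x_i - y_j moves at unit speed, so one line avoids the zeros of all
     denominators near the point. *)
  apply: (@frac_meromorphic _ _ (row_mx (const_mx 1) 0)) => [i|a].
    by rewrite mxE; case: splitP => k _; rewrite mxE ?nrm1 ?nrm0.
  apply: frac_mul; last exact/frac_analytic/analytic_const.
  apply: (frac_sum (index_enum _) (F := fun (s : 'S_n) p => (-1) ^+ s * \prod_i P_matrix tau theta phi p i (s i))) => s.
  apply: frac_mul; first exact/frac_analytic/analytic_const.
  apply: (frac_prod (index_enum _) (F := fun (i : 'I_n) p => P_matrix tau theta phi p i (s i))) => i.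
  rewrite (_ : (fun _ => _) = (fun p : 'rV[Cplx R]_(n + n) => P1 theta phi tau (p 0 (lshift n i) - p 0 (rshift n (s i))))); last first.
    by apply/funext => p; rewrite mxE.
  apply: frac_mero1; first by rewrite row_mxEl row_mxEr !mxE subr0.
  by have [/meromorphic1P mP _] := P1P theta1 tau_gt0 lam0 lam1 nz.
- move=> p hp; apply: analytic_mul; last exact: analytic_const.
  apply: (analytic_sum (index_enum _) (P := xpredT) (F := fun (s : 'S_n) p => (-1) ^+ s * \prod_i P_matrix tau theta phi p i (s i))) => s _.
  apply: analytic_mul; first exact: analytic_const.
  apply: (analytic_prod (index_enum _) (P := xpredT) (F := fun (i : 'I_n) p => P_matrix tau theta phi p i (s i))) => i _.
  rewrite (_ : (fun _ => _) = (fun p : 'rV[Cplx R]_(n + n) => P1 theta phi tau (p 0 (lshift n i) - p 0 (rshift n (s i))))); last first.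
    by apply/funext => q; rewrite mxE.
  apply: analytic_comp; have /andP[h1 h2] := dom p i (s i) hp.
  have [] // := P1_analytic theta1 tau_gt0 lam0 lam1 nz (z := xpt p i - ypt p (s i)).
    by rewrite ltr0_norm //; lra.
  by rewrite lt_eqF.
- move=> p hp; congr (\det _ * _); apply/matrixP => i j; rewrite !mxE.
  by apply: (P1_left theta1 tau_gt0 lam0 lam1 nz); exact: dom.
- by move=> K cK hK i j; exact: P1_term_unif.
Qed.
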